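(* Let $d>1$, $1\le p<\infty$, let $K\subset\mathbb R^d$ be a proper convex cone, and let $B=L^p\left((0,1]\times\mathbb S^{d-1}\right)$ with norm $\|\cdot\|_p$. Let $j:\mathcal F_{\mathrm{cconv}}(\mathbb R^d)\to B$, $j(x^* )=s_{x^*}(\cdot,\cdot)$, be the support function embedding, and let $\mathcal K=j\left(\mathcal F^K_{\mathrm{cconv}}(\mathbb R^d)\right)$, a proper convex cone in $B$. Let $X^{\mathcal K}_t$, $t\ge0$, be a $B$-valued Lévy process on a probability space $(\Omega,\mathcal E,\mathbf P)$ with generating triplet $(A,\Pi,\gamma)$ such that (a) $A=0$; (b) $\Pi(B\setminus\mathcal K)=0$; (c) there exists a $\Pi$-Pettis centering $\mathcal I_\Pi=\int_{D_0}x\,\Pi(dx)$ with $\gamma-\mathcal I_\Pi\in\mathcal K$; and such that $X^{\mathcal K}_t$ takes values in $\mathcal K$ for all $t\ge0$. Define the $\mathcal F^K_{\mathrm{cconv}}(\mathbb R^d)$-valued process ${X^K_t}^*=j^{-1}(X^{\mathcal K}_t)$, $t\ge0$. Then: (i) The process starts from zero, i.e. ${X^K_0}^*=0$ a.s. (ii) The process has independent and stationary increments of the form $d_p\left({X^K_t}^*,{X^K_s}^*\right)$, $t>s\ge0$; that is, for all $0\le t_0<t_1<\dots<t_n$ the real random variables $d_p\left({X^K_{t_i}}^*,{X^K_{t_{i-1}}}^*\right)$, $i=1,\dots,n$, are independent, and the law of $d_p\left({X^K_t}^*,{X^K_s}^*\right)$ depends only on $t-s$. (iii) The process is stochastically continuous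 with respect to the metric $d_p$: for every $t\ge 0$ and every $\varepsilon>0$, $$\lim_{s\to t}\mathbf P\left(d_p\left({X^K_t}^*,{X^K_s}^*\right)>\varepsilon\right)=0.$$ (iv) The trajectories of the process are a.s. càdlàg, i.e. a.s. they are right-continuous and have left-limits (as functions of $t$ into $\mathcal F^K_{\mathrm{cconv}}(\mathbb R^d)$) with respect to the metric $d_p$.
   Context: Fuzzy vectors. A $d$-dimensional fuzzy vector $x^*$ is identified with its characterizing function $\xi_{x^*}:\mathbb R^d\to[0,1]$, which is required to satisfy: (1) $\operatorname{supp}\xi_{x^*}:=\overline{\{x\in\mathbb R^d:\xi_{x^*}(x)>0\}}$ is bounded; (2) for every $\alpha\in(0,1]$ the $\alpha$-cut $C_\alpha(x^* )=\{x\in\mathbb R^d:\xi_{x^*}(x)\ge\alpha\}$ is non-empty, compact and convex, and so is $C_0(x^* ):=\operatorname{supp}\xi_{x^*}$. The set of all such fuzzy vectors is $\mathcal F_{\mathrm{cconv}}(\mathbb R^d)$, and $\mathcal F^K_{\mathrm{cconv}}(\mathbb R^d)=\{x^*\in\mathcal F_{\mathrm{cconv}}(\mathbb R^d):\operatorname{supp}\xi_{x^*}\subset K\}$. The fuzzy vector $0$ is the one whose characterizing function is the indicator function of $\{0\}\subset\mathbb R^d$. Metric. With $d_H$ the Hausdorff metric (for the Euclidean norm) on non-empty compact convex subsets of $\mathbb R^d$, $$d_p(x^*,y^* )=\left(\int_0^1 d_H\bigl(C_\alpha(x^* ),C_\alpha(y^* )\bigr)^p\,d\alpha\right)^{1/p}.$$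 Support function and embedding. $\mathbb S^{d-1}$ is the Euclidean unit sphere of $\mathbb R^d$. For $x^*\in\mathcal F_{\mathrm{cconv}}(\mathbb R^d)$, $s_{x^*}(\alpha,u)=\sup_{a\in C_\alpha(x^* )}\langle u,a\rangle$ for $\alpha\in(0,1]$, $u\in\mathbb S^{d-1}$. $L^p((0,1]\times\mathbb S^{d-1})$ is the real $L^p$ space with respect to the product of Lebesgue measure on $(0,1]$ and normalized Lebesgue (surface) measure on $\mathbb S^{d-1}$. The map $j$ is injective, and $j^{-1}$ denotes its inverse on its image. Cones. A subset of a real vector space is a convex cone if it is closed under addition and under multiplication by scalars $\lambda>0$. A convex cone $\mathcal C$ is proper if $x\in\mathcal C$ and $-x\in\mathcal C$ imply $x=0$. Lévy processes in $B$. A $B$-valued Lévy process $X_t$, $t\ge0$, is a $B$-valued stochastic process such that $X_0=0$ a.s.; it has independent and stationary increments; it is stochastically continuous, i.e. $\lim_{s\to t}\mathbf P(\|X_t-X_s\|>\varepsilon)=0$ for every $\varepsilon>0$; and its trajectories are a.s. càdlàg with respect to the norm. Its generating triplet $(A,\Pi,\gamma)$ is determined by the Lévy–Khinchin formula: for every $\ell$ in the topological dual $B^*$, $$\mathbf E\, e^{i\ell(X_t)}=\exp\left(t\left(-\tfrac12\langle A\ell,\ell\rangle+i\ell(\gamma)+\int\left(e^{i\ell(x)}-1-i\ell(x)\mathbf 1_{D_0}(x)\right)\Pi(dx)\right)\right),$$ where $D_0=\{x\in B:0<\|x\|\le1\}$, $\gamma\in B$, $A$ is a non-negative self-adjoint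 operator from $B^*$ to $B$, and $\Pi$ is the Lévy measure on $B\setminus\{0\}$, satisfying $\int_{D_0}|\ell(x)|^2\,\Pi(dx)<\infty$ for all $\ell\in B^*$. An element $\mathcal I_\Pi\in B$ is a $\Pi$-Pettis centering, written $\mathcal I_\Pi=\int_{D_0}x\,\Pi(dx)$, if for every $\ell\in B^*$ the integral $\int_{D_0}|\ell(x)|\,\Pi(dx)$ is finite and $\ell(\mathcal I_\Pi)=\int_{D_0}\ell(x)\,\Pi(dx)$. *)

(* Defs.v *)
From HB Require Import structures.
From mathcomp Require Import all_boot all_order all_algebra.
From mathcomp Require Import complex.
From mathcomp Require Import all_classical all_reals all_analysis.
From mathcomp Require Import measurable_realfun.
Set Implicit Arguments.
Unset Strict Implicit.
Unset Printing Implicit Defensive.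
Import Order.TTheory GRing.Theory Num.Theory.
Import numFieldNormedType.Exports.
Local Open Scope classical_set_scope.
Local Open Scope ring_scope.

Definition rV_display : measure_display.
Proof. exact: default_measure_display. Qed.

(* Row vectors carry the product sigma-algebra of their coordinates, i.e. the
   Borel sigma-algebra of the Euclidean space. *)
Section measurable_rV.
Context (R : realType) (n : nat).
Let coor (i : 'I_n) (v : 'rV[R]_n) : R := v 0 i.

Let rV_set0 : g_sigma_preimage coor set0.
Proof. exact: sigma_algebra0. Qed.

Let rV_setC A : g_sigma_preimage coor A -> g_sigma_preimage coor (~` A).
Proof. exact: sigma_algebraC. Qed.

Let rV_bigcup (F : (set 'rV[R]_n)^nat) :
  (forall i, g_sigma_preimage coor (F i)) ->
  g_sigma_preimage coor (\bigcup_i (F i)).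
Proof. exact: sigma_algebra_bigcup. Qed.

HB.instance Definition _ :=
  @isMeasurable.Build rV_display 'rV[R]_n (g_sigma_preimage coor)
    rV_set0 rV_setC rV_bigcup.

Lemma measurable_coor (i : 'I_n) :
  measurable_fun [set: 'rV[R]_n] (fun v => v 0 i : measurableTypeR R).
Proof.
move=> _ Y mY; rewrite setTI; apply: sub_sigma_algebra => /=.
rewrite -bigcup_seq/=; exists i => /=; first by rewrite mem_index_enum.
by exists Y => //; rewrite setTI.
Qed.

Lemma measurable_fun_rV d (T : measurableType d) (f : T -> 'rV[R]_n) :
  (forall i, measurable_fun [set: T] (fun x => f x 0 i : measurableTypeR R)) ->
  measurable_fun [set: T] f.
Proof.
move=> mf _ A mA; rewrite setTI.
pose F' := image_set_system setT f (@measurable d T).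
suff : F' A by rewrite /F' /image_set_system /= setTI.
apply: mA; split; first by
  apply: sigma_algebra_image; exact: sigma_algebra_measurable.
move=> B; rewrite -bigcup_seq => -[i _ /= [C mC <-]].
rewrite /F' /image_set_system /= !setTI -comp_preimage -[X in measurable X]setTI.
exact: mf.
Qed.

End measurable_rV.

Section euclid.
Context (R : realType).

Definition dotv n (u v : 'rV[R]_n) : R := \sum_i u 0 i * v 0 i.
Definition enorm n (u : 'rV[R]_n) : R := Num.sqrt (dotv u u).

Lemma measurable_enorm n :
  measurable_fun [set: 'rV[R]_n] (@enorm n : _ -> measurableTypeR R).
Proof.
rewrite (_ : @enorm n = fun u => dotv u u `^ 2^-1); last first.
  apply/funext => u; rewrite powR12_sqrt//.
  by apply: sumr_ge0 => i _; rewrite -expr2 sqr_ge0.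
apply: (@measurableT_comp _ _ _ _ _ _ (@powR R ^~ 2^-1)) => //.
by apply: measurable_sum => i; apply: measurable_funM; exact: measurable_coor.
Qed.

Definition unit_ball n : set 'rV[R]_n := [set x | enorm x <= 1].

Lemma measurable_unit_ball n : measurable (@unit_ball n).
Proof.
rewrite (_ : @unit_ball n = setT `&` (@enorm n) @^-1` `]-oo, 1]%classic).
  by apply: measurable_enorm => //; exact: measurable_itv.
by apply/seteqP; split => x /=; rewrite in_itv/= => //; case.
Qed.

Definition radial n (x : 'rV[R]_n) : 'rV[R]_n := (enorm x)^-1 *: x.

Lemma measurable_radial n : measurable_fun [set: 'rV[R]_n] (@radial n).
Proof.
apply: measurable_fun_rV => i.
rewrite (_ : (fun x => _) = fun x : 'rV[R]_n => (enorm x) `^ (-1) * x 0 i).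
  apply: measurable_funM; last exact: measurable_coor.
  apply: (@measurableT_comp _ _ _ _ _ _ (@powR R ^~ (-1))) => //.
  exact: measurable_enorm.
by apply/funext => x; rewrite mxE powR_inv1// sqrtr_ge0.
Qed.

(* Prepends the coordinate [z.2] to the vector [z.1]. *)
Definition consv n (z : 'rV[R]_n * measurableTypeR R) : 'rV[R]_n.+1 :=
  row_mx (z.2%:M : 'rV[R]_1) z.1.

Lemma measurable_consv n : measurable_fun [set: _] (@consv n).
Proof.
apply: measurable_fun_rV => i.
have [j ->|j ->] := split_ordP (i : 'I_(1 + n)).
  rewrite (_ : (fun x => _) = snd)//; apply/funext => x.
  transitivity ((x.2%:M : 'M[R]_1) 0 j); first exact: row_mxEl.
  by rewrite ord1 mxE eqxx mulr1n.
rewrite (_ : (fun x => _) = (fun v : 'rV[R]_n => v 0 j) \o fst).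
  by apply: measurableT_comp => //; exact: measurable_coor.
by apply/funext => x; exact: row_mxEr.
Qed.

Section lebesgue_consv.
Context n (m : {measure set 'rV[R]_n -> \bar R}).

Definition lebesgue_consv :=
  pushforward (m \x @lebesgue_measure R)%E (@consv n).

Let mc := @measurable_consv n.

Let lc0 : lebesgue_consv set0 = 0%E.
Proof. exact: measure0. Qed.

Let lc_ge0 A : (0 <= lebesgue_consv A)%E.
Proof. exact: measure_ge0. Qed.

Let lc_sigma_additive : semi_sigma_additive lebesgue_consv.
Proof. exact: measure_semi_sigma_additive. Qed.

HB.instance Definition _ := isMeasure.Build _ _ _ lebesgue_consv
  lc0 lc_ge0 lc_sigma_additive.

End lebesgue_consv.

(* Iterated product measure: [lebesgue_rV m.+1] is the image of
   [lebesgue_rV m \x lebesgue_measure] under [consv]. *)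
Fixpoint lebesgue_rV n : {measure set 'rV[R]_n -> \bar R} :=
  if n is m.+1 then lebesgue_consv (lebesgue_rV m) else \d_(0 : 'rV[R]_0).

Definition sphere n : set 'rV[R]_n := [set u | enorm u = 1].

(* Normalized surface measure, obtained as the normalized cone measure: up to a
   constant factor, the measure of a Borel subset [A] of the sphere is the
   volume of [{r u | 0 < r <= 1, u in A}].  It lives on row vectors and is
   carried by [sphere n] when [0 < n]; the Dirac mass passed to [mnormalize] is
   only used if the unit ball had volume 0 or +oo, which never happens. *)
Section sphere_measure.
Context (n : nat).
Let ball_measure := mrestr (lebesgue_rV n) (@measurable_unit_ball n).
Let cone_measure := pushforward ball_measure (@radial n).
Let mr := @measurable_radial n.

Let cone0 : cone_measure set0 = 0%E.
Proof. exact: measure0. Qed.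

Let cone_ge0 A : (0 <= cone_measure A)%E.
Proof. exact: measure_ge0. Qed.

Let cone_sigma_additive : semi_sigma_additive cone_measure.
Proof. exact: measure_semi_sigma_additive. Qed.

HB.instance Definition _ := isMeasure.Build _ _ _ cone_measure
  cone0 cone_ge0 cone_sigma_additive.

Definition sphere_measure : probability 'rV[R]_n R :=
  mnormalize cone_measure \d_(0 : 'rV[R]_n).

End sphere_measure.

Let measurable_oc01 : measurable (`]0, 1]%classic : set (measurableTypeR R)).
Proof. exact: measurable_itv. Qed.

(* Carried by `]0, 1] x [sphere n], so that L^p of this measure is
   L^p(`]0, 1] x sphere). *)
Definition cyl_measure n :
    {measure set (measurableTypeR R * 'rV[R]_n)%type -> \bar R} :=
  (mrestr (@lebesgue_measure R) measurable_oc01 \x sphere_measure n)%E.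

End euclid.

(* L^p as a normed space: the quotient of [LfunType] by equality almost
   everywhere. (The library's [LspaceType] carries no algebraic or normed
   structure.) *)
Section Lp.
Context d (T : measurableType d) (R : realType).
Context (mu : {measure set T -> \bar R}) (p : R) (p1 : (1 <= p%:E)%E).

Local Notation fT := (LfunType mu p1).
Local Open Scope quotient_scope.

Definition Lp_eq (f g : fT) : bool := `[< f = g %[ae mu] >].

Let Lp_eq_refl : reflexive Lp_eq.
Proof. by move=> f; apply/asboolP; exact: ae_eq_refl. Qed.

Let Lp_eq_sym : symmetric Lp_eq.
Proof.
by move=> f g; apply/idP/idP => /asboolP h; apply/asboolP/ae_eq_sym.
Qed.

Let Lp_eq_trans : transitive Lp_eq.
Proof.
by move=> f g h /asboolP gf /asboolP fh; apply/asboolP/(ae_eq_trans gf fh).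
Qed.

Canonical Lp_equiv := EquivRel Lp_eq Lp_eq_refl Lp_eq_sym Lp_eq_trans.

Definition Lp : Type := {eq_quot Lp_eq}.
HB.instance Definition _ := Choice.on Lp.
HB.instance Definition _ := EqQuotient.on Lp.

Definition Lp_fun (x : Lp) : T -> R := (repr x : fT).

Definition Lp_norm (x : Lp) : R := fine 'N[mu]_p%:E [EFin \o (repr x : fT)]%E.
Definition Lp_zero : Lp := \pi_Lp (0 : fT).
Definition Lp_opp (x : Lp) : Lp := \pi_Lp (- (repr x : fT)).
Definition Lp_add (x y : Lp) : Lp := \pi_Lp ((repr x : fT) + (repr y : fT)).
Definition Lp_scale (a : R) (x : Lp) : Lp := \pi_Lp (a *: (repr x : fT)).

Lemma Lp_piP (f g : fT) : \pi_Lp f = \pi_Lp g <-> f = g %[ae mu].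
Proof.
split => [/eqP|h]; first by rewrite eqmodE => /asboolP.
by apply/eqP; rewrite eqmodE; apply/asboolP.
Qed.

Lemma Lp_repr_pi (f : fT) : (repr (\pi_Lp f) : fT) = f %[ae mu].
Proof. by apply/Lp_piP; rewrite reprK. Qed.

Lemma Lp_addE f g : Lp_add (\pi_Lp f) (\pi_Lp g) = \pi_Lp (f + g).
Proof.
apply/Lp_piP; move: (Lp_repr_pi f) (Lp_repr_pi g).
apply: filterS2 => t hf hg tD.
exact: (congr2 +%R (hf tD) (hg tD)).
Qed.

Lemma Lp_oppE f : Lp_opp (\pi_Lp f) = \pi_Lp (- f).
Proof.
apply/Lp_piP; move: (Lp_repr_pi f).
apply: filterS => t hf tD; exact: (congr1 -%R (hf tD)).
Qed.

Lemma Lp_scaleE a f : Lp_scale a (\pi_Lp f) = \pi_Lp (a *: f).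
Proof.
apply/Lp_piP; move: (Lp_repr_pi f).
apply: filterS => t hf tD; exact: (congr1 ( *:%R a) (hf tD)).
Qed.

Let addA : associative Lp_add.
Proof.
elim/quotW => f; elim/quotW => g; elim/quotW => h.
by rewrite (Lp_addE g h) (Lp_addE f) (Lp_addE f g) (Lp_addE (f + g)) addrA.
Qed.

Let addC : commutative Lp_add.
Proof.
by elim/quotW => f; elim/quotW => g; rewrite (Lp_addE f g) (Lp_addE g f) addrC.
Qed.

Let add0 : left_id Lp_zero Lp_add.
Proof. by elim/quotW => f; rewrite (Lp_addE 0 f) add0r. Qed.

Let addN : left_inverse Lp_zero Lp_opp Lp_add.
Proof. by elim/quotW => f; rewrite (Lp_oppE f) (Lp_addE (- f)) addNr. Qed.

HB.instance Definition _ := GRing.isZmodule.Build Lp addA addC add0 addN.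

Let scaleA a b x : Lp_scale a (Lp_scale b x) = Lp_scale (a * b) x.
Proof.
elim/quotW: x => f.
by rewrite (Lp_scaleE b f) (Lp_scaleE a) (Lp_scaleE (a * b) f) scalerA.
Qed.

Let scale1 : left_id 1 Lp_scale.
Proof. by elim/quotW => f; rewrite (Lp_scaleE 1 f) scale1r. Qed.

Let scaleDr : right_distributive Lp_scale +%R.
Proof.
move=> a; elim/quotW => f; elim/quotW => g.
rewrite (Lp_scaleE a f) (Lp_scaleE a g) -[RHS]/(Lp_add _ _) (Lp_addE (a *: f)).
by rewrite -[_ + _]/(Lp_add _ _) (Lp_addE f g) (Lp_scaleE a) scalerDr.
Qed.

Let scaleDl x : {morph Lp_scale^~ x : a b / a + b}.
Proof.
move=> a b; elim/quotW: x => f.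
rewrite (Lp_scaleE a f) (Lp_scaleE b f) (Lp_scaleE (a + b) f) scalerDl.
exact/esym/Lp_addE.
Qed.

HB.instance Definition _ := GRing.Zmodule_isLmodule.Build R Lp
  scaleA scale1 scaleDr scaleDl.

Lemma Lp_normE f : Lp_norm (\pi_Lp f) = fine 'N[mu]_p%:E [EFin \o f]%E.
Proof.
have mpow (h : fT) : measurable_fun setT (fun x => `|(EFin \o h) x|%E `^ p)%E.
  rewrite (_ : (fun x => _) = EFin \o (fun x => `|h x| `^ p)); last first.
    by apply/funext.
  apply/measurable_EFinP.
  apply: (@measurableT_comp _ _ _ _ _ _ (@powR R ^~ p)) => //.
  exact: measurableT_comp.
rewrite /Lp_norm; congr fine; rewrite unlock.
apply: (congr1 (fun z => z `^ p^-1)%E).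
apply: ae_eq_integral => //; try exact: mpow.
move: (Lp_repr_pi f); apply: filterS => t hf _ /=.
by rewrite hf.
Qed.

Let norm_triangle x y : Lp_norm (x + y) <= Lp_norm x + Lp_norm y.
Proof.
elim/quotW: x => f; elim/quotW: y => g.
rewrite -[_ + _ in leLHS]/(Lp_add _ _) (Lp_addE f g) !Lp_normE.
exact: ler_LnormD.
Qed.

Let norm_scale a x : Lp_norm (a *: x) = `|a| * Lp_norm x.
Proof.
elim/quotW: x => f.
rewrite -[_ *: _]/(Lp_scale _ _) (Lp_scaleE a f) !Lp_normE.
by rewrite LnormZ -finite_norm_fine.
Qed.

Let norm_eq0 x : Lp_norm x = 0 -> x = 0.
Proof.
elim/quotW: x => f; rewrite Lp_normE => /fine_Lnormr_eq0 f0.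
by apply/Lp_piP.
Qed.

HB.instance Definition _ := Lmodule_isNormed.Build R Lp
  norm_triangle norm_scale norm_eq0.
End Lp.

Section fuzzy_vectors.
Context (R : realType) (n : nat).
Implicit Types (xi eta : 'rV[R]_n -> R) (A B K : set 'rV[R]_n).

Definition alpha_cut xi (a : R) : set 'rV[R]_n := [set x | a <= xi x].

Definition fsupp xi : set 'rV[R]_n := closure [set x | 0 < xi x].

Definition Fcconv : set ('rV[R]_n -> R) := [set xi |
  [/\ forall x, 0 <= xi x <= 1,
      bounded_set (fsupp xi),
      forall a : R, 0 < a <= 1 ->
        [/\ alpha_cut xi a !=set0, compact (alpha_cut xi a) &
            convex_set (alpha_cut xi a)] &
      [/\ fsupp xi !=set0, compact (fsupp xi) & convex_set (fsupp xi)]]].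

Definition FcconvK K : set ('rV[R]_n -> R) :=
  [set xi | Fcconv xi /\ fsupp xi `<=` K].

Definition fuzzy0 : 'rV[R]_n -> R := \1_[set 0].

Definition hausdorff_dist A B : R :=
  Num.max (sup [set inf [set enorm (a - b) | b in B] | a in A])
          (sup [set inf [set enorm (a - b) | a in A] | b in B]).

Definition dp (p : R) xi eta : R :=
  (\int[@lebesgue_measure R]_(a in `]0, 1])
     (hausdorff_dist (alpha_cut xi a) (alpha_cut eta a) `^ p)) `^ p^-1.

Definition support_fun xi (z : measurableTypeR R * 'rV[R]_n) : R :=
  sup [set dotv z.2 a | a in alpha_cut xi z.1].

Context (p : R) (p1 : (1 <= p%:E)%E).

Definition LpB : normedModType R := Lp (@cyl_measure R n) p1.

(* [support_fun xi] is only meaningful on `]0, 1] x sphere, outside of which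
   [cyl_measure] vanishes. There it is bounded and jointly measurable whenever
   [Fcconv xi], so the class below exists; it is clearly unique. *)
Definition support_embed xi : LpB :=
  xget 0 [set b : LpB | Lp_fun b = support_fun xi %[ae @cyl_measure R n]].

Definition support_embed_inv (b : LpB) : 'rV[R]_n -> R :=
  'pinv_(fun=> fuzzy0) Fcconv support_embed b.

Definition cone_embed K : set LpB := support_embed @` FcconvK K.

End fuzzy_vectors.
Arguments support_embed {R n p} p1 xi.
Arguments support_embed_inv {R n p} p1 b.
Arguments cone_embed {R n p} p1 K.

Definition proper_convex_cone (R : realType) (V : lmodType R) (C : set V) :=
  [/\ forall x y, C x -> C y -> C (x + y),
      forall (l : R) x, 0 < l -> C x -> C (l *: x) &
      forall x, C x -> C (- x) -> x = 0].

Section processes.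
Context (R : realType) d (Omega : measurableType d) (P : probability Omega R).

Section increments.
Context d' (T : measurableType d').

(* Taking some of the [A i] to be [setT] yields the product rule for every
   subfamily. *)
Definition mutually_independent (I : finType) (Y : I -> Omega -> T) :=
  (forall i, measurable_fun setT (Y i)) /\
  forall A : I -> set T, (forall i, measurable (A i)) ->
    P (\bigcap_i (Y i @^-1` A i)) = (\prod_i P (Y i @^-1` A i))%E.

(* [D s t] is the increment between the times [s] and [t]. *)
Definition independent_increments (D : R -> R -> Omega -> T) :=
  forall (n : nat) (t : nat -> R), 0 <= t 0 ->
    (forall i, (i < n)%N -> t i < t i.+1) ->
    mutually_independent (fun i : 'I_n => D (t i) (t i.+1)).

Definition stationary_increments (D : R -> R -> Omega -> T) :=
  forall s t s' t' : R, 0 <= s < t -> 0 <= s' < t' -> t - s = t' - s' ->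
    forall A, measurable A -> P (D s t @^-1` A) = P (D s' t' @^-1` A).
End increments.

(* [D t s] is the distance between the states at times [t] and [s]. *)
Definition stochastically_continuous (D : R -> R -> Omega -> R) :=
  forall t : R, 0 <= t -> forall eps : R, 0 < eps ->
    P [set w | eps < D t s w] @[s --> within [set s | 0 <= s] (nbhs t)]
      --> 0%E.

(* Cadlag paths on [0, +oo[ for the metric [D], with left limits in [S]. *)
Definition cadlag (V : Type) (S : set V) (D : V -> V -> R) (x : R -> V) :=
  (forall t : R, 0 <= t -> D (x s) (x t) @[s --> t^'+] --> 0) /\
  (forall t : R, 0 < t -> exists2 l, S l & D (x s) l @[s --> t^'-] --> 0).

Section levy.
Context (B : normedModType R).

Definition Borel := g_sigma_algebraType (@open B).

Record levy_process (X : R -> Omega -> B) : Prop := {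
  levy_random : forall t : R, 0 <= t ->
    measurable_fun setT (X t : Omega -> Borel);
  levy_start : {ae P, forall w, X 0 w = 0};
  levy_indep : independent_increments
    (fun s t w => X t w - X s w : Borel);
  levy_stationary : stationary_increments
    (fun s t w => X t w - X s w : Borel);
  levy_stoch_cont : stochastically_continuous
    (fun t s w => `|X t w - X s w|);
  levy_cadlag : {ae P, forall w,
    cadlag setT (fun b c : B => `|b - c|) (X ^~ w)} }.

Definition topdual (l : B -> R) := linear (l : B -> R^o) /\ continuous l.

Definition D0 : set B := [set x | 0 < `|x| <= 1].

(* Operators from the topological dual of [B] to [B] are encoded as functions
   of [B -> R], whose values outside of [topdual] are irrelevant. *)
Record covariance_operator (A : (B -> R) -> B) : Prop := {
  cov_linear : forall (a : R) l m, topdual l -> topdual m ->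
    A (fun x => a * l x + m x) = a *: A l + A m;
  cov_selfadjoint : forall l m, topdual l -> topdual m -> m (A l) = l (A m);
  cov_nonneg : forall l, topdual l -> 0 <= l (A l) }.

(* A measure on [B] minus the origin, seen as a measure on [B] without mass at
   the origin. *)
Record levy_measure (Pi : {measure set Borel -> \bar R}) : Prop := {
  levy_measure0 : Pi [set 0] = 0%E;
  levy_measure_away : forall r : R, 0 < r ->
    (Pi [set x : B | (r < `|x|)%R] < +oo)%E;
  levy_measure_D0 : forall l, topdual l ->
    (\int[Pi]_(x in D0) (l x ^+ 2)%:E < +oo)%E }.

Definition cis (x : R) : R[i] := (cos x +i* sin x)%C.

Definition cexp (z : R[i]) : R[i] :=
  ((expR (complex.Re z))%:C * cis (complex.Im z))%C.

Definition cintegral d' (T : measurableType d')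
    (mu : {measure set T -> \bar R}) (f : T -> R[i]) : R[i] :=
  ((\int[mu]_x complex.Re (f x)) +i* (\int[mu]_x complex.Im (f x)))%C.

Definition levy_exponent (A : (B -> R) -> B)
    (Pi : {measure set Borel -> \bar R}) (gamma : B) (l : B -> R) : R[i] :=
  (- (2^-1 * l (A l)) +i* l gamma)%C
  + cintegral Pi (fun x : Borel =>
      cis (l x) - 1 - (0 +i* (l x * \1_D0 x))%C).

Record generating_triplet (X : R -> Omega -> B) (A : (B -> R) -> B)
    (Pi : {measure set Borel -> \bar R}) (gamma : B) : Prop := {
  triplet_cov : covariance_operator A;
  triplet_levy : levy_measure Pi;
  triplet_formula : forall l (t : R), topdual l -> 0 <= t ->
    cintegral P (fun w => cis (l (X t w))) =
    cexp (t%:C%C * levy_exponent A Pi gamma l) }.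

Definition Pettis_centering (Pi : {measure set Borel -> \bar R}) (I : B) :=
  forall l, topdual l ->
    (\int[Pi]_(x in D0) `|l x|%:E < +oo)%E /\
    l I = \int[Pi]_(x in D0) l x.

End levy.
End processes.

(* Main.v *)
Require Import Defs.
From HB Require Import structures.
From mathcomp Require Import all_boot all_order all_algebra.
From mathcomp Require Import complex.
From mathcomp Require Import all_classical all_reals all_analysis.
From mathcomp Require Import measurable_realfun.
From mathcomp Require Import ring lra.
Set Implicit Arguments.
Unset Strict Implicit.
Unset Printing Implicit Defensive.
Import Order.TTheory GRing.Theory Num.Theory.
Import numFieldNormedType.Exports.
Local Open Scope classical_set_scope.
Local Open Scope ring_scope.

(* On the image of [j] the metric [dp] and the norm are comparable: since support
   functions are Lipschitz on the sphere, with constants bounded by their sup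
   norms, and every spherical cap of radius [r] has measure at least [c r > 0], the
   sup over the sphere of a difference of support functions is controlled by
   its [L^p] norm up to a small multiple of the norms of the two functions.
   Hence norm convergence implies [dp] convergence, uniformly on bounded sets;
   this yields stochastic continuity and right-continuity. Moreover
   [dp xi eta] is a Borel function of [j xi - j eta], so independence and
   stationarity pass from the increments of [X] to their [dp] lengths.

   The left limits are the delicate point, because [K] need not be closed.
   Almost surely the increments of [X] between rational times lie in the cone
   [cone_embed p1 K] (by stationarity, as [X 0 = 0]), so along rationals
   increasing to [t] the path is a series of elements of the cone, bounded above
   by the value of the path at a rational time after [t]. Peeling off a point of
   the [1]-cut of each term makes the support functions monotone, which forces
   the base points, and then the support functions, to converge. The alpha-cuts
   of the limit are infinite Minkowski sums of subsets of [K], and a convergent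
   series of vectors of a convex cone has its sum in the cone: the tail lies in
   the span of finitely many terms and is absorbed into their coefficients. *)

(** * Euclidean geometry and support functions *)

(** The two distances treat directions differently: [dp] takes a supremum over the sphere, the norm
    an [L^p] mean. A difference of support functions is not a support function, so its Lipschitz
    constant is bounded only by the sum of those of the two terms, not by its own size; hence the
    small multiple of the two norms in the comparison. What survives subtraction is collected in
    [regular]. Elements of [B] are classes, whereas cuts are pointwise data. Support functions are
    Lipschitz in the direction but only left-continuous in the level; a cap times an interval of
    levels ending at the given one has positive measure, so values can still be read off a class. In
    the left limit base points are needed because support functions change sign: adding an element
    of the cone need not increase them. A point of the [1]-cut lies in every cut, so subtracting it
    makes all levels nonnegative at once. The [L^1] masses of the recentred functions are then
    monotone and bounded, hence Cauchy; as the path is Cauchy too, so are the base points. *)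

Section euclidean.
Context (R : realType) (n : nat).
Implicit Types u v w x y : 'rV[R]_n.

Lemma dotvC u v : dotv u v = dotv v u.
Proof. by apply: eq_bigr => i _; rewrite mulrC. Qed.

Lemma dotvDl u v w : dotv (u + v) w = dotv u w + dotv v w.
Proof. by rewrite -big_split; apply: eq_bigr => i _; rewrite mxE mulrDl. Qed.

Lemma dotvZl a u v : dotv (a *: u) v = a * dotv u v.
Proof. by rewrite mulr_sumr; apply: eq_bigr => i _; rewrite mxE mulrA. Qed.

Lemma dotvDr u v w : dotv u (v + w) = dotv u v + dotv u w.
Proof. by rewrite dotvC dotvDl !(dotvC u). Qed.

Lemma dotvZr a u v : dotv u (a *: v) = a * dotv u v.
Proof. by rewrite dotvC dotvZl dotvC. Qed.

Lemma dotvNl u v : dotv (- u) v = - dotv u v.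
Proof. by rewrite -scaleN1r dotvZl mulN1r. Qed.

Lemma dotvNr u v : dotv u (- v) = - dotv u v.
Proof. by rewrite dotvC dotvNl dotvC. Qed.

Lemma dotvBl u v w : dotv (u - v) w = dotv u w - dotv v w.
Proof. by rewrite dotvDl dotvNl. Qed.

Lemma dotvBr u v w : dotv u (v - w) = dotv u v - dotv u w.
Proof. by rewrite dotvDr dotvNr. Qed.

Lemma dot0v u : dotv 0 u = 0.
Proof. by rewrite -(scale0r (0 : 'rV[R]_n)) dotvZl mul0r. Qed.

Lemma dotv0 u : dotv u 0 = 0.
Proof. by rewrite dotvC dot0v. Qed.

Lemma dotv_sumr I (r : seq I) (P : pred I) u (f : I -> 'rV[R]_n) :
  dotv u (\sum_(i <- r | P i) f i) = \sum_(i <- r | P i) dotv u (f i).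
Proof.
by elim/big_rec2: _ => [|i a b _ <-]; [exact: dotv0 | exact: dotvDr].
Qed.

Lemma dotv_ge0 u : 0 <= dotv u u.
Proof. by apply: sumr_ge0 => i _; rewrite -expr2 sqr_ge0. Qed.

Lemma enorm_ge0 u : 0 <= enorm u. Proof. exact: sqrtr_ge0. Qed.

Lemma sqr_enorm u : enorm u ^+ 2 = dotv u u.
Proof. by rewrite sqr_sqrtr// dotv_ge0. Qed.

Lemma ler_coord_enorm u i : `|u 0 i| <= enorm u.
Proof.
rewrite -sqrtr_sqr ler_wsqrtr// /dotv (bigD1 i)//= -expr2 lerDl.
by apply: sumr_ge0 => j _; rewrite -expr2 sqr_ge0.
Qed.

Lemma enorm0_eq0 u : enorm u = 0 -> u = 0.
Proof.
move=> u0; apply/rowP => i; rewrite mxE; apply/eqP; rewrite -normr_le0.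
by rewrite -u0 ler_coord_enorm.
Qed.

Lemma enorm0 : enorm (0 : 'rV[R]_n) = 0.
Proof. by rewrite /enorm dot0v sqrtr0. Qed.

Lemma enorm_gt0 u : u != 0 -> 0 < enorm u.
Proof.
by move=> u0; rewrite lt0r enorm_ge0 andbT; apply: contra_neq u0 => /enorm0_eq0.
Qed.

Lemma enormZ a u : enorm (a *: u) = `|a| * enorm u.
Proof. by rewrite /enorm dotvZl dotvZr mulrA -expr2 sqrtrM ?sqr_ge0// sqrtr_sqr. Qed.

Lemma enormN u : enorm (- u) = enorm u.
Proof. by rewrite -scaleN1r enormZ normrN normr1 mul1r. Qed.

Lemma enorm_distC u v : enorm (u - v) = enorm (v - u).
Proof. by rewrite -enormN opprB. Qed.

Lemma ler_dotv_enorm u v : `|dotv u v| <= enorm u * enorm v.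
Proof.
rewrite -(ler_pXn2r (n:=2))// ?nnegrE ?mulr_ge0 ?enorm_ge0//.
rewrite exprMn !sqr_enorm real_normK ?num_real//.
have [->|v0] := eqVneq v 0; first by rewrite !dotv0 expr0n mulr0.
have vv0 : 0 < dotv v v by rewrite -sqr_enorm exprn_gt0// enorm_gt0.
(* This vector is [<v, v>] times the component of [u] orthogonal to [v]; with the names set below,
   its squared norm is [c (a c - b^2)]. *)
have := dotv_ge0 (dotv v v *: u - dotv u v *: v).
rewrite dotvBl !dotvBr !dotvZl !dotvZr (dotvC v u).
set a := dotv u u; set b := dotv u v; set c := dotv v v => h.
have : 0 <= c * (a * c - b ^+ 2) by apply: le_trans h _; rewrite le_eqVlt; apply/orP; left; apply/eqP; ring.
by rewrite pmulr_rge0// subr_ge0.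
Qed.

Lemma dotv_le u v : dotv u v <= enorm u * enorm v.
Proof. exact: le_trans (ler_norm _) (ler_dotv_enorm _ _). Qed.

Lemma ler_enormD u v : enorm (u + v) <= enorm u + enorm v.
Proof.
rewrite -(ler_pXn2r (n:=2))// ?nnegrE ?addr_ge0 ?enorm_ge0//.
rewrite sqrrD !sqr_enorm dotvDl !dotvDr (dotvC v u).
have := dotv_le u v; lra.
Qed.

Lemma ler_enorm_add x u v : enorm (u - v) <= enorm (u - x) + enorm (x - v).
Proof. by rewrite -(subrKA x u (- v)) ler_enormD. Qed.

Lemma ler_enorm_dist u v : `|enorm u - enorm v| <= enorm (u - v).
Proof.
have h1 := ler_enormD (u - v) v; have h2 := ler_enormD (v - u) u.
by rewrite ler_norml; move: h1 h2; rewrite !subrK (enorm_distC v u); lra.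
Qed.

Lemma enorm_le_coord u h : (forall i, `|u 0 i| <= h) -> 0 <= h -> enorm u <= n%:R * h.
Proof.
move=> uh h0; rewrite -(ler_pXn2r (n:=2))// ?nnegrE ?mulr_ge0 ?enorm_ge0//.
rewrite sqr_enorm exprMn; apply: (@le_trans _ _ (\sum_(i < n) h ^+ 2)).
  apply: ler_sum => i _; rewrite -expr2 -(real_normK (num_real _)).
  by rewrite ler_pXn2r// nnegrE.
rewrite sumr_const card_ord -[leLHS]mulr_natl ler_wpM2r ?sqr_ge0// -natrX ler_nat.
by case: (n) => // k; rewrite leq_pmulr.
Qed.

Lemma ler_coord_norm u i : `|u 0 i| <= `|u|.
Proof.
rewrite [leRHS]/Num.norm /= mx_normrE; apply/bigmax_geP; right => /=.
by exists (0, i).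
Qed.

Lemma norm_le_enorm u : `|u| <= enorm u.
Proof.
rewrite [leLHS]/Num.norm /= mx_normrE; apply/bigmax_leP; split => [|[i j] _] /=.
  exact: enorm_ge0.
by rewrite ord1 ler_coord_enorm.
Qed.

Lemma enorm_le_norm u : enorm u <= n%:R * `|u|.
Proof. by apply: enorm_le_coord => // i; exact: ler_coord_norm. Qed.

(** Neighbourhoods of row vectors are those of the max norm, so the Euclidean bound costs a factor
    [n]. *)
Lemma lipschitz_enorm_continuous (f : 'rV[R]_n -> R) (M : R) :
  (forall u v, `|f u - f v| <= M * enorm (u - v)) -> continuous f.
Proof.
move=> fM u; apply/(@cvgrPdist_lt _ _ _ (nbhs u)) => e e0.
have M1 : 0 < `|M| * n%:R + 1 by rewrite ltr_wpDl// mulr_ge0.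
apply/(@nbhs_normP R 'rV[R]_n); exists (e / (`|M| * n%:R + 1)) => /=; first by rewrite divr_gt0.
move=> v /=; rewrite ltr_pdivlMr// => uv.
apply: le_lt_trans (fM _ _) _; apply: le_lt_trans uv.
apply: (@le_trans _ _ (`|M| * (n%:R * `|u - v|))).
  apply: le_trans (ler_wpM2r (enorm_ge0 _) (ler_norm M)) _.
  by rewrite ler_wpM2l// enorm_le_norm.
by rewrite mulrA mulrC ler_wpM2l// lerDl.
Qed.

Lemma continuous_dotv u : continuous (dotv u).
Proof.
apply: (@lipschitz_enorm_continuous _ (enorm u)) => v w.
by rewrite -dotvBr ler_dotv_enorm.
Qed.

Lemma continuous_enorm : continuous (@enorm R n).
Proof.
by apply: (@lipschitz_enorm_continuous _ 1) => v w; rewrite mul1r ler_enorm_dist.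
Qed.

End euclidean.

(** * Support functions, nearest points and separation *)

Section convexity.
Context (R : realType) (n : nat).
Implicit Types (u v w x y : 'rV[R]_n) (C D : set 'rV[R]_n).

Lemma convex_setP C : convex_set C <->
  forall x y (t : R), C x -> C y -> 0 <= t <= 1 -> C (t *: x + (1 - t) *: y).
Proof.
split => [cC x y t Cx Cy /andP[t0 t1]|cC x y t /set_mem Cx /set_mem Cy].
  exact/set_mem/(cC x y (Itv01 t0 t1))/mem_set/Cy/mem_set.
by apply/mem_set; apply: cC => //; rewrite ge0 le1.
Qed.

Definition convex_body C := [/\ C !=set0, compact C & convex_set C].

(** Taken at every vector and not only on the sphere: homogeneity, the value 0 at the origin and a
    global Lipschitz bound are then available. *)
Definition suppf C u : R := sup [set dotv u a | a in C].

Lemma closed_dotv_le u r : closed [set x | dotv u x <= r].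
Proof.
rewrite (_ : [set x | _] = dotv u @^-1` [set y | y <= r])//.
by apply: preimage_closed; [move=> x _; exact: continuous_dotv | exact: closed_le].
Qed.

Lemma compact_enorm_bounded C : compact C -> exists2 M, 0 <= M & forall a, C a -> enorm a <= M.
Proof.
move=> /compact_bounded[M [_ CM]]; exists (n%:R * (`|M| + 1)); first by rewrite mulr_ge0// addr_ge0.
move=> a Ca; apply: le_trans (enorm_le_norm a) _; rewrite ler_wpM2l//.
by apply: (CM (`|M| + 1)) => //; rewrite ltr_pwDr// ler_norm.
Qed.

Lemma enorm_bounded_compact C M : closed C -> (forall a, C a -> enorm a <= M) -> compact C.
Proof.
move=> cC CM; apply: bounded_closed_compact => //; exists M; split; first exact: num_real.
by move=> r Mr x /CM xM; apply: le_trans (norm_le_enorm _) _; apply: le_trans xM (ltW Mr).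
Qed.

Section support.
Context (C : set 'rV[R]_n) (C0 : C !=set0) (cC : compact C).

Lemma suppf_attained u : exists2 a, C a & dotv u a = suppf C u.
Proof.
have [|c /set_mem Cc cmax] := @EVT_max_rV _ _ (dotv u) C C0 cC.
  by apply: continuous_subspaceT; exact: continuous_dotv.
exists c => //; apply/esym/le_anti/andP; split.
  by apply: ge_sup; [exists (dotv u c), c | move=> _ [a Ca <-]; exact/cmax/mem_set].
apply: ub_le_sup; last by exists c.
by exists (dotv u c) => _ [a Ca <-]; exact/cmax/mem_set.
Qed.

Lemma suppf_ub u a : C a -> dotv u a <= suppf C u.
Proof.
move=> Ca; have [M M0 CM] := compact_enorm_bounded cC.
apply: ub_le_sup; last by exists a.
exists (enorm u * M) => _ [b Cb <-].
by apply: le_trans (dotv_le _ _) _; rewrite ler_wpM2l ?enorm_ge0 ?CM.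
Qed.

Lemma suppf_le u r : (forall a, C a -> dotv u a <= r) -> suppf C u <= r.
Proof. by move=> Cr; have [a /Cr + <-] := suppf_attained u. Qed.

Lemma suppfZ t u : 0 <= t -> suppf C (t *: u) = t * suppf C u.
Proof.
move=> t0; apply/le_anti/andP; split.
  by apply: suppf_le => a Ca; rewrite dotvZl ler_wpM2l// suppf_ub.
by have [a Ca <-] := suppf_attained u; rewrite -dotvZl suppf_ub.
Qed.

Lemma suppf_lip u v M : (forall a, C a -> enorm a <= M) ->
  `|suppf C u - suppf C v| <= M * enorm (u - v).
Proof.
move=> CM; wlog uv : u v / suppf C v <= suppf C u.
  move=> h; have [/h//|/ltW/h] := leP (suppf C v) (suppf C u).
  by rewrite distrC enorm_distC.
rewrite ger0_norm ?subr_ge0//; have [a Ca <-] := suppf_attained u.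
have := suppf_ub v Ca; have := dotv_le (u - v) a; rewrite dotvBl.
have := ler_wpM2l (enorm_ge0 (u - v)) (CM _ Ca); lra.
Qed.

Lemma suppfN u : - suppf C (- u) <= suppf C u.
Proof.
have [a Ca <-] := suppf_attained (- u).
by rewrite dotvNl opprK suppf_ub.
Qed.

Lemma exists_proj x : exists2 c, C c & forall b, C b -> enorm (x - c) <= enorm (x - b).
Proof.
have [|c /set_mem Cc cmin] := @EVT_min_rV _ _ (fun b => enorm (x - b)) C C0 cC.
  apply: continuous_subspaceT; apply: (@lipschitz_enorm_continuous _ _ _ 1) => u v.
  apply: le_trans (ler_enorm_dist _ _) _.
  by rewrite opprB addrC subrKA mul1r enorm_distC.
by exists c => // b Cb; exact/cmin/mem_set.
Qed.

Hypothesis convC : convex_set C.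

Lemma proj_dotv x c : C c -> (forall b, C b -> enorm (x - c) <= enorm (x - b)) ->
  forall b, C b -> dotv (x - c) (b - c) <= 0.
Proof.
move=> Cc cmin b Cb; rewrite leNgt; apply/negP => h.
set g := dotv _ _ in h; set q := dotv (b - c) (b - c).
have q0 : 0 <= q by exact: dotv_ge0.
(* Moving from [c] towards [b] by [t] changes the squared distance to [x] by [t (t q - 2 g)]. Here
   [t q <= g], so the change is negative; the extra [g] in the denominator keeps [t <= 1] and covers
   [q = 0]. *)
pose t : R := g / (g + q).
have t0 : 0 < t by rewrite divr_gt0// ltr_wpDr.
have t1 : t <= 1 by rewrite ler_pdivrMr ?mul1r ?lerDl// ltr_wpDr.
have /cmin : C (t *: b + (1 - t) *: c) by apply: (convex_setP C).1 => //; rewrite (ltW t0).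
have -> : x - (t *: b + (1 - t) *: c) = (x - c) - t *: (b - c).
  by apply/rowP => i; rewrite !mxE; ring.
rewrite -(ler_pXn2r (n:=2)) ?nnegrE ?enorm_ge0// !sqr_enorm.
have -> (a e : 'rV[R]_n) : dotv (a - t *: e) (a - t *: e) =
    dotv a a - t * (2 * dotv a e) + t * (t * dotv e e).
  by rewrite dotvBl !dotvBr !dotvZl !dotvZr (dotvC e a); ring.
rewrite -/g -/q => H; have {H} : t * (2 * g) <= t * (t * q) by lra.
rewrite ler_pM2l// /t -mulrAC ler_pdivlMr; last by rewrite ltr_wpDr.
nra.
Qed.

(** The normal direction at the nearest point realises the distance exactly. This equality, stronger
    than separation, is what turns bounds on support functions into bounds on distances. *)
Lemma suppf_separation x : ~ C x ->
  exists c u, [/\ C c, enorm u = 1, dotv u x - suppf C u = enorm (x - c) &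
    0 < enorm (x - c)].
Proof.
move=> Cx; have [c Cc cmin] := exists_proj x.
have xc : 0 < enorm (x - c).
  by apply: enorm_gt0; apply/negP => /eqP/subr0_eq xc; apply: Cx; rewrite xc.
exists c, ((enorm (x - c))^-1 *: (x - c)); split => //.
  by rewrite enormZ ger0_norm ?invr_ge0 ?enorm_ge0// mulVf// gt_eqF.
have -> : suppf C ((enorm (x - c))^-1 *: (x - c)) = dotv ((enorm (x - c))^-1 *: (x - c)) c.
  apply/le_anti/andP; split; last exact: suppf_ub.
  apply: suppf_le => b Cb; rewrite !dotvZl ler_wpM2l ?invr_ge0 ?enorm_ge0//.
  by have := proj_dotv Cc cmin Cb; rewrite dotvBr subr_le0.
by rewrite -dotvBr dotvZl -sqr_enorm expr2 mulKf// gt_eqF.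
Qed.

Lemma suppf_mem x : (forall u, enorm u = 1 -> dotv u x <= suppf C u) -> C x.
Proof.
move=> h; apply: contrapT => /suppf_separation[c [u [_ u1 + c0]]].
by have := h _ u1; lra.
Qed.

End support.

Lemma suppf_inj C D : convex_body C -> convex_body D ->
  (forall u, enorm u = 1 -> suppf C u = suppf D u) -> C = D.
Proof.
move=> [C0 cC xC] [D0 cD xD] CD; apply/seteqP; split => x Cx.
  by apply: suppf_mem => // u u1; rewrite -CD// suppf_ub.
by apply: suppf_mem => // u u1; rewrite CD// suppf_ub.
Qed.

Lemma suppf1 x u : suppf [set x] u = dotv u x.
Proof. by rewrite /suppf image_set1 sup1. Qed.

End convexity.

(** * Hausdorff distance and Minkowski series *)

Section hausdorff.
Context (R : realType) (n : nat).
Implicit Types (u v w x y : 'rV[R]_n) (C D : set 'rV[R]_n).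

Lemma inf_dist_le C x c : C c -> inf [set enorm (x - b) | b in C] <= enorm (x - c).
Proof.
move=> Cc; apply: ge_inf; last by exists c.
by exists 0 => _ [b _ <-]; exact: enorm_ge0.
Qed.

Lemma inf_dist_attained C x : convex_body C ->
  exists2 c, C c & inf [set enorm (x - b) | b in C] = enorm (x - c).
Proof.
move=> [C0 cC _]; have [c Cc cmin] := exists_proj C0 cC x; exists c => //.
apply/le_anti; rewrite inf_dist_le//= lb_le_inf//; first by exists (enorm (x - c)), c.
by move=> _ [b Cb <-]; exact: cmin.
Qed.

Lemma inf_dist_le_sup C D a : convex_body C -> convex_body D -> C a ->
  inf [set enorm (a - b) | b in D] <=
  sup [set inf [set enorm (a - b) | b in D] | a in C].
Proof.
move=> [_ cC _] bD Ca; apply: ub_le_sup; last by exists a.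
have [M M0 CM] := compact_enorm_bounded cC; have [[d Dd] _ _] := bD.
exists (M + enorm d) => _ [b Cb <-]; apply: le_trans (inf_dist_le _ Dd) _.
by rewrite -(enormN d); apply: le_trans (ler_enormD _ _) _; rewrite lerD2r CM.
Qed.

Lemma suppf_sub_le C D u : convex_body C -> convex_body D -> enorm u = 1 ->
  suppf C u - suppf D u <= sup [set inf [set enorm (a - b) | b in D] | a in C].
Proof.
move=> bC bD u1; have [C0 cC _] := bC; have [D0 cD _] := bD.
have [a Ca <-] := suppf_attained C0 cC u.
have [d Dd ad] := inf_dist_attained a bD.
apply: le_trans (inf_dist_le_sup bC bD Ca); rewrite ad.
have := dotv_le u (a - d); have := suppf_ub cD u Dd.
rewrite dotvBr u1; lra.
Qed.

Lemma sup_inf_dist_le C D r : convex_body C -> convex_body D -> 0 <= r ->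
  (forall u, enorm u = 1 -> suppf C u - suppf D u <= r) ->
  sup [set inf [set enorm (a - b) | b in D] | a in C] <= r.
Proof.
move=> [C0 cC _] [D0 cD xD] r0 CDr; apply: ge_sup.
  by case: C0 => a Ca; eexists; exists a.
move=> _ [a Ca <-]; have [Da|Da] := pselect (D a).
  by apply: le_trans (inf_dist_le _ Da) _; rewrite subrr enorm0.
have [c [u [Dc u1 uc _]]] := suppf_separation D0 cD xD Da.
apply: le_trans (inf_dist_le _ Dc) _; rewrite -uc.
by have := CDr _ u1; have := suppf_ub cC u Ca; lra.
Qed.

Lemma hausdorff_distE C D : hausdorff_dist C D =
  Num.max (sup [set inf [set enorm (a - b) | b in D] | a in C])
          (sup [set inf [set enorm (a - b) | b in C] | a in D]).
Proof.
congr (Num.max _ (sup _)); apply: eq_imagel => b _; congr inf.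
by apply: eq_imagel => a _; rewrite enorm_distC.
Qed.

Lemma hausdorff_distC C D : hausdorff_dist C D = hausdorff_dist D C.
Proof. by rewrite !hausdorff_distE maxC. Qed.

Lemma hausdorff_ge C D u : convex_body C -> convex_body D -> enorm u = 1 ->
  `|suppf C u - suppf D u| <= hausdorff_dist C D.
Proof.
move=> bC bD u1; rewrite hausdorff_distE le_max !ler_norml.
have := suppf_sub_le bC bD u1; have := suppf_sub_le bD bC u1.
set a := sup _; set b := sup _ => h1 h2; apply/orP.
by have [|] := leP (suppf C u) (suppf D u) => h; [right|left]; apply/andP; split; lra.
Qed.

Lemma hausdorff_le C D r : convex_body C -> convex_body D -> 0 <= r ->
  (forall u, enorm u = 1 -> `|suppf C u - suppf D u| <= r) ->
  hausdorff_dist C D <= r.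
Proof.
move=> bC bD r0 CDr; rewrite hausdorff_distE ge_max.
apply/andP; split; apply: sup_inf_dist_le => // u /CDr; rewrite ler_norml.
  by move=> /andP[].
by move=> /andP[]; lra.
Qed.

Lemma sup_nonneg (E : set R) : (forall r, E r -> 0 <= r) -> 0 <= sup E.
Proof.
move=> E0; have [hE|/sup_out->//] := pselect (has_sup E).
have [[x Ex] ubE] := hE; exact: le_trans (E0 _ Ex) (ub_le_sup ubE Ex).
Qed.

Lemma hausdorff_ge0 C D : 0 <= hausdorff_dist C D.
Proof.
rewrite hausdorff_distE le_max; apply/orP; left; apply: sup_nonneg => _ [a _ <-].
have [->|D0] := eqVneq D set0; first by rewrite image_set0 inf0.
by apply: lb_le_inf; [exact/image_nonempty/set0P | move=> _ [b _ <-]; exact: enorm_ge0].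
Qed.

End hausdorff.

(** * Infinite Minkowski sums as intersections of half-spaces *)

Section minkowski_series.
Context (R : realType) (n : nat).
Implicit Types (u v w x y : 'rV[R]_n) (C : set 'rV[R]_n) (D : nat -> set 'rV[R]_n).

Definition msum C C' : set 'rV[R]_n := [set z.1 + z.2 | z in C `*` C'].

Lemma convex_body_msum C C' : convex_body C -> convex_body C' -> convex_body (msum C C').
Proof.
move=> [[c Cc] cC xC] [[c' Cc'] cC' xC']; split.
- by exists (c + c'); exists (c, c').
- apply: continuous_compact; last exact: compact_setX.
  by apply: continuous_subspaceT => z; exact: add_continuous.
- apply/convex_setP => _ _ t [[x x'] [/= Cx Cx'] <-] [[y y'] [/= Cy Cy'] <-] t01.
  exists (t *: x + (1 - t) *: y, t *: x' + (1 - t) *: y').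
    by split; [exact: (convex_setP C).1|exact: (convex_setP C').1].
  by rewrite /= !scalerDr addrACA.
Qed.

Lemma suppf_msum C C' u : convex_body C -> convex_body C' ->
  suppf (msum C C') u = suppf C u + suppf C' u.
Proof.
move=> bC bC'; have [S0 cS _] := convex_body_msum bC bC'.
have [C0 cC _] := bC; have [C'0 cC' _] := bC'.
apply/le_anti/andP; split.
  by apply: suppf_le => // _ [[x y] [/= Cx C'y] <-]; rewrite dotvDr lerD// suppf_ub.
have [a Ca <-] := suppf_attained C0 cC u.
have [b C'b <-] := suppf_attained C'0 cC' u.
by rewrite -dotvDr; apply: suppf_ub => //; exists (a, b).
Qed.

(** When [T] is the sum of a series of support functions, this set plays the role of the infinite
    Minkowski sum. *)
Definition halfspaces (T : 'rV[R]_n -> R) : set 'rV[R]_n :=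
  [set x | forall u, dotv u x <= T u].

Lemma closed_halfspaces T : closed (halfspaces T).
Proof.
rewrite (_ : halfspaces T = \bigcap_u [set x | dotv u x <= T u]).
  by apply: closed_bigI => u _; exact: closed_dotv_le.
by apply/seteqP; split => [x Tx u _|x Tx u]; exact: Tx.
Qed.

Lemma convex_halfspaces T : convex_set (halfspaces T).
Proof.
apply/convex_setP => x y t Tx Ty /andP[t0 t1] u.
by rewrite dotvDr !dotvZr; have := Tx u; have := Ty u; nra.
Qed.

Lemma dotv_delta i x : dotv (delta_mx 0 i) x = x 0 i.
Proof.
rewrite /dotv (bigD1 i)//= big1 ?addr0; first by rewrite mxE !eqxx mul1r.
by move=> j ji; rewrite mxE (negbTE ji) andbF mul0r.
Qed.

(** The half-spaces in the directions of the basis vectors and their opposites already bound every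
    coordinate, whatever [T] is. *)
Lemma compact_halfspaces T : compact (halfspaces T).
Proof.
pose h i := `|T (delta_mx 0 i)| + `|T (- delta_mx 0 i)|.
have h0 i : 0 <= h i by rewrite addr_ge0.
apply: (@enorm_bounded_compact _ _ _ (n%:R * \sum_i h i)); first exact: closed_halfspaces.
move=> x Tx; apply: enorm_le_coord; last exact: sumr_ge0.
move=> i; apply: (@le_trans _ _ (h i)).
  have := Tx (delta_mx 0 i); have := Tx (- delta_mx 0 i).
  rewrite dotvNl dotv_delta => h1 h2.
  have := ler_norm (T (delta_mx 0 i)); have := ler_norm (T (- delta_mx 0 i)).
  have := normr_ge0 (T (delta_mx 0 i)); have := normr_ge0 (T (- delta_mx 0 i)).
  by rewrite /h ler_norml => ? ? ? ?; apply/andP; split; lra.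
by rewrite (bigD1 i)//= lerDl sumr_ge0.
Qed.

Lemma cvg_le_const (a : nat -> R) l r : a @ \oo --> l -> (forall k, a k <= r) -> l <= r.
Proof.
move=> al ar; rewrite -(cvg_lim _ al)//; apply: limr_le; first by apply/cvg_ex; exists l.
exact: nearW.
Qed.

Section series.
Context D (T : 'rV[R]_n -> R) (c : nat -> 'rV[R]_n) (zc : 'rV[R]_n).
Hypotheses (bD : forall i, convex_body (D i)) (Dc : forall i, D i (c i))
  (cvg_c : forall u, \sum_(i < k) dotv u (c i) @[k --> \oo] --> dotv u zc)
  (cvg_T : forall u, \sum_(i < k) suppf (D i) u @[k --> \oo] --> T u).

(** The point is the sum of the [a i] for [i < k] and of the base points [c i] from [k] on. It stays
    below [T] because replacing the remaining base points by maximisers can only increase the value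
    at [u]. *)
Lemma series_halfspaces k (a : nat -> 'rV[R]_n) : (forall i, D i (a i)) ->
  halfspaces T (\sum_(i < k) (a i - c i) + zc).
Proof.
move=> Da u; rewrite dotvDr dotv_sumr -lerBrDr.
have incr : nondecreasing_seq (fun k => \sum_(i < k) (suppf (D i) u - dotv u (c i))).
  apply/nondecreasing_seqP => m; rewrite big_ord_recr/= lerDl subr_ge0.
  by apply: suppf_ub => //; have [] := bD m.
apply: (@le_trans _ _ (\sum_(i < k) (suppf (D i) u - dotv u (c i)))).
  by apply: ler_sum => i _; rewrite dotvBr lerD2r suppf_ub//; have [] := bD i.
have hl : \sum_(i < k) (suppf (D i) u - dotv u (c i)) @[k --> \oo] --> T u - dotv u zc.
  by under eq_fun do rewrite sumrB; apply: cvgB; [exact: cvg_T|exact: cvg_c].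
rewrite -(cvg_lim _ hl)//; apply: nondecreasing_cvgn_le => //.
by apply/cvg_ex; eexists; exact: hl.
Qed.

Lemma convex_body_halfspaces : convex_body (halfspaces T).
Proof.
split; [|exact: compact_halfspaces|exact: convex_halfspaces].
by have := series_halfspaces 0 Dc; rewrite big_ord0 add0r; exists zc.
Qed.

(** The value [T u] is approached by points that maximise [u] in the first [k] summands and are base
    points afterwards. *)
Lemma suppf_halfspaces u : suppf (halfspaces T) u = T u.
Proof.
have [H0 cH _] := convex_body_halfspaces.
apply/le_anti/andP; split; first by apply: suppf_le => // x; exact.
have /choice[a Da] : forall i, exists a, D i a /\ dotv u a = suppf (D i) u.
  by move=> i; have [D0 cD _] := bD i; have [a Da au] := suppf_attained D0 cD u; exists a.
apply: (@cvg_le_const (fun k => dotv u (\sum_(i < k) (a i - c i) + zc))) => [|k]; last first.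
  by apply: suppf_ub => //; apply: series_halfspaces => i; case: (Da i).
have aE k : dotv u (\sum_(i < k) (a i - c i) + zc) =
    \sum_(i < k) suppf (D i) u - \sum_(i < k) dotv u (c i) + dotv u zc.
  rewrite dotvDr dotv_sumr -sumrB; congr (_ + _).
  by apply: eq_bigr => i _; rewrite dotvBr (Da i).2.
under eq_fun do rewrite aE.
rewrite -[T u](subrK (dotv u zc)); apply: cvgD; last exact: cvg_cst.
by apply: cvgB; [exact: cvg_T|exact: cvg_c].
Qed.

End series.

(* Points are split off one at a time: with [Tn k] the tails of the series,
   [halfspaces (Tn k)] is the Minkowski sum of [D k] and [halfspaces (Tn k.+1)],
   both sides being convex bodies with the same support function. *)
Lemma halfspaces_decomp D T (c : nat -> 'rV[R]_n) zc z :
  (forall i, convex_body (D i)) -> (forall i, D i (c i)) ->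
  (forall u, \sum_(i < k) dotv u (c i) @[k --> \oo] --> dotv u zc) ->
  (forall u, \sum_(i < k) suppf (D i) u @[k --> \oo] --> T u) ->
  halfspaces T z ->
  exists2 d : nat -> 'rV[R]_n, forall i, D i (d i) &
    forall u, \sum_(i < k) dotv u (d i) @[k --> \oo] --> dotv u z.
Proof.
move=> bD Dc cvg_c cvg_T Tz.
pose Tn k u := T u - \sum_(i < k) suppf (D i) u.
pose zn k := zc - \sum_(i < k) c i.
have shift (F : nat -> R) k m : \sum_(i < k) F (m + i)%N = \sum_(i < m + k) F i - \sum_(i < m) F i.
  by rewrite big_split_ord/= addrAC subrr add0r.
have cvg_cn m u : \sum_(i < k) dotv u (c (m + i)%N) @[k --> \oo] --> dotv u (zn m).
  rewrite /zn dotvBr dotv_sumr.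
  under eq_fun do rewrite (shift (fun i => dotv u (c i))).
  apply: cvgB; last exact: cvg_cst.
  under eq_fun do rewrite addnC.
  by have := cvg_c u; rewrite -(cvg_shiftn m).
have cvg_Tn m u : \sum_(i < k) suppf (D (m + i)%N) u @[k --> \oo] --> Tn m u.
  rewrite /Tn; under eq_fun do rewrite (shift (fun i => suppf (D i) u)).
  apply: cvgB; last exact: cvg_cst.
  under eq_fun do rewrite addnC.
  by have := cvg_T u; rewrite -(cvg_shiftn m).
have bT m := convex_body_halfspaces (fun i => bD (m + i)%N) (fun i => Dc (m + i)%N) (cvg_cn m) (cvg_Tn m).
have sT m := suppf_halfspaces (fun i => bD (m + i)%N) (fun i => Dc (m + i)%N) (cvg_cn m) (cvg_Tn m).
have step (m : nat) e : exists e', halfspaces (Tn m) e ->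
    D m (e - e') /\ halfspaces (Tn m.+1) e'.
  have [Te|Te] := pselect (halfspaces (Tn m) e); last by exists 0.
  have [S0 cS xS] := convex_body_msum (bD m) (bT m.+1).
  have [[a b] [/= Da Tb] <-] : msum (D m) (halfspaces (Tn m.+1)) e.
    apply: suppf_mem => // u u1; rewrite suppf_msum// sT /Tn big_ord_recr/=.
    by have := Te u; rewrite /Tn; lra.
  by exists b => _; rewrite addrK.
have /choice[g gP] : forall me : nat * 'rV[R]_n, exists e', halfspaces (Tn me.1) me.2 ->
    D me.1 (me.2 - e') /\ halfspaces (Tn me.1.+1) e'.
  by move=> [m e]; exact: step.
(* [e k] is what remains of [z] once [k] points have been split off. *)
pose e := fix e k := if k is k'.+1 then g (k', e k') else z.
have eP k : halfspaces (Tn k) (e k).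
  elim: k => [u|k ih]; last exact: (gP (k, e k) ih).2.
  by rewrite /Tn big_ord0 subr0; exact: Tz.
exists (fun k => e k - e k.+1) => [k|u]; first exact: (gP (k, e k) (eP k)).1.
have -> : (fun k => \sum_(i < k) dotv u (e i - e i.+1)) = (fun k => dotv u z - dotv u (e k)).
  apply/funext; elim=> [|k ih]; first by rewrite big_ord0 subrr.
  by rewrite big_ord_recr/= ih dotvBr; lra.
rewrite -[X in _ --> X]subr0; apply: cvgB; first exact: cvg_cst.
(* [e k] lies in the [k]-th tail body, so [dotv u (e k)] is squeezed by the tails in the directions
   [u] and [- u]. *)
have T0 v : Tn k v @[k --> \oo] --> 0.
  by rewrite -(subrr (T v)); apply: cvgB; [exact: cvg_cst|exact: cvg_T].
apply: (@squeeze_cvgr _ _ _ _ (fun k => - Tn k (- u)) (fun k => Tn k u)) => //.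
  apply: nearW => k; have := eP k u; have := eP k (- u).
  by rewrite dotvNl => h1 ->; rewrite andbT; lra.
by rewrite -oppr0; apply: cvgN.
Qed.

End minkowski_series.

Section cone_series.
Context (R : realType) (n : nat).

(* The tail of the series lies in the span of finitely many terms and is
   small, so it can be absorbed into their (positive) coefficients: the cone
   need not be closed. *)
Lemma cone_series (K : set 'rV[R]_n) (v : nat -> 'rV[R]_n) z :
  (forall x y, K x -> K y -> K (x + y)) ->
  (forall (l : R) x, 0 < l -> K x -> K (l *: x)) ->
  (forall i, K (v i)) ->
  (forall u, \sum_(i < k) dotv u (v i) @[k --> \oo] --> dotv u z) -> K z.
Proof.
move=> KD KZ Kv vz.
pose V m : 'M[R]_(m, n) := \matrix_(i < m) v i.
have vV m i : (i < m)%N -> (v i <= V m)%MS.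
  move=> im; rewrite (_ : v i = row (Ordinal im) (V m)) ?row_sub//.
  by rewrite rowK.
(* With [m] maximising the rank, the first [m] vectors span all the others. *)
have [m mmax] : exists m, forall k, (\rank (V k) <= \rank (V m))%N.
  have ex0 : exists r, `[< exists m, \rank (V m) = r >] by exists (\rank (V 0)); apply/asboolP; exists 0.
  have bd r : `[< exists m, \rank (V m) = r >] -> (r <= n)%N.
    by move=> /asboolP[m <-]; exact: rank_leq_col.
  case: (ex_maxnP ex0 bd) => r /asboolP[m <-] h; exists m => k.
  by apply: h; apply/asboolP; exists k.
have vVm i : (v i <= V m)%MS.
  have VV : (V m <= V (maxn m i.+1))%MS.
    by apply/row_subP => j; rewrite rowK vV// leq_max ltn_ord.
  apply: (@submx_trans _ _ _ _ _ _ (V (maxn m i.+1))); first by rewrite vV// leq_max ltnSn orbT.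
  by rewrite -(geq_leqif (mxrank_leqif_sup VV)) mmax.
pose x k := \sum_(i < k) v i.
have xz u : dotv u (x k) @[k --> \oo] --> dotv u z.
  by under eq_fun do rewrite /x dotv_sumr; exact: vz.
have mulE p (w : 'rV[R]_n) (B : 'M[R]_(n, p)) j : (w *m B) 0 j = dotv (col j B)^T w.
  by rewrite mxE; apply: eq_bigr => i _; rewrite !mxE mulrC.
have xV k : (x k <= V m)%MS by apply: summx_sub.
(* Membership in the row space is the vanishing of finitely many linear forms, the columns of the
   cokernel matrix, so it passes from the partial sums to the limit. *)
have zV : (z <= V m)%MS.
  rewrite submxE; apply/eqP/rowP => j; rewrite mulE mxE.
  have := xz (col j (cokermx (V m)))^T.
  under eq_fun => k do rewrite -mulE (eqP (_ : x k *m cokermx (V m) == 0)) -?submxE// mxE.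
  by move=> /(cvg_lim (@norm_hausdorff _ _)) <-; rewrite lim_cst.
(* Coordinates of the tail on the first [m] vectors, through a linear map that does not depend on
   [k]; they tend to 0 with the tail. *)
pose c k : 'rV[R]_m := (z - x k) *m pinvmx (V m).
have c0 i : c k 0 i @[k --> \oo] --> 0.
  rewrite (_ : (fun k => _) = fun k => dotv (col i (pinvmx (V m)))^T z - dotv (col i (pinvmx (V m)))^T (x k)).
    by rewrite -[X in _ --> X](subrr (dotv (col i (pinvmx (V m)))^T z)); apply: cvgB => //; exact: cvg_cst.
  by apply/funext => k; rewrite /c mulE dotvBr.
have [k [mk ck]] : exists k, (m < k)%N /\ forall i, -1 < c k 0 i.
  have : \forall k \near \oo, forall i, -1 < c k 0 i.
    have h i : \forall k \near \oo, -1 < c k 0 i by apply: (cvgr_gt _ (c0 i)); rewrite ltrN10.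
    have := @filter_forall _ 'I_m (fun i k => -1 < c k 0 i) \oo _; exact.
  move=> [N _ hN]; exists (maxn N m.+1); split; first by rewrite leq_max ltnSn orbT.
  by apply: hN => /=; rewrite leq_max leqnn.
pose a (i : nat) : R := if insub i is Some j then 1 + c k 0 j else 1.
have a0 i : 0 < a i.
  by rewrite /a; case: insubP => // j _ _; have := ck j; lra.
have -> : z = \sum_(i < k) a i *: v i.
  have -> : z = (z - x k) + x k by rewrite subrK.
  have -> : z - x k = c k *m V m.
    by rewrite /c mulmxKpV// addmx_sub// (eqmx_opp (x k)).
  rewrite mulmx_sum_row /x -[k](subnKC (ltnW mk)) !big_split_ord/= subnKC 1?ltnW//.
  rewrite addrA -big_split/=; congr (_ + _); apply: eq_bigr => i _.
    by rewrite rowK /a insubT//= => im; rewrite [RHS]scalerDl scale1r addrC; congr (_ + c k 0 _ *: _); apply: val_inj.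
  by rewrite /a insubN ?scale1r// -leqNgt leq_addr.
(* The cone need not contain 0, so the sum must have at least one term. *)
have k0 : (0 < k)%N by exact: leq_ltn_trans mk.
clearbody a; clear c c0 mk ck; case: k k0 => // k _.
elim: k => [|k ih]; first by rewrite big_ord_recr big_ord0/= add0r; exact: KZ.
by rewrite big_ord_recr/=; apply: KD => //; exact: KZ.
Qed.

End cone_series.

(** * The measure of spherical caps *)

Section boxes.
Context (R : realType).

Definition cube n (a : 'rV[R]_n) (h : R) : set 'rV[R]_n :=
  [set x | forall i, a 0 i - h <= x 0 i <= a 0 i + h].

Lemma measurable_cube n a h : measurable (@cube n a h).
Proof.
rewrite (_ : cube a h = \bigcap_(i in [set: 'I_n])
    (setT `&` (fun v : 'rV[R]_n => v 0 i : measurableTypeR R) @^-1` `[a 0 i - h, a 0 i + h]%classic)).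
  apply: fin_bigcap_measurable; first exact: finite_finset.
  by move=> i _; apply: measurable_coor => //; exact: measurable_itv.
apply/seteqP; split => [x ax i _|x ax i]; first by split => //=; rewrite in_itv/=; exact: ax.
by have [_] := ax i I; rewrite /= in_itv.
Qed.

Lemma consv0 n (z : 'rV[R]_n * measurableTypeR R) : consv z 0 0 = z.2.
Proof.
rewrite (_ : 0 = @lshift 1 n 0); last exact: val_inj.
transitivity ((z.2%:M : 'M[R]_1) 0 0); first exact: row_mxEl.
by rewrite mxE eqxx mulr1n.
Qed.

Lemma consv_rshift n (z : 'rV[R]_n * measurableTypeR R) i :
  consv z 0 (@rshift 1 n i) = z.1 0 i.
Proof. exact: row_mxEr. Qed.

Lemma consv_cube n (a : 'rV[R]_n.+1) h :
  @consv R n @^-1` cube a h =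
  cube (\row_i a 0 (@rshift 1 n i)) h `*` `[a 0 0 - h, a 0 0 + h]%classic.
Proof.
apply/seteqP; split => [z az|z [/= za z0] i].
  split => /= [i|]; first by rewrite mxE -consv_rshift; exact: az.
  by rewrite in_itv/= -consv0; exact: az.
have [j ->|j ->] := split_ordP (i : 'I_(1 + n)); last first.
  by have := za j; rewrite mxE consv_rshift.
have -> : @lshift 1 n j = 0 by apply: val_inj; rewrite /= ord1.
by rewrite consv0; move: z0; rewrite in_itv.
Qed.

(** Half-width 0 is allowed: in positive dimension it shows that the origin is a null set. *)
Lemma lebesgue_rV_cube n (a : 'rV[R]_n) h : 0 <= h ->
  lebesgue_rV R n (cube a h) = ((2 * h) ^+ n)%:E.
Proof.
move=> h0; elim: n a => [|n ih] a.
  rewrite /= /dirac indicE mem_set// => i; by case: i.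
rewrite [LHS]/= /lebesgue_consv /pushforward consv_cube product_measure1E//; last exact: measurable_cube.
have lE : lebesgue_measure (`[a 0 0 - h, a 0 0 + h]%classic : set R) = (2 * h)%:E.
  rewrite lebesgue_measure_itv/= lte_fin; case: ltP => ah.
    by rewrite -EFinD; congr EFin; lra.
  by congr EFin; lra.
by rewrite ih exprSr EFinM -lE.
Qed.

End boxes.

Lemma measurable_dist_lt (R : realType) n (e : 'rV[R]_n) (delta : R) :
  measurable [set u : 'rV[R]_n | enorm (u - e) < delta].
Proof.
have mf : measurable_fun [set: 'rV[R]_n] (fun u => u - e : 'rV[R]_n).
  apply: measurable_fun_rV => i.
  rewrite (_ : (fun x => _) = (fun x : 'rV[R]_n => x 0 i - e 0 i)).
    by apply: measurable_funB => //; exact: measurable_coor.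
  by apply/funext => x; rewrite !mxE.
rewrite (_ : [set _ | _] = setT `&` ((@enorm R n : _ -> measurableTypeR R) \o (fun u => u - e : 'rV[R]_n)) @^-1` `]-oo, delta[%classic).
  apply: (measurableT_comp (@measurable_enorm R n) mf) => //; exact: measurable_itv.
by apply/seteqP; split => u /=; rewrite in_itv/= => //; case.
Qed.

Section sphere.
Context (R : realType) (m : nat).
Local Notation n := m.+1.
Local Notation sigma := (@sphere_measure R n).

Definition ball_volume : R := fine (lebesgue_rV R n (@unit_ball R n)).

(** The ball lies between the cubes of half-widths [1/n] and [1]. A finite positive volume keeps
    [mnormalize] off its default measure. *)
Lemma lebesgue_unit_ball : lebesgue_rV R n (@unit_ball R n) = ball_volume%:E /\ 0 < ball_volume.
Proof.
have le1 : (lebesgue_rV R n (@unit_ball R n) <= ((2 * 1) ^+ n)%:E)%E.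
  rewrite -(lebesgue_rV_cube (0 : 'rV[R]_n) ler01); apply: le_measure.
  - by rewrite inE; exact: measurable_unit_ball.
  - by rewrite inE; exact: measurable_cube.
  - move=> x /= x1 i; have := le_trans (ler_coord_enorm x i) x1.
    by rewrite ler_norml mxE; lra.
have n0 : 0 < n%:R :> R by [].
have ge1 : (((2 * n%:R^-1) ^+ n)%:E <= lebesgue_rV R n (@unit_ball R n))%E.
  rewrite -(lebesgue_rV_cube (0 : 'rV[R]_n)); last by rewrite invr_ge0 ltW.
  apply: le_measure.
  - by rewrite inE; exact: measurable_cube.
  - by rewrite inE; exact: measurable_unit_ball.
  - move=> x x1; rewrite /unit_ball /= -(divff (lt0r_neq0 n0)); apply: enorm_le_coord; last by rewrite invr_ge0 ltW.
    by move=> i; have := x1 i; rewrite mxE ler_norml sub0r add0r.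
have fin : (lebesgue_rV R n (@unit_ball R n) \is a fin_num)%E.
  by rewrite ge0_fin_numE//; apply: le_lt_trans le1 _; rewrite ltry.
rewrite /ball_volume fineK//; split => //.
rewrite -lte_fin fineK//; apply: lt_le_trans ge1.
by rewrite lte_fin exprn_gt0// mulr_gt0// invr_gt0.
Qed.

Lemma sphere_measureE A :
  sigma A = (lebesgue_rV R n (@radial R n @^-1` A `&` @unit_ball R n) * (ball_volume^-1)%:E)%E.
Proof.
have [bE b0] := lebesgue_unit_ball.
rewrite /sphere_measure /= /mnormalize /= /pushforward /mrestr preimage_setT setTI bE.
by rewrite eqe gt_eqF//=.
Qed.

Lemma sphere_measure_sphere : {ae sigma, forall u, enorm u = 1}.
Proof.
have ms : measurable ((@enorm R n : _ -> measurableTypeR R) @^-1` [set 1]).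
  by rewrite -[X in measurable X]setTI; apply: measurable_enorm.
exists (~` [set u : 'rV[R]_n | enorm u = 1]); split => //; first exact: measurableC.
(* [radial] sends nonzero vectors to the sphere and 0 to 0, so only the origin misses the sphere. *)
rewrite sphere_measureE (_ : _ `&` _ = cube 0 0).
  by rewrite lebesgue_rV_cube// mulr0 expr0n mul0e.
apply/seteqP; split => [x [/= xs _] i|x x0].
  have [->|x0] := eqVneq x 0; first by rewrite mxE subr0 addr0 lexx.
  exfalso; apply: xs; rewrite /radial enormZ ger0_norm ?invr_ge0 ?enorm_ge0//.
  by rewrite mulVf// gt_eqF// enorm_gt0.
have -> : x = 0.
  by apply/rowP => i; have := x0 i; rewrite mxE subr0 addr0 -eq_le => /eqP.
split; rewrite /= /unit_ball/= /radial ?scaler0 enorm0//.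
by move/eqP; rewrite eq_sym oner_eq0.
Qed.

Definition cap (e : 'rV[R]_n) (delta : R) : set 'rV[R]_n := [set u | enorm (u - e) < delta].

Lemma measurable_cap e delta : measurable (cap e delta).
Proof. exact: measurable_dist_lt. Qed.

(* A cube around [e / 2] is mapped into the cap by the radial projection; its
   volume does not depend on [e]. *)
Lemma cap_lower_bound delta : 0 < delta ->
  exists2 c : R, 0 < c & forall e, enorm e = 1 -> (c%:E <= sigma (cap e delta))%E.
Proof.
move=> d0; have [bE b0] := lebesgue_unit_ball.
have n0 : 0 < n%:R :> R by [].
(* For [x] within [rho] of [e / 2], the bound [1/3] keeps [x] nonzero and inside the unit ball. Both
   [radial x - 2 x] and [2 x - e] have norm at most [2 rho], and [4 rho < delta] by the bound
   [delta / 5]. *)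
pose rho : R := Num.min (delta / 5) 3^-1.
have rho0 : 0 < rho by rewrite lt_min divr_gt0//= invr_gt0.
pose h := rho / n%:R.
have h0 : 0 < h by rewrite divr_gt0.
exists ((2 * h) ^+ n * ball_volume^-1).
  by rewrite mulr_gt0 ?invr_gt0// exprn_gt0// mulr_gt0.
move=> e e1; rewrite sphere_measureE EFinM lee_wpmul2r ?lee_fin ?invr_ge0 ?(ltW b0)//.
rewrite -(lebesgue_rV_cube (2^-1 *: e) (ltW h0)); apply: le_measure.
- by rewrite inE; exact: measurable_cube.
- rewrite inE; apply: measurableI; last exact: measurable_unit_ball.
  by rewrite -[X in measurable X]setTI; apply: measurable_radial => //; exact: measurable_cap.
move=> x /= xe.
have xr : enorm (x - 2^-1 *: e) <= rho.
  rewrite (_ : rho = n%:R * h); last by rewrite /h mulrC divfK// gt_eqF.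
  by apply: enorm_le_coord; [move=> i; have := xe i; rewrite ler_norml !mxE; lra|exact: ltW].
have e2 : enorm (2^-1 *: e) = 2^-1 by rewrite enormZ e1 mulr1 ger0_norm.
have hx := ler_enorm_dist x (2^-1 *: e); rewrite e2 ler_norml in hx.
have rle : rho <= delta / 5 /\ rho <= 3^-1 by rewrite !ge_min !lexx/= orbT.
split; last by rewrite /= /unit_ball /=; case/andP: hx; lra.
rewrite /= /cap /=.
have x0 : x != 0.
  apply/eqP => x0; have x00 : enorm x = 0 by rewrite x0 enorm0.
  by case/andP: hx; case: rle; lra.
have xx : enorm x *: radial x = x.
  by rewrite /radial scalerA divff ?scale1r// gt_eqF// enorm_gt0.
have rx : enorm (radial x) = 1.
  by rewrite /radial enormZ ger0_norm ?invr_ge0 ?enorm_ge0// mulVf// gt_eqF// enorm_gt0.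
apply: le_lt_trans (ler_enorm_add (2 *: x) _ _) _.
have -> : 2 *: x - e = 2 *: (x - 2^-1 *: e).
  by rewrite scalerBr scalerA divff ?scale1r.
have -> : radial x - 2 *: x = (1 - 2 * enorm x) *: radial x.
  by rewrite scalerBl scale1r -scalerA xx.
rewrite (enormZ _ (radial x)) rx mulr1 (enormZ 2) (ger0_norm (_ : 0 <= 2))//.
have : `|1 - 2 * enorm x| <= 2 * rho by rewrite ler_norml; case/andP: hx; lra.
lra.
Qed.

End sphere.

(** * Regularity of support functions *)

Section measurability_criteria.
Context (R : realType) d (T : measurableType d).

Lemma measurable_fun_lt_set (f : T -> measurableTypeR R) :
  (forall c : R, measurable [set x | f x < c]) -> measurable_fun setT f.
Proof.
move=> mf; apply: (measurability _ (RGenInftyO.measurableE R)) => //.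
move=> _ [_ [c ->] <-]; rewrite setTI preimage_itvNyo; exact: mf.
Qed.

Lemma measurable_fun_gt_set (f : T -> measurableTypeR R) :
  (forall c : R, measurable [set x | c < f x]) -> measurable_fun setT f.
Proof.
move=> mf; apply: (measurability _ (RGenOInfty.measurableE R)) => //.
move=> _ [_ [c ->] <-]; rewrite setTI preimage_itvoy; exact: mf.
Qed.

End measurability_criteria.

Section fuzzy.
Context (R : realType) (n : nat).
Implicit Types (xi eta : 'rV[R]_n -> R) (u v : 'rV[R]_n).

Section one.
Context xi (Fxi : Fcconv xi).

Lemma convex_body_cut (a : R) : 0 < a <= 1 -> convex_body (alpha_cut xi a).
Proof. by case: Fxi => _ _ + _ => /[apply]. Qed.

Lemma convex_body_fsupp : convex_body (fsupp xi).
Proof. by case: Fxi. Qed.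

Lemma cut_sub_fsupp (a : R) : 0 < a -> alpha_cut xi a `<=` fsupp xi.
Proof. by move=> a0 x ax; apply: subset_closure; exact: lt_le_trans ax. Qed.

Lemma cut_subset (a b : R) : a <= b -> alpha_cut xi b `<=` alpha_cut xi a.
Proof. by move=> ab x; exact: le_trans. Qed.

Lemma suppf_cut_le (a b : R) u : 0 < a -> a <= b -> b <= 1 ->
  suppf (alpha_cut xi b) u <= suppf (alpha_cut xi a) u.
Proof.
move=> a0 ab b1; have [A0 cA _] : convex_body (alpha_cut xi a) by apply: convex_body_cut; rewrite a0 (le_trans ab).
have [B0 cB _] : convex_body (alpha_cut xi b) by apply: convex_body_cut; rewrite b1 (lt_le_trans a0).
by apply: suppf_le => // x bx; apply: suppf_ub => //; exact: cut_subset bx.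
Qed.

(** Left continuity in the level, by compactness. If a gap [e] persisted at all levels below [a],
    points realising it at levels increasing to [a] would have a cluster point; that point lies in
    all these cuts, hence in the cut of level [a], which contradicts the gap. *)
Lemma cut_left_lim (a e : R) u : 0 < a <= 1 -> 0 < e ->
  exists2 b : R, 0 < b < a & suppf (alpha_cut xi b) u <= suppf (alpha_cut xi a) u + e.
Proof.
move=> /andP[a0 a1] e0; set s := suppf _ u; apply: contrapT => H.
(* Levels increasing to [a]; the offset 2 makes even [b 0] positive. *)
pose b k : R := a * (1 - k.+2%:R^-1).
have b0 k : 0 < b k by rewrite mulr_gt0// subr_gt0 invf_lt1// ltr1n.
have ba k : b k < a by rewrite -[ltRHS]mulr1 ltr_pM2l// ltrBlDr ltrDl invr_gt0.
have bB k : convex_body (alpha_cut xi (b k)) by apply: convex_body_cut; rewrite b0 ltW// (lt_le_trans (ba k)).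
have /choice[x xP] k : exists y, alpha_cut xi (b k) y /\ s + e < dotv u y.
  have [B0 cB _] := bB k; have [y yb yu] := suppf_attained B0 cB u.
  exists y; split=> //; rewrite yu ltNge; apply/negP => h; apply: H.
  by exists (b k) => //; rewrite b0 ba.
have bmono k l : (k <= l)%N -> b k <= b l.
  by move=> kl; rewrite ler_pM2l// lerD2l lerN2 lef_pV2 ?posrE// ler_nat !ltnS.
have [_ cB _] := bB 0%N.
have [|y [_ ycl]] := cB (x @ \oo) _.
  by exists 0%N => // k _; apply: cut_subset (xP k).1; exact: bmono.
have cl (C : set 'rV[R]_n) : closed C -> (\forall k \near \oo, C (x k)) -> C y.
  by move=> cC Cx; apply: cC => B By; have := ycl _ _ Cx By.
have yb k : b k <= xi y.
  apply: (cl (alpha_cut xi (b k))).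
    by apply: compact_closed; [exact: norm_hausdorff | have [_ ? _] := bB k].
  by exists k => // l /= kl; apply: cut_subset (xP l).1; exact: bmono.
have yse : s + e <= dotv u y.
  have : [set z | dotv (- u) z <= - (s + e)] y.
    apply: cl; first exact: closed_dotv_le.
    by apply: nearW => k /=; rewrite dotvNl lerN2 ltW// (xP k).2.
  by rewrite /= dotvNl lerN2.
have ya : alpha_cut xi a y.
  have hb : b k @[k --> \oo] --> a.
    have h1 : 1 - k.+2%:R^-1 @[k --> \oo] --> (1 - 0 : R).
      apply: cvgB; first exact: cvg_cst.
      have := @cvg_harmonic R; rewrite -(cvg_shiftS (@harmonic R)); exact.
    have h2 : b k @[k --> \oo] --> a * (1 - 0) by apply: cvgM h1; exact: cvg_cst.
    by move: h2; rewrite subr0 mulr1.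
  exact: cvg_le_const hb yb.
have [_ cA _] : convex_body (alpha_cut xi a) by apply: convex_body_cut; rewrite a0.
by have := suppf_ub cA u ya; rewrite -/s; lra.
Qed.

Lemma fsupp_bounded : exists2 M, 0 <= M & forall x, fsupp xi x -> enorm x <= M.
Proof. by have [_ cS _] := convex_body_fsupp; exact: compact_enorm_bounded. Qed.

End one.

(** A representative of [support_fun] cut off outside the levels []0, 1]], where the sets are no
    longer convex bodies. Measurability and the Lipschitz bound in the direction then hold
    everywhere, not just almost everywhere. *)
Definition csupp xi (z : measurableTypeR R * 'rV[R]_n) : R :=
  if 0 < z.1 <= 1 then suppf (alpha_cut xi z.1) z.2 else 0.

Lemma csupp_lip xi M : Fcconv xi -> 0 <= M -> (forall x, fsupp xi x -> enorm x <= M) ->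
  forall a u v, `|csupp xi (a, u) - csupp xi (a, v)| <= M * enorm (u - v).
Proof.
move=> Fxi M0 xiM a u v; rewrite /csupp /=; case: ifPn => [a01|_].
  have [A0 cA _] := convex_body_cut Fxi a01; apply: suppf_lip => //.
  by move=> x xa; apply: xiM; apply: cut_sub_fsupp xa; case/andP: a01.
by rewrite subrr normr0 mulr_ge0// enorm_ge0.
Qed.

Lemma rat_dense_enorm u (delta : R) : 0 < delta ->
  exists q : 'rV[rat]_n, enorm (u - map_mx ratr q) < delta.
Proof.
move=> d0; pose h := delta / n.+1%:R; have h0 : 0 < h by rewrite divr_gt0.
have /choice[q qP] (i : 'I_n) : exists q : rat, u 0 i < ratr q < u 0 i + h.
  have [|q] := @rat_in_itvoo R (u 0 i) (u 0 i + h); first by rewrite ltrDl.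
  by rewrite in_itv /= => ?; exists q.
exists (\row_i q i); apply: (@le_lt_trans _ _ (n%:R * h)).
  apply: enorm_le_coord; last exact: ltW.
  by move=> i; rewrite !mxE ler_norml; case/andP: (qP i); lra.
by rewrite mulrCA -[ltRHS]mulr1 ltr_pM2l// ltr_pdivrMr// mul1r ltr_nat.
Qed.

(* [f (a, u) < c] iff [f (a, q) < r] and [r + M |u - q| < c] for
   some rational [q], [r]. *)
Lemma measurable_lipschitz_section (f : measurableTypeR R * 'rV[R]_n -> measurableTypeR R) (M : R) :
  0 <= M ->
  (forall u, measurable_fun setT (fun a : measurableTypeR R => f (a, u))) ->
  (forall a u v, `|f (a, u) - f (a, v)| <= M * enorm (u - v)) ->
  measurable_fun setT f.
Proof.
move=> M0 mf fM; apply: measurable_fun_lt_set => c.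
pose q' (q : 'rV[rat]_n) : 'rV[R]_n := map_mx ratr q.
pose F (qr : 'rV[rat]_n * rat) : set (measurableTypeR R * 'rV[R]_n) :=
  [set a | f (a, q' qr.1) < ratr qr.2] `*` [set u | ratr qr.2 + M * enorm (u - q' qr.1) < c].
rewrite (_ : [set x | _] = \bigcup_qr F qr); last first.
  apply/seteqP; split => [[a u] /= fc|[a u] [qr _ [/= h1 h2]]]; last first.
    by have := fM a u (q' qr.1); rewrite ler_norml => /andP[_]; lra.
  have M1 : 0 < 4 * (M + 1) by rewrite mulr_gt0// ltr_wpDl.
  (* With [q] within [e] of [u], the term [M |u - q|] takes at most a quarter of the gap
     [c - f (a, u)]. A rational [r] placed between a quarter and a half of the gap then leaves room
     on both sides. *)
  pose e := (c - f (a, u)) / (4 * (M + 1)).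
  have e0 : 0 < e by rewrite divr_gt0// subr_gt0.
  have [q qu] := rat_dense_enorm u e0.
  have Me : M * enorm (u - q' q) <= (c - f (a, u)) / 4.
    apply: (@le_trans _ _ ((M + 1) * e)).
      by rewrite ler_pM ?enorm_ge0 ?lerDl// ltW.
    rewrite /e le_eqVlt; apply/orP; left; apply/eqP; field.
    by apply/eqP => h; move: M0; rewrite (_ : M = -1); lra.
  have := fM a u (q' q); rewrite ler_norml => /andP[h1 h2].
  have [|r] := @rat_in_itvoo R (f (a, u) + (c - f (a, u)) / 4) (f (a, u) + (c - f (a, u)) / 2).
    lra.
  rewrite in_itv /= => /andP[r1 r2]; exists (q, r) => //; split => /=; lra.
apply: countable_bigcupT_measurable => [|[q r]]; first exact: countableP.
apply: measurableX => /=.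
  have := mf (q' q) measurableT `]-oo, ratr r[%classic (measurable_itv _).
  by rewrite setTI preimage_itvNyo.
have [M00|M00] := eqVneq M 0.
  have [h|h] := boolP (ratr r < c).
    by rewrite (_ : [set u | _] = setT)//; apply/seteqP; split => // x _ /=; rewrite M00 mul0r addr0.
  rewrite (_ : [set u | _] = set0)//; apply/seteqP; split => // x /=.
  by rewrite M00 mul0r addr0 (negbTE h).
have M1 : 0 < M by rewrite lt0r M00.
rewrite (_ : [set u | _] = [set u | enorm (u - q' q) < (c - ratr r) / M]).
  exact: measurable_dist_lt.
by apply/seteqP; split => x /=; rewrite ltr_pdivlMr// mulrC; lra.
Qed.

Lemma measurable_csupp xi : Fcconv xi -> measurable_fun setT (csupp xi : _ -> measurableTypeR R).
Proof.
move=> Fxi; have [M M0 xiM] := fsupp_bounded Fxi.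
apply: (@measurable_lipschitz_section _ M M0); last exact: csupp_lip.
move=> u; apply: measurable_fun_lt_set => c.
rewrite (_ : [set x | _] = ([set a | 0 < a <= 1] `&` [set a | suppf (alpha_cut xi a) u < c]) `|`
   (~` [set a | 0 < a <= 1] `&` [set a : R | 0 < c])); last first.
  apply/seteqP; split => [a /=|a /=]; rewrite /csupp /=; case: ifP => h.
  - by move=> ?; left.
  - by move=> ?; right; split => //; apply/negP; rewrite h.
  - by case => [[]//|[]].
  - by case => [[]//|[]].
have m01 : measurable ([set a | 0 < a <= 1] : set (measurableTypeR R)).
  by rewrite (_ : [set a | _] = `]0, 1]%classic)//; apply/seteqP; split => a /=; rewrite in_itv.
apply: measurableU.
  (* Support functions decrease in the level, so this sublevel set is an interval. *)
  apply: is_interval_measurable => x y [/= /andP[x0 x1] xc] [/= /andP[y0 y1] yc] z /andP[xz zy].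
  have z0 : 0 < z <= 1 by rewrite (lt_le_trans x0)//= (le_trans zy).
  split => //; apply: le_lt_trans xc; apply: suppf_cut_le => //; by case/andP: z0.
apply: measurableI; first exact: measurableC.
have [h|h] := boolP (0 < c); first by rewrite (_ : [set _ | _] = setT)//; apply/seteqP; split.
by rewrite (_ : [set _ | _] = set0)//; apply/seteqP; split => // x /=; rewrite (negbTE h).
Qed.

(** The properties of support functions that are stable under differences. The Lipschitz bound and
    left continuity let values be recovered from an almost everywhere class; together with the value
    0 at the origin, the Lipschitz bound also bounds the function on the sphere. *)
Record regular (f : measurableTypeR R * 'rV[R]_n -> R) : Prop := Regular {
  regular_measurable : measurable_fun setT (f : _ -> measurableTypeR R);
  regular_lip : exists2 M, 0 <= M &
    forall a u v, `|f (a, u) - f (a, v)| <= M * enorm (u - v);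
  regular_origin : forall a, f (a, 0) = 0;
  regular_left : forall u (a e : R), 0 < a <= 1 -> 0 < e ->
    exists2 b, 0 < b < a & forall c, b <= c <= a -> `|f (c, u) - f (a, u)| <= e }.

Lemma regular_csupp xi : Fcconv xi -> regular (csupp xi).
Proof.
move=> Fxi; split; first exact: measurable_csupp.
- by have [M M0 xiM] := fsupp_bounded Fxi; exists M => //; exact: csupp_lip.
- move=> a; rewrite /csupp /=; case: ifP => // a01.
  have [A0 cA _] := convex_body_cut Fxi a01.
  by rewrite -(scale0r 0) suppfZ// mul0r.
move=> u a e a01 e0; have [b /andP[b0 ba] bs] := cut_left_lim Fxi u a01 e0.
exists b => [|c /andP[bc ca]]; first by rewrite b0.
have [a0 a1] := andP a01.
have c01 : 0 < c <= 1 by rewrite (lt_le_trans b0)//= (le_trans ca).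
have [c0 _] := andP c01.
rewrite /csupp /= a01 c01 ger0_norm ?subr_ge0; last exact: suppf_cut_le.
by have := suppf_cut_le Fxi u b0 bc (le_trans ca a1); lra.
Qed.

Lemma regularD f g : regular f -> regular g -> regular (fun z => f z + g z).
Proof.
move=> [mf [M M0 fM] f0 fl] [mg [N N0 gN] g0 gl]; split.
- exact: measurable_funD.
- exists (M + N) => [|a u v]; first exact: addr_ge0.
  rewrite opprD addrACA mulrDl; apply: le_trans (ler_normD _ _) _; exact: lerD.
- by move=> a; rewrite f0 g0 addr0.
move=> u a e a01 e0; have e2 : 0 < e / 2 by rewrite divr_gt0.
have [b /andP[b0 ba] bf] := fl u a _ a01 e2; have [c /andP[c0 ca] cg] := gl u a _ a01 e2.
exists (Num.max b c) => [|x /andP[]]; first by rewrite lt_max b0/= gt_max ba.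
rewrite ge_max => /andP[bx cx] xa; rewrite opprD addrACA (splitr e).
by apply: le_trans (ler_normD _ _) _; rewrite lerD// ?bf ?cg// ?bx ?cx.
Qed.

Lemma regularN f : regular f -> regular (fun z => - f z).
Proof.
move=> [mf [M M0 fM] f0 fl]; split.
- by apply: (measurableT_comp _ mf); exact: oppr_measurable.
- by exists M => // a u v; rewrite -opprD normrN.
- by move=> a; rewrite f0 oppr0.
move=> u a e a01 e0; have [b b0 bf] := fl u a _ a01 e0; exists b => // c /bf.
by rewrite -opprD normrN.
Qed.

Lemma regularB f g : regular f -> regular g -> regular (fun z => f z - g z).
Proof. by move=> rf rg; apply: regularD => //; exact: regularN. Qed.

End fuzzy.

(** * The support function embedding *)

Section lebesgue01.
Context (R : realType).

(** The first factor of [cyl_measure], built from the same measurability proof so that the two agree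
    by unfolding. Naming it allows the finiteness instance that Tonelli's theorem requires. *)
Definition lebesgue01 : set (measurableTypeR R) -> \bar R :=
  mrestr (@lebesgue_measure R) (@Defs.measurable_oc01_subproof R).

Let lebesgue01_0 : lebesgue01 set0 = 0%E.
Proof. exact: measure0. Qed.

Let lebesgue01_ge0 A : (0 <= lebesgue01 A)%E.
Proof. exact: measure_ge0. Qed.

Let lebesgue01_sigma_additive : semi_sigma_additive lebesgue01.
Proof. exact: measure_semi_sigma_additive. Qed.

HB.instance Definition _ := isMeasure.Build _ _ _ lebesgue01
  lebesgue01_0 lebesgue01_ge0 lebesgue01_sigma_additive.

Let lebesgue01_fin : fin_num_fun lebesgue01.
Proof.
move=> A mA; rewrite ge0_fin_numE//.
apply: (@le_lt_trans _ _ (lebesgue_measure (`]0, 1]%classic : set R))); last first.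
  by rewrite lebesgue_measure_itv/= lte01 ltry.
by apply: le_measure; rewrite ?inE//; apply: measurableI.
Qed.

HB.instance Definition _ :=
  Measure_isFinite.Build _ _ _ lebesgue01 lebesgue01_fin.

End lebesgue01.

Section cylinder.
Context (R : realType) (m : nat).
Local Notation n := m.+1.
Local Notation sigma := (@sphere_measure R n).
Local Notation cyl := (@cyl_measure R n).
Local Notation I01 := (`]0, 1]%classic : set (measurableTypeR R)).

Lemma cyl_integral (g : measurableTypeR R * 'rV[R]_n -> \bar R) :
  measurable_fun setT g -> (forall z, 0 <= g z)%E ->
  (\int[cyl]_z g z = \int[lebesgue_measure]_(a in I01) \int[sigma]_u g (a, u))%E.
Proof.
move=> mg g0; transitivity (\int[(@lebesgue01 R \x sigma)]_z g z)%E.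
  exact: eq_measure_integral.
rewrite fubini_tonelli1//; transitivity (\int[@lebesgue01 R]_(a in I01) \int[sigma]_u g (a, u))%E.
  rewrite (@ge0_negligible_integral _ _ _ (@lebesgue01 R) setT (~` I01))//.
  - by rewrite setDE setCK setTI.
  - exact: measurableC.
  - exact: measurable_fun_fubini_tonelli_F.
  - by move=> a _; exact: integral_ge0.
  - by exact: (etrans (congr1 (@lebesgue_measure R) (setICl I01)) (measure0 _)).
by apply: eq_measure_integral => A mA AD; rewrite /= /lebesgue01 /mrestr setIidl.
Qed.

Lemma cylE (A : set (measurableTypeR R)) (B : set 'rV[R]_n) : measurable A -> measurable B ->
  cyl (A `*` B) = (lebesgue_measure (A `&` I01) * sigma B)%E.
Proof.
move=> mA mB; transitivity ((@lebesgue01 R \x sigma) (A `*` B))%E; first by [].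
exact: product_measure1E.
Qed.

Lemma cyl_ae_filter : Filter (nbhs (almost_everywhere cyl)).
Proof. exact: ae_filter_ringOfSetsType. Qed.
#[local] Existing Instance cyl_ae_filter.

Lemma cyl_aeI (P Q : measurableTypeR R * 'rV[R]_n -> Prop) :
  {ae cyl, forall z, P z} -> {ae cyl, forall z, Q z} -> {ae cyl, forall z, P z /\ Q z}.
Proof. by apply: filterS2 => z hP hQ; exact: conj hP hQ. Qed.

Lemma cyl_setT : cyl setT = 1%E.
Proof.
rewrite -setXTT cylE// setTI probability_setT mule1 lebesgue_measure_itv/= lte01.
by rewrite oppr0 adde0.
Qed.

Lemma measurable_sphere : measurable [set u : 'rV[R]_n | enorm u = 1].
Proof.
rewrite (_ : [set _ | _] = (@enorm R n : _ -> measurableTypeR R) @^-1` [set 1])//.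
by rewrite -[X in measurable X]setTI; apply: measurable_enorm.
Qed.

Lemma cyl_carrier : {ae cyl, forall z, 0 < z.1 <= 1 /\ enorm z.2 = 1}.
Proof.
have mI : measurable (~` I01) by exact: measurableC.
have mS : measurable (~` [set u : 'rV[R]_n | enorm u = 1]) by apply: measurableC; exact: measurable_sphere.
have s0 : sigma (~` [set u : 'rV[R]_n | enorm u = 1]) = 0%E.
  have [N [mN N0 sN]] := sphere_measure_sphere R m.
  by apply/eqP; rewrite eq_le measure_ge0 andbT -N0 le_measure ?inE.
have ae1 : {ae cyl, forall z, 0 < z.1 <= 1}.
  exists ((~` I01) `*` setT); split; first exact: measurableX.
    apply: etrans (cylE mI measurableT) _.
    by rewrite (_ : _ `&` _ = set0) ?measure0 ?mul0e//; exact: setICl.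
  by move=> [a u] /= h; split => //=; rewrite in_itv.
have ae2 : {ae cyl, forall z, enorm z.2 = 1}.
  exists (setT `*` (~` [set u : 'rV[R]_n | enorm u = 1])); split; first exact: measurableX.
    by apply: etrans (cylE measurableT mS) _; rewrite s0 mule0.
  by move=> [a u] /= h; split.
exact: cyl_aeI ae1 ae2.
Qed.

(** The box has positive measure, so it is not contained in the exceptional null set. The levels are
    taken below [a] because only left continuity is available. *)
Lemma cyl_ae_ball (P : measurableTypeR R * 'rV[R]_n -> Prop) (a b delta : R) u :
  {ae cyl, forall z, P z} -> 0 < b < a -> a <= 1 -> enorm u = 1 -> 0 < delta ->
  exists c v, [/\ b <= c <= a, enorm (v - u) < delta & P (c, v)].
Proof.
move=> [N [mN N0 PN]] /andP[b0 ba] a1 u1 d0; apply: contrapT => H.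
have mC := measurable_cap u delta.
have : (0 < cyl (`[b, a]%classic `*` cap u delta))%E.
  rewrite cylE//; apply: mule_gt0; last first.
    have [c c0 /(_ u u1)] := cap_lower_bound m d0.
    by apply: lt_le_trans; rewrite lte_fin.
  rewrite setIidl; first by rewrite lebesgue_measure_itv/= lte_fin ba -EFinD lte_fin subr_gt0.
  by move=> x /=; rewrite !in_itv/= => /andP[bx xa]; rewrite (lt_le_trans b0)//= (le_trans xa).
rewrite ltNge => /negP; apply; rewrite -N0; apply: le_measure; rewrite ?inE//.
  exact: measurableX.
move=> [c v] [/= + vu]; rewrite in_itv/= => cab; apply: PN => /= Pcv.
by apply: H; exists c, v.
Qed.

(** The passage from equality of classes to equality at every level and direction; additivity and
    injectivity of the embedding rest on it. *)
Lemma regular_ae_eq0 (f : measurableTypeR R * 'rV[R]_n -> R) : regular f ->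
  f = cst 0 %[ae cyl] -> forall a u, 0 < a <= 1 -> enorm u = 1 -> f (a, u) = 0.
Proof.
move=> [mf [M M0 fM] f0 fl] fae a u a01 u1; apply: contrapT => /eqP fau.
(* Moving to a nearby level and moving to a nearby direction each cost at most [e], so a zero of [f]
   nearby would give [4 e <= 2 e]. *)
pose e := `|f (a, u)| / 4.
have e0 : 0 < e by rewrite divr_gt0// normr_gt0.
have [b /andP[b0 ba] bf] := fl u a e a01 e0.
have M1 : 0 < M + 1 by rewrite ltr_wpDl.
have [||||c [v [bca vu /(_ I)/= fcv]]] := @cyl_ae_ball _ a b (e / (M + 1)) u fae => //.
- by rewrite b0.
- by case/andP: a01.
- by rewrite divr_gt0.
have := bf _ bca; have := fM c u v; rewrite fcv subr0 enorm_distC => h1 h2.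
have : M * enorm (v - u) <= e.
  apply: le_trans (ler_wpM2l M0 (ltW vu)) _.
  by rewrite mulrCA ler_piMr ?(ltW e0)// ler_pdivrMr// mul1r lerDl.
have h3 : `|f (a, u)| <= `|f (c, u)| + `|f (c, u) - f (a, u)|.
  by rewrite -[X in `|X| <= _](subKr (f (c, u))); exact: ler_normB.
have : `|f (a, u)| = 4 * e by rewrite /e mulrC divfK.
lra.
Qed.


Context (p : R) (p1 : (1 <= p%:E)%E).
Local Notation B := (LpB n p1).

Lemma p_ge1 : 1 <= p. Proof. by rewrite -lee_fin. Qed.

Lemma p_gt0 : 0 < p. Proof. exact: lt_le_trans ltr01 p_ge1. Qed.

Lemma measurable_normr_powR d (T : measurableType d) (f : T -> measurableTypeR R) (q : R) :
  measurable_fun setT f -> measurable_fun setT (fun z => (`|f z| `^ q)%:E).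
Proof.
move=> mf; apply/measurable_EFinP.
apply: (@measurableT_comp _ _ _ _ _ _ (@powR R ^~ q)) => //.
exact: measurableT_comp.
Qed.

Lemma regular_bound f : regular f -> exists2 M, 0 <= M &
  forall (a : measurableTypeR R) (u : 'rV[R]_n), enorm u = 1 -> `|f (a, u)| <= M.
Proof.
move=> [_ [M M0 fM] f0 _]; exists M => // a u u1.
by have := fM a u 0; rewrite f0 !subr0 u1 mulr1.
Qed.

Lemma regular_Lfun f : regular f -> f \in Lfun cyl p%:E.
Proof.
move=> rf; have [mf _ _ _] := rf; have [M M0 fM] := regular_bound rf.
apply/andP; rewrite !inE; split => //=.
rewrite /finite_norm unlock; apply: poweR_lty.
apply: (@le_lt_trans _ _ (\int[cyl]_z (M `^ p)%:E)%E); last first.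
  by rewrite integral_cst// cyl_setT mule1 ltry.
apply: ae_ge0_le_integral => //.
- by move=> z _; exact: poweR_ge0.
- exact: (measurable_normr_powR p mf).
- by move=> z _; rewrite lee_fin powR_ge0.
move: cyl_carrier; apply: filterS => -[a u] [_ /= u1] _.
by rewrite lee_fin ge0_ler_powR ?nnegrE ?(ltW p_gt0)//; exact: fM.
Qed.

Lemma Lp_funP (b c : B) : Lp_fun b = Lp_fun c %[ae cyl] -> b = c.
Proof. by move=> bc; rewrite -(reprK b) -(reprK c); exact/Lp_piP. Qed.

Lemma Lp_funB (b c : B) : Lp_fun (b - c) = (fun z => Lp_fun b z - Lp_fun c z) %[ae cyl].
Proof.
have -> : b - c = (\pi_(Lp cyl p1) (repr b - repr c))%qT.
  transitivity (Lp_add (\pi_(Lp cyl p1) (repr b))%qT (Lp_opp (\pi_(Lp cyl p1) (repr c))%qT)).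
    by rewrite !reprK.
  by rewrite (Lp_oppE (repr c)) (Lp_addE (repr b) (- repr c)).
exact: Lp_repr_pi.
Qed.

Lemma Lp_funD (b c : B) : Lp_fun (b + c) = (fun z => Lp_fun b z + Lp_fun c z) %[ae cyl].
Proof.
have -> : b + c = (\pi_(Lp cyl p1) (repr b + repr c))%qT.
  transitivity (Lp_add (\pi_(Lp cyl p1) (repr b))%qT (\pi_(Lp cyl p1) (repr c))%qT).
    by rewrite !reprK.
  by rewrite (Lp_addE (repr b) (repr c)).
exact: Lp_repr_pi.
Qed.

Lemma measurable_Lp_fun (b : B) : measurable_fun setT (Lp_fun b : _ -> measurableTypeR R).
Proof. exact: (set_mem (sub_Lfun_mfun (LfunP (repr b)))). Qed.

Lemma Lp_norm_powR (b : B) : (`|b| `^ p)%:E = (\int[cyl]_z (`|Lp_fun b z| `^ p)%:E)%E.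
Proof.
rewrite -[`|b|]/(Lp_norm b) /Lp_norm -poweR_EFin finite_norm_fine.
by rewrite poweR_Lnorm// gt_eqF// p_gt0.
Qed.

Lemma Lp_norm_energy (b : B) g : measurable_fun setT (g : _ -> measurableTypeR R) ->
  Lp_fun b = g %[ae cyl] -> (`|b| `^ p)%:E =
  (\int[lebesgue_measure]_(a in I01) \int[sigma]_u (`|g (a, u)| `^ p)%:E)%E.
Proof.
move=> mg bg; rewrite Lp_norm_powR -(@cyl_integral (fun z => (`|g z| `^ p)%:E)).
- apply: ae_eq_integral => //; try exact: measurable_normr_powR.
    exact: (measurable_normr_powR p (measurable_Lp_fun b)).
  by move: bg; apply: filterS => z h zT; rewrite h.
- exact: measurable_normr_powR.
- by move=> z; rewrite lee_fin powR_ge0.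
Qed.

Section embedding.
Implicit Types xi eta : 'rV[R]_n -> R.

Lemma csupp_support_fun xi : csupp xi = support_fun xi %[ae cyl].
Proof. by move: cyl_carrier; apply: filterS => -[a u] [/= a01 _] _; rewrite /csupp a01. Qed.

(** Exhibits a class with the required property, so that the [xget] in [support_embed] does not fall
    back on 0. *)
Lemma support_embedE xi : Fcconv xi -> Lp_fun (support_embed p1 xi) = csupp xi %[ae cyl].
Proof.
move=> Fxi; pose f := Lfun_Sub p1 (regular_Lfun (regular_csupp Fxi)).
have fE : Lp_fun (\pi_(Lp cyl p1) f)%qT = csupp xi %[ae cyl] by exact: Lp_repr_pi.
suff : Lp_fun (support_embed p1 xi) = support_fun xi %[ae cyl].
  by move: (csupp_support_fun xi); apply: filterS2 => z h1 h2 zT; rewrite h2// h1.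
apply: (@xgetPex B 0 [set b : B | Lp_fun b = support_fun xi %[ae cyl]]).
exists (\pi_(Lp cyl p1) f)%qT => /=.
by move: fE (csupp_support_fun xi); apply: filterS2 => z h1 h2 zT; rewrite h1// h2.
Qed.

Lemma csupp_cutE xi (a : R) u : 0 < a <= 1 -> csupp xi (a, u) = suppf (alpha_cut xi a) u.
Proof. by rewrite /csupp /= => ->. Qed.

Lemma suppf_eq_of_sphere (F : 'rV[R]_n -> R) : (forall t u, 0 <= t -> F (t *: u) = t * F u) ->
  (forall u, enorm u = 1 -> F u = 0) -> forall u, F u = 0.
Proof.
move=> FZ F1 u; have [->|u0] := eqVneq u 0.
  by rewrite -(scale0r 0) FZ// mul0r.
have e0 := enorm_gt0 u0.
rewrite -[u](scalerK (lt0r_neq0 e0)) scalerA mulrC -scalerA FZ ?enorm_ge0// F1 ?mulr0//.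
by rewrite enormZ ger0_norm ?invr_ge0 ?enorm_ge0// mulVf// gt_eqF.
Qed.

(** The sum in [B] is known only almost everywhere. Regularity extends it to all levels and unit
    vectors, homogeneity to all vectors. *)
Lemma support_embedD xi eta zeta : Fcconv xi -> Fcconv eta -> Fcconv zeta ->
  support_embed p1 zeta = support_embed p1 xi + support_embed p1 eta ->
  forall (a : R) u, 0 < a <= 1 ->
  suppf (alpha_cut zeta a) u = suppf (alpha_cut xi a) u + suppf (alpha_cut eta a) u.
Proof.
move=> Fx Fe Fz zE a u a01; apply/eqP; rewrite -subr_eq0; apply/eqP; move: u.
apply: suppf_eq_of_sphere => [t u t0|u u1].
  have [X0 cX _] := convex_body_cut Fx a01; have [E0 cE _] := convex_body_cut Fe a01.
  have [Z0 cZ _] := convex_body_cut Fz a01.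
  by rewrite !suppfZ// mulrBr mulrDr.
rewrite -!csupp_cutE//.
apply: (regular_ae_eq0 (regularB (regular_csupp Fz) (regularD (regular_csupp Fx) (regular_csupp Fe)))) => //.
have := cyl_aeI (cyl_aeI (support_embedE Fx) (support_embedE Fe)) (cyl_aeI (support_embedE Fz)
  (Lp_funD (support_embed p1 xi) (support_embed p1 eta))).
rewrite -zE; apply: filterS => z [[hx he] [hz hD]] zT.
by rewrite -hx// -he// -hz// hD// subrr.
Qed.

Lemma support_embed_sub xi eta : Fcconv xi -> Fcconv eta ->
  Lp_fun (support_embed p1 xi - support_embed p1 eta) =
  (fun z => csupp xi z - csupp eta z) %[ae cyl].
Proof.
move=> Fx Fe; have := cyl_aeI (cyl_aeI (support_embedE Fx) (support_embedE Fe))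
  (Lp_funB (support_embed p1 xi) (support_embed p1 eta)).
apply: filterS => z [[hx he] hD] zT.
by rewrite -hx// -he// hD.
Qed.

Lemma Fcconv_inj xi eta : Fcconv xi -> Fcconv eta ->
  (forall (a : R) u, 0 < a <= 1 -> suppf (alpha_cut xi a) u = suppf (alpha_cut eta a) u) ->
  xi = eta.
Proof.
move=> Fx Fe h; have cuts (a : R) : 0 < a <= 1 -> alpha_cut xi a = alpha_cut eta a.
  move=> a01; apply: suppf_inj => [||u _]; [exact: convex_body_cut| exact: convex_body_cut|exact: h].
have [[x01 _ _ _] [e01 _ _ _]] := (Fx, Fe); apply/funext => v; apply/le_anti/andP; split.
  have [xv0|xv0] := leP (xi v) 0; first by apply: le_trans xv0 _; case/andP: (e01 v).
  have : alpha_cut xi (xi v) v by exact: lexx.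
  by rewrite cuts// xv0; case/andP: (x01 v).
have [ev0|ev0] := leP (eta v) 0; first by apply: le_trans ev0 _; case/andP: (x01 v).
have : alpha_cut eta (eta v) v by exact: lexx.
by rewrite -cuts// ev0; case/andP: (e01 v).
Qed.

Lemma fuzzy0_cut (a : R) : 0 < a <= 1 -> alpha_cut (@fuzzy0 R n) a = [set 0].
Proof.
move=> /andP[a0 a1]; apply/seteqP; split => [x|x ->]; rewrite /alpha_cut /= /fuzzy0 indicE.
  case: (boolP (x \in [set 0])) => [/set_mem//|_]; rewrite leNgt a0//.
by rewrite mem_set.
Qed.

Lemma convex_body1 (x : 'rV[R]_n) : convex_body [set x].
Proof.
split; [by exists x|exact: compact_set1|].
by apply/convex_setP => _ _ t -> -> _; rewrite -scalerDl subrKC scale1r.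
Qed.

Lemma Fcconv_fuzzy0 : Fcconv (@fuzzy0 R n).
Proof.
have fs : fsupp (@fuzzy0 R n) = [set 0].
  rewrite /fsupp (_ : [set x | _] = [set 0]).
    by apply/esym/closure_id/accessible_closed_set1/hausdorff_accessible/norm_hausdorff.
  apply/seteqP; split => [x|x ->]; rewrite /= /fuzzy0 indicE.
    by case: (boolP (x \in [set 0])) => [/set_mem//|_]; rewrite ltxx.
  by rewrite mem_set// ltr01.
have [b0 b1 b2] := convex_body1 0; split.
- by move=> x; rewrite /fuzzy0 indicE; case: (_ \in _); rewrite lexx ler01.
- by rewrite fs; exact: compact_bounded.
- by move=> a a01; rewrite fuzzy0_cut.
- by rewrite fs.
Qed.

Lemma support_embed_fuzzy0 : support_embed p1 (@fuzzy0 R n) = 0.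
Proof.
apply: Lp_funP; have h0 : Lp_fun (0 : B) = cst 0 %[ae cyl].
  by have := Lp_funB 0 (0 : B); rewrite subrr; apply: filterS => z h zT; rewrite [LHS]h// subrr.
move: h0 (support_embedE Fcconv_fuzzy0); apply: filterS2 => -[a u] h1 h2 zT.
rewrite h1// h2// /csupp /=; case: ifP => // a01.
by rewrite fuzzy0_cut// suppf1 dotv0.
Qed.

(** Additivity with the fuzzy vector 0 as one of the summands. *)
Lemma support_embed_inj xi eta : Fcconv xi -> Fcconv eta ->
  support_embed p1 xi = support_embed p1 eta -> xi = eta.
Proof.
move=> Fx Fe h; apply: Fcconv_inj => // a u a01.
have := support_embedD Fe Fcconv_fuzzy0 Fx _ u a01.
by rewrite support_embed_fuzzy0 addr0 fuzzy0_cut// suppf1 dotv0 addr0; exact.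
Qed.

Lemma support_embedK xi : Fcconv xi -> support_embed_inv p1 (support_embed p1 xi) = xi.
Proof.
move=> Fx; apply: pinvKV; last exact: mem_set.
by move=> x y /set_mem Fcx /set_mem Fcy; exact: support_embed_inj.
Qed.

End embedding.

End cylinder.

(** * Comparison of the metric with the norm *)

Section sphere_sup.
Context (R : realType) (m : nat).
Local Notation n := m.+1.
Local Notation sigma := (@sphere_measure R n).
Local Notation cyl := (@cyl_measure R n).
Local Notation I01 := (`]0, 1]%classic : set (measurableTypeR R)).
Implicit Types (f : measurableTypeR R * 'rV[R]_n -> R) (a : R) (u : 'rV[R]_n).

Lemma exists_unit_vector : exists u, enorm u = 1 :> R.
Proof.
exists (delta_mx 0 0); apply/eqP; rewrite -(eqrXn2 (n:=2))// ?enorm_ge0//.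
by rewrite sqr_enorm dotv_delta mxE !eqxx expr1n.
Qed.

Definition sphere_sup f a : R := sup [set `|f (a, u)| | u in @sphere R n].

Lemma sphere_sup_le f a r : (forall u, enorm u = 1 -> `|f (a, u)| <= r) -> sphere_sup f a <= r.
Proof.
move=> fr; apply: ge_sup; last by move=> _ [u u1 <-]; exact: fr.
by have [u u1] := exists_unit_vector; exists `|f (a, u)|, u.
Qed.

Section regular.
Context f (rf : regular f).

Lemma sphere_sup_ub a u : enorm u = 1 -> `|f (a, u)| <= sphere_sup f a.
Proof.
move=> u1; have [M M0 fM] := regular_bound rf; apply: ub_le_sup; last by exists u.
by exists M => _ [v v1 <-]; exact: fM.
Qed.

Lemma sphere_sup_ge0 a : 0 <= sphere_sup f a.
Proof.
have [u u1] := exists_unit_vector; exact: le_trans (normr_ge0 _) (sphere_sup_ub a u1).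
Qed.

Lemma sphere_sup_adherent a r : r < sphere_sup f a -> exists2 u, enorm u = 1 & r < `|f (a, u)|.
Proof.
move=> ra; apply: contrapT => H; move: ra; rewrite ltNge => /negP; apply.
apply: sphere_sup_le => u u1; rewrite leNgt; apply/negP => h; apply: H.
by exists u.
Qed.

Lemma sphere_sup_bounded : exists2 M, 0 <= M & forall a, sphere_sup f a <= M.
Proof.
have [M M0 fM] := regular_bound rf; exists M => // a; apply: sphere_sup_le => u; exact: fM.
Qed.

Lemma measurable_regular_section a : measurable_fun setT (fun u => f (a, u) : measurableTypeR R).
Proof. by have [mf _ _ _] := rf; exact: measurableT_comp. Qed.

(* By continuity, a value is exceeded at some point of the sphere iff it is
   exceeded on a cap around it. *)
Lemma sphere_sup_cap a (r e : R) : r < sphere_sup f a -> 0 < e ->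
  exists2 delta, 0 < delta & exists2 u, enorm u = 1 &
    cap u delta `<=` [set v | r - e < `|f (a, v)|].
Proof.
move=> /sphere_sup_adherent[u u1 ru] e0; have [_ [M M0 fM] _ _] := rf.
have M1 : 0 < M + 1 by rewrite ltr_wpDl.
exists (e / (M + 1)); first by rewrite divr_gt0.
exists u => // v /=; rewrite /cap /= => vu.
have h1 : M * enorm (v - u) <= e.
  apply: le_trans (ler_wpM2l M0 (ltW vu)) _.
  by rewrite mulrCA ler_piMr ?(ltW e0)// ler_pdivrMr// mul1r lerDl.
have := fM a u v; rewrite enorm_distC => h2.
have : `|f (a, u)| <= `|f (a, v)| + `|f (a, u) - f (a, v)|.
  by rewrite -[X in `|X| <= _](subrKC (f (a, v))) ler_normD.
lra.
Qed.

(** The supremum over the sphere is an essential supremum. This replaces an uncountable supremum by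
    the measure of a section, whose dependence on the level is measurable. *)
Lemma sphere_sup_gtE a r : 0 <= r ->
  (r < sphere_sup f a) = (0 < sigma [set v | (r < `|f (a, v)|)%R])%E.
Proof.
have mA s : measurable [set v | s < `|f (a, v)|].
  have := measurableT_comp (@normr_measurable R setT) (measurable_regular_section a).
  move=> /(_ measurableT `]s, +oo[%classic (measurable_itv _)).
  by rewrite setTI preimage_itvoy.
move=> r0; apply/idP/idP => [ra|].
  have e0 : 0 < (sphere_sup f a - r) / 2 by rewrite divr_gt0// subr_gt0.
  have ra2 : r + (sphere_sup f a - r) / 2 < sphere_sup f a by lra.
  have [delta d0 [u u1 cu]] := sphere_sup_cap ra2 e0.
  have [c c0 /(_ u u1) cc] := cap_lower_bound m d0.
  apply: (@lt_le_trans _ _ c%:E); first by rewrite lte_fin.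
  apply: le_trans cc _; apply: le_measure; rewrite ?inE//; first exact: measurable_cap.
  by move=> v /cu /=; rewrite addrK.
apply: contraTT; rewrite -!leNgt => ar.
have [N [mN N0 sN]] := sphere_measure_sphere R m.
rewrite -N0; apply: le_measure; rewrite ?inE// => v /= rv; apply: sN => /= v1.
by have := sphere_sup_ub a v1; rewrite leNgt (le_lt_trans ar).
Qed.

Lemma measurable_sphere_sup : measurable_fun setT (sphere_sup f : measurableTypeR R -> measurableTypeR R).
Proof.
apply: measurable_fun_gt_set => r; have [r0|r0] := leP 0 r; last first.
  rewrite (_ : [set _ | _] = setT)//; apply/seteqP; split => // a _ /=.
  exact: lt_le_trans r0 (sphere_sup_ge0 a).
have [mf _ _ _] := rf.
have mA : measurable [set z | r < `|f z|].
  have := measurableT_comp (@normr_measurable R setT) mf.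
  move=> /(_ measurableT `]r, +oo[%classic (measurable_itv _)).
  by rewrite setTI preimage_itvoy.
have := @measurable_fun_xsection _ _ (measurableTypeR R) 'rV[R]_n R sigma _ mA.
move=> /(_ measurableT `]0%E, +oo[%classic (emeasurable_itv _)).
rewrite setTI preimage_itvoy; congr measurable; apply/seteqP; split => a /=.
  by rewrite sphere_sup_gtE//; congr (0 < sigma _)%E; apply/seteqP; split => v /=; rewrite /xsection /= inE.
by rewrite sphere_sup_gtE//; congr (0 < sigma _)%E; apply/seteqP; split => v /=; rewrite /xsection /= inE.
Qed.

End regular.

Lemma hausdorff_sphere_sup (xi eta : 'rV[R]_n -> R) a : Fcconv xi -> Fcconv eta -> 0 < a <= 1 ->
  hausdorff_dist (alpha_cut xi a) (alpha_cut eta a) =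
  sphere_sup (fun z => csupp xi z - csupp eta z) a.
Proof.
move=> Fx Fe a01; have bx := convex_body_cut Fx a01; have be := convex_body_cut Fe a01.
have rf := regularB (regular_csupp Fx) (regular_csupp Fe).
apply/le_anti/andP; split.
  apply: hausdorff_le => //; first exact: (sphere_sup_ge0 rf a).
  by move=> u u1; have := sphere_sup_ub rf a u1; rewrite !csupp_cutE.
by apply: sphere_sup_le => u u1; rewrite !csupp_cutE//; exact: hausdorff_ge.
Qed.

End sphere_sup.

Section norm_comparison.
Context (R : realType) (m : nat).
Local Notation n := m.+1.
Local Notation sigma := (@sphere_measure R n).
Local Notation cyl := (@cyl_measure R n).
Local Notation I01 := (`]0, 1]%classic : set (measurableTypeR R)).
Context (p : R) (p1 : (1 <= p%:E)%E).

Let p_ge1 : 1 <= p. Proof. by rewrite -lee_fin. Qed.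
Let p_gt0 : 0 < p. Proof. exact: lt_le_trans ltr01 p_ge1. Qed.

Definition sphere_energy (g : 'rV[R]_n -> R) : \bar R := (\int[sigma]_u (`|g u| `^ p)%:E)%E.

Lemma sphere_energy_ge0 g : (0 <= sphere_energy g)%E.
Proof. by apply: integral_ge0 => u _; rewrite lee_fin powR_ge0. Qed.

(** Reduces to the criterion in two variables through a dummy level. *)
Lemma lipschitz_measurable (g : 'rV[R]_n -> measurableTypeR R) N : 0 <= N ->
  (forall u v, `|g u - g v| <= N * enorm (u - v)) -> measurable_fun setT g.
Proof.
move=> N0 gN; have : measurable_fun setT (fun z : measurableTypeR R * 'rV[R]_n => g z.2 : measurableTypeR R).
  by apply: (@measurable_lipschitz_section _ _ _ N) => //= a u v; exact: gN.
move=> mg; have mp : measurable_fun setT (pair (0 : measurableTypeR R) : 'rV[R]_n -> _) by [].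
exact: (measurableT_comp mg mp).
Qed.

(* Either [|g u0|] is small compared with the Lipschitz constant, or [|g|] is at
   least [|g u0| / 2] on a cap of fixed radius. *)
Lemma lipschitz_point_bound (e : R) : 0 < e -> exists2 C, 0 <= C &
  forall (g : 'rV[R]_n -> R) N u0, 0 <= N ->
  (forall u v, `|g u - g v| <= N * enorm (u - v)) -> enorm u0 = 1 ->
  ((`|g u0| `^ p)%:E <= ((e * N) `^ p)%:E + C%:E * sphere_energy g)%E.
Proof.
move=> e0; have e20 : 0 < e / 2 by rewrite divr_gt0.
(* If [|g u0| > e N], then [g] varies by at most [N e / 2 < |g u0| / 2] on the cap of radius
   [e / 2]. The energy is thus at least [(|g u0| / 2)^p c], which gives the constant [2^p / c]. *)
have [c c0 hc] := cap_lower_bound (R := R) m e20.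
have t0 : 0 < 2 `^ p :> R by rewrite powR_gt0.
exists (2 `^ p / c); first by rewrite divr_ge0 ?ltW.
move=> g N u0 N0 gN u01.
have Cge0 : (0 <= (2 `^ p / c)%:E * sphere_energy g)%E.
  by rewrite mule_ge0 ?sphere_energy_ge0// lee_fin divr_ge0 ?ltW.
have [gs|gl] := leP `|g u0| (e * N).
  apply: (@le_trans _ _ ((e * N) `^ p)%:E); last by rewrite leeDl.
  by rewrite lee_fin ge0_ler_powR ?nnegrE ?mulr_ge0// ltW.
apply: (@le_trans _ _ ((2 `^ p / c)%:E * sphere_energy g)%E); last by rewrite leeDr// lee_fin powR_ge0.
have mg := lipschitz_measurable N0 gN.
have mgp : measurable_fun setT (fun u => (`|g u| `^ p)%:E) by exact: measurable_normr_powR.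
have mC := measurable_cap u0 (e / 2).
have capE : (((`|g u0| / 2) `^ p * c)%:E <= sphere_energy g)%E.
  apply: (@le_trans _ _ (\int[sigma]_(u in cap u0 (e / 2)) ((`|g u0| / 2) `^ p)%:E)%E).
    by rewrite integral_cst// EFinM lee_wpmul2l ?hc// lee_fin powR_ge0.
  apply: (@le_trans _ _ (\int[sigma]_(u in cap u0 (e / 2)) (`|g u| `^ p)%:E)%E); last first.
    by apply: ge0_subset_integral => // u _; rewrite lee_fin powR_ge0.
  apply: ge0_le_integral => //; first exact: measurable_funTS.
  move=> u; rewrite /cap /= => uu0; rewrite lee_fin ge0_ler_powR ?nnegrE ?divr_ge0 ?(ltW p_gt0)//.
  have := gN u0 u; rewrite enorm_distC => h1.
  have h2 : `|g u0| <= `|g u| + `|g u0 - g u|.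
    by rewrite -[X in `|X| <= _](subrKC (g u)) ler_normD.
  have h3 : N * enorm (u - u0) <= N * (e / 2) by rewrite ler_wpM2l// ltW.
  lra.
have -> : `|g u0| `^ p = (2 `^ p / c) * ((`|g u0| / 2) `^ p * c).
  transitivity ((`|g u0| / 2) `^ p * 2 `^ p * (c / c)); last by ring.
  by rewrite divff ?gt_eqF// mulr1 -powRM ?divr_ge0// divfK.
by rewrite EFinM lee_wpmul2l// lee_fin divr_ge0 ?ltW.
Qed.

(** [N] is the largest norm of a point of [C]. It is a Lipschitz constant, and the support function
    reaches at least [N] in the direction of that point: the sup norm on the sphere controls the
    Lipschitz constant. *)
Lemma suppf_lipschitz_bound (C : set 'rV[R]_n) : convex_body C ->
  exists N, [/\ 0 <= N, forall u v, `|suppf C u - suppf C v| <= N * enorm (u - v) &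
    exists2 u, enorm u = 1 & N <= `|suppf C u|].
Proof.
move=> [C0 cC _].
have [|a /set_mem Ca amax] := @EVT_max_rV _ _ (@enorm R n) C C0 cC.
  by apply: continuous_subspaceT; exact: continuous_enorm.
exists (enorm a); split; first exact: enorm_ge0.
  by move=> u v; apply: suppf_lip => // b Cb; exact/amax/mem_set.
have [a0|a0] := eqVneq a 0.
  by have [u u1] := exists_unit_vector R m; exists u => //; rewrite a0 enorm0.
have ea := enorm_gt0 a0; exists ((enorm a)^-1 *: a).
  by rewrite enormZ ger0_norm ?invr_ge0 ?enorm_ge0// mulVf// gt_eqF.
apply: le_trans (ler_norm _); have := suppf_ub cC ((enorm a)^-1 *: a) Ca.
by rewrite dotvZl -sqr_enorm expr2 mulKf// gt_eqF.
Qed.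

(** The pointwise bound with [e = 1/2] has error [(N / 2)^p], at most half of [N^p] since [p >= 1];
    the error is absorbed on the left, which doubles the constant. *)
Lemma suppf_energy_bound : exists2 C, 0 < C & forall K (N : R) u, convex_body K ->
  0 <= N -> (forall u v, `|suppf K u - suppf K v| <= N * enorm (u - v)) ->
  enorm u = 1 -> N <= `|suppf K u| ->
  ((N `^ p)%:E <= C%:E * sphere_energy (suppf K))%E.
Proof.
have h20 : 0 < 2^-1 :> R by rewrite invr_gt0.
have [C C0 hC] := lipschitz_point_bound h20.
exists (2 * (C + 1)) => [|K N u bK N0 KN u1 Nu]; first by rewrite mulr_gt0// ltr_wpDl.
have h1 : ((N `^ p)%:E <= ((2^-1 * N) `^ p)%:E + C%:E * sphere_energy (suppf K))%E.
  apply: le_trans (hC _ _ _ N0 KN u1).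
  by rewrite lee_fin ge0_ler_powR ?nnegrE// ltW.
have h2 : (2^-1 * N) `^ p <= 2^-1 * N `^ p.
  rewrite powRM//.
  by rewrite ler_wpM2r ?powR_ge0// ge1r_powR// h20/= invf_le1// ler1n.
have := sphere_energy_ge0 (suppf K); move: h1.
case: (sphere_energy _) => [s||]//=; last first.
  by move=> _ _; rewrite mulry gtr0_sg ?mul1e ?leey// mulr_gt0// ltr_wpDl.
rewrite -!EFinM -EFinD !lee_fin => h1 s0.
have : 2 * (C + 1) * s = 2 * (C * s) + 2 * s by ring.
lra.
Qed.

Lemma hausdorff_energy_bound (e : R) : 0 < e -> exists2 C, 0 <= C &
  forall K K', convex_body K -> convex_body K' ->
  ((hausdorff_dist K K' `^ p)%:E <= e%:E * (sphere_energy (suppf K) + sphere_energy (suppf K'))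
    + C%:E * sphere_energy (fun u => (suppf K u - suppf K' u)%R))%E.
Proof.
move=> e0; have [C1 C10 hC1] := suppf_energy_bound.
have t0 : 0 < 2 `^ p :> R by rewrite powR_gt0.
have q0 : 0 < e / (2 `^ p * C1) by rewrite divr_gt0// mulr_gt0.
(* The difference has Lipschitz constant at most [N + N'], and [(N + N')^p <= 2^p (N^p + N'^p)],
   where the last sum is at most [C1] times the sum of the energies. This [e'] turns the error term
   into exactly [e] times that sum. *)
pose e' := (e / (2 `^ p * C1)) `^ p^-1.
have e'0 : 0 < e' by rewrite powR_gt0.
have e'p : e' `^ p = e / (2 `^ p * C1).
  by rewrite -powRrM mulVf ?gt_eqF// powRr1// ltW.
have [C C0 hC] := lipschitz_point_bound e'0; exists C => // K K' bK bK'.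
have [N [N0 KN [u u1 Nu]]] := suppf_lipschitz_bound bK.
have [N' [N'0 KN' [u' u'1 Nu']]] := suppf_lipschitz_bound bK'.
have hN := hC1 _ _ _ bK N0 KN u1 Nu; have hN' := hC1 _ _ _ bK' N'0 KN' u'1 Nu'.
set E := sphere_energy (suppf K) in hN *; set E' := sphere_energy (suppf K') in hN' *.
set F := sphere_energy (fun u => _).
have E0 : (0 <= E)%E by exact: sphere_energy_ge0.
have E'0 : (0 <= E')%E by exact: sphere_energy_ge0.
have F0 : (0 <= F)%E by exact: sphere_energy_ge0.
clearbody E E'.
have sumN : (((e' * (N + N')) `^ p)%:E <= e%:E * (E + E'))%E.
  have : (e' * (N + N')) `^ p <= e / C1 * (N `^ p + N' `^ p).
    rewrite powRM ?(ltW e'0) ?addr_ge0// e'p.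
    have : (N + N') `^ p <= 2 `^ p * (N `^ p + N' `^ p).
      wlog NN : N N' {u u1 Nu u' u'1 Nu' hN hN' KN KN'} N0 N'0 / N <= N'.
        move=> h; have [/h|/ltW/h] := leP N N'; first exact.
        by rewrite (addrC N') (addrC (N' `^ p)); exact.
      apply: (@le_trans _ _ ((2 * N') `^ p)).
        by rewrite ge0_ler_powR ?nnegrE ?addr_ge0 ?mulr_ge0// ?(ltW p_gt0)//; lra.
      by rewrite powRM// ler_pM2l// lerDr powR_ge0.
    move=> h; apply: le_trans (ler_wpM2l (ltW q0) h) _.
    rewrite le_eqVlt; apply/orP; left; apply/eqP; field.
    by rewrite !gt_eqF.
  rewrite -lee_fin => h; apply: le_trans h _.
  have eC : 0 < e / C1 by rewrite divr_gt0.
  have {hN hN'} h : ((N `^ p)%:E + (N' `^ p)%:E <= C1%:E * (E + E'))%E.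
    by rewrite (ge0_muleDr _ E0 E'0); exact: leeD hN hN'.
  rewrite EFinM EFinD; apply: (@le_trans _ _ ((e / C1)%:E * (C1%:E * (E + E')))%E).
    by rewrite lee_wpmul2l// lee_fin ltW.
  by rewrite muleA -EFinM divfK// gt_eqF.
have lip v w : `|(suppf K v - suppf K' v) - (suppf K w - suppf K' w)| <= (N + N') * enorm (v - w).
  have -> : (suppf K v - suppf K' v) - (suppf K w - suppf K' w) =
    (suppf K v - suppf K w) - (suppf K' v - suppf K' w) by ring.
  by rewrite mulrDl; apply: le_trans (ler_normB _ _) _; rewrite lerD.
have key v : enorm v = 1 ->
    ((`|suppf K v - suppf K' v| `^ p)%:E <= e%:E * (E + E') + C%:E * F)%E.
  move=> v1; apply: le_trans (hC _ _ _ (addr_ge0 N0 N'0) lip v1) _.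
  by rewrite leeD2r.
have : (0 <= e%:E * (E + E') + C%:E * F)%E.
  have e0' : (0 <= e%:E)%E by rewrite lee_fin ltW.
  by have C0' : (0 <= C%:E)%E; [rewrite lee_fin|exact: (adde_ge0 (mule_ge0 e0' (adde_ge0 E0 E'0)) (mule_ge0 C0' F0))].
move: key; case: (_ + _)%E => [s key s0||]//; last by move=> _ _; exact: leey.
rewrite lee_fin in s0; rewrite lee_fin.
have -> : s = (s `^ p^-1) `^ p by rewrite -powRrM mulVf ?gt_eqF// powRr1.
rewrite ge0_ler_powR ?nnegrE ?hausdorff_ge0 ?powR_ge0 ?(ltW p_gt0)//.
apply: hausdorff_le => //; first exact: powR_ge0.
move=> v /key; rewrite lee_fin => h.
have -> : `|suppf K v - suppf K' v| = (`|suppf K v - suppf K' v| `^ p) `^ p^-1.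
  by rewrite -powRrM mulfV ?gt_eqF// powRr1.
by rewrite ge0_ler_powR ?nnegrE ?powR_ge0// invr_ge0 ltW.
Qed.

Lemma integral_comb d (T : measurableType d) (mu : {measure set T -> \bar R}) (D : set T)
    (U V W : T -> \bar R) (e C : R) : measurable D ->
  measurable_fun D U -> measurable_fun D V -> measurable_fun D W ->
  (forall x, 0 <= U x)%E -> (forall x, 0 <= V x)%E -> (forall x, 0 <= W x)%E ->
  0 <= e -> 0 <= C ->
  (e%:E * (\int[mu]_(x in D) U x + \int[mu]_(x in D) V x) + C%:E * \int[mu]_(x in D) W x
   = \int[mu]_(x in D) (e%:E * (U x + V x) + C%:E * W x))%E.
Proof.
move=> mD mU mV mW U0 V0 W0 e0 C0.
have mUV : measurable_fun D (fun x => U x + V x)%E by exact: emeasurable_funD.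
have UV0 x : (0 <= U x + V x)%E by exact: adde_ge0.
rewrite ge0_integralD//.
- by rewrite !ge0_integralZl ?lee_fin// ge0_integralD.
- by move=> x _; rewrite mule_ge0.
- exact: measurable_funeM.
- by move=> x _; rewrite mule_ge0.
- exact: measurable_funeM.
Qed.

Definition dp_energy (f : measurableTypeR R * 'rV[R]_n -> R) : R :=
  fine (\int[lebesgue_measure]_(a in I01) (sphere_sup f a `^ p)%:E)%E.

Lemma dp_energy_fin f : regular f ->
  (\int[lebesgue_measure]_(a in I01) (sphere_sup f a `^ p)%:E)%E = (dp_energy f)%:E.
Proof.
move=> rf; have [M M0 fM] := sphere_sup_bounded rf.
rewrite /dp_energy fineK// ge0_fin_numE; last first.
  by apply: integral_ge0 => a _; rewrite lee_fin powR_ge0.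
apply: (@le_lt_trans _ _ (\int[lebesgue_measure]_(a in I01) (M `^ p)%:E)%E).
  apply: ge0_le_integral => //.
  - by move=> a _; rewrite lee_fin powR_ge0.
  - apply: measurable_funTS; apply/measurable_EFinP.
    apply: (@measurableT_comp _ _ _ _ _ _ (@powR R ^~ p)) => //.
    exact: measurable_sphere_sup.
  - move=> a _; rewrite lee_fin ge0_ler_powR ?nnegrE ?(ltW p_gt0)//.
    exact: (sphere_sup_ge0 rf a).
by rewrite integral_cst//= lebesgue_measure_itv/= lte01 oppr0 adde0 mule1 ltry.
Qed.

Lemma dp_energy_ge0 f : 0 <= dp_energy f.
Proof. by apply: fine_ge0; apply: integral_ge0 => a _; rewrite lee_fin powR_ge0. Qed.

Lemma dpE (xi eta : 'rV[R]_n -> R) : Fcconv xi -> Fcconv eta ->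
  dp p xi eta = (dp_energy (fun z => csupp xi z - csupp eta z)) `^ p^-1.
Proof.
move=> Fx Fe; apply: (congr1 (fun t : \bar R => fine t `^ p^-1)).
apply: eq_integral => a; rewrite inE /= in_itv /= => a01.
by rewrite hausdorff_sphere_sup.
Qed.

Lemma dp_ge0 (xi eta : 'rV[R]_n -> R) : 0 <= dp p xi eta.
Proof. exact: powR_ge0. Qed.

Lemma dp_powR (xi eta : 'rV[R]_n -> R) : Fcconv xi -> Fcconv eta ->
  dp p xi eta `^ p = dp_energy (fun z => csupp xi z - csupp eta z).
Proof. by move=> Fx Fe; rewrite dpE// -powRrM mulVf ?gt_eqF// powRr1// dp_energy_ge0. Qed.

Lemma measurable_section_energy (g : measurableTypeR R * 'rV[R]_n -> measurableTypeR R) :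
  measurable_fun setT g ->
  measurable_fun setT (fun a : measurableTypeR R => sphere_energy (fun u => g (a, u))).
Proof.
move=> mg; apply: (@measurable_fun_fubini_tonelli_F _ _ _ _ _ _ (fun z => (`|g z| `^ p)%:E)).
  exact: measurable_normr_powR.
by move=> z; rewrite lee_fin powR_ge0.
Qed.

Lemma dp_energy_bound f (U V W : measurableTypeR R -> \bar R) (e C : R) : regular f ->
  measurable_fun setT U -> measurable_fun setT V -> measurable_fun setT W ->
  (forall a, 0 <= U a)%E -> (forall a, 0 <= V a)%E -> (forall a, 0 <= W a)%E ->
  0 <= e -> 0 <= C ->
  (forall a, 0 < a <= 1 -> ((sphere_sup f a `^ p)%:E <= e%:E * (U a + V a) + C%:E * W a)%E) ->
  ((dp_energy f)%:E <= e%:E * (\int[lebesgue_measure]_(a in I01) U a +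
      \int[lebesgue_measure]_(a in I01) V a) + C%:E * \int[lebesgue_measure]_(a in I01) W a)%E.
Proof.
move=> rf mU mV mW U0 V0 W0 e0 C0 h; rewrite -dp_energy_fin//.
rewrite integral_comb//; [|exact: measurable_funTS|exact: measurable_funTS|exact: measurable_funTS].
apply: ge0_le_integral => //.
- by move=> a _; rewrite lee_fin powR_ge0.
- apply: measurable_funTS; apply/measurable_EFinP.
  apply: (@measurableT_comp _ _ _ _ _ _ (@powR R ^~ p)) => //.
  exact: measurable_sphere_sup.
- apply: measurable_funTS; apply: emeasurable_funD; apply: measurable_funeM => //.
  exact: emeasurable_funD.
Qed.

Lemma dp_norm_bound (e : R) : 0 < e -> exists2 C, 0 <= C & forall xi eta : 'rV[R]_n -> R,
  Fcconv xi -> Fcconv eta -> dp p xi eta `^ p <=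
  e * (`|support_embed p1 xi| `^ p + `|support_embed p1 eta| `^ p)
  + C * `|support_embed p1 xi - support_embed p1 eta| `^ p.
Proof.
move=> e0; have [C C0 hC] := hausdorff_energy_bound e0; exists C => // xi eta Fx Fe.
have rf := regularB (regular_csupp Fx) (regular_csupp Fe).
have [mx _ _ _] := regular_csupp Fx; have [me _ _ _] := regular_csupp Fe; have [mf _ _ _] := rf.
have := Lp_norm_energy mf (support_embed_sub p1 Fx Fe).
have := Lp_norm_energy me (support_embedE p1 Fe).
have := Lp_norm_energy mx (support_embedE p1 Fx).
move: `|support_embed p1 xi| `|support_embed p1 eta| `|support_embed p1 xi - support_embed p1 eta|.
move=> Nx Ne Nf Hx He Hf.
rewrite -lee_fin dp_powR// EFinD !EFinM EFinD Hx He Hf.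
apply: (dp_energy_bound rf (measurable_section_energy mx) (measurable_section_energy me)
  (measurable_section_energy mf) (fun _ => sphere_energy_ge0 _) (fun _ => sphere_energy_ge0 _)
  (fun _ => sphere_energy_ge0 _) (ltW e0) C0) => a a01.
rewrite -hausdorff_sphere_sup//.
have := hC _ _ (convex_body_cut Fx a01) (convex_body_cut Fe a01).
rewrite /sphere_energy /csupp /= a01; exact.
Qed.

End norm_comparison.

(** * Measurability of the metric *)

(* The Borel function expressing [dp] through differences of embeddings is a
   supremum of integrals of the functions [level_max], which are Lipschitz for
   the [L^1] norm: [level r N] is close to [r^p] times the indicator function
   of the event that [|g|] exceeds [r] with positive probability. *)
Section dp_borel.
Context (R : realType) (m : nat).
Local Notation n := m.+1.
Local Notation sigma := (@sphere_measure R n).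
Local Notation cyl := (@cyl_measure R n).
Local Notation I01 := (`]0, 1]%classic : set (measurableTypeR R)).
Context (p : R) (p1 : (1 <= p%:E)%E).
Local Notation B := (LpB n p1).

Let p_ge1 : 1 <= p. Proof. by rewrite -lee_fin. Qed.
Let p_gt0 : 0 < p. Proof. exact: lt_le_trans ltr01 p_ge1. Qed.

(** A 1-Lipschitz substitute for the indicator function of []r, +oo[], positive on the same set. *)
Definition bump (r t : R) : R := Num.min 1 (Num.max 0 (t - r)).

Lemma bump_ge0 r t : 0 <= bump r t.
Proof. by rewrite le_min ler01/= le_max lexx. Qed.

Lemma bump_eq0 r t : t <= r -> bump r t = 0.
Proof. by move=> tr; rewrite /bump max_l ?subr_le0// min_r. Qed.

Lemma bump_lip r t t' : bump r t <= bump r t' + `|t - t'|.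
Proof.
have h1 := ler_norm (t - t'); have h2 := normr_ge0 (t - t').
rewrite /bump; have [a|a] := leP 0 (t - r); have [b|b] := leP 0 (t' - r);
  rewrite !minEle; repeat (case: ifPn; rewrite -?ltNge => ?); lra.
Qed.

Lemma measurable_bump r : measurable_fun setT (bump r : measurableTypeR R -> measurableTypeR R).
Proof.
apply: measurable_minr => //; apply: measurable_maxr => //.
exact: measurable_funB.
Qed.

Lemma measurable_bump_normr r d (T : measurableType d) (g : T -> measurableTypeR R) :
  measurable_fun setT g -> measurable_fun setT (fun z => (bump r `|g z|)%:E).
Proof.
move=> mg; apply/measurable_EFinP; apply: (measurableT_comp (measurable_bump r)).
exact: measurableT_comp.
Qed.

Definition exceed r (g : 'rV[R]_n -> R) : \bar R := (\int[sigma]_u (bump r `|g u|)%:E)%E.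

Definition L1dist (g h : 'rV[R]_n -> R) : \bar R := (\int[sigma]_u `|(g u - h u)%R|%:E)%E.

Lemma exceed_ge0 r g : (0 <= exceed r g)%E.
Proof. by apply: integral_ge0 => u _; rewrite lee_fin bump_ge0. Qed.

Lemma L1dist_ge0 g h : (0 <= L1dist g h)%E.
Proof. by apply: integral_ge0 => u _; rewrite lee_fin. Qed.

Lemma exceed_lip r (g h : 'rV[R]_n -> measurableTypeR R) :
  measurable_fun setT g -> measurable_fun setT h ->
  (exceed r g <= exceed r h + L1dist g h)%E.
Proof.
move=> mg mh; have mgh : measurable_fun setT (fun u => `|g u - h u|%:E).
  by apply/measurable_EFinP; apply: measurableT_comp => //; exact: measurable_funB.
rewrite -ge0_integralD//; last 2 first.
- by move=> u _; rewrite lee_fin bump_ge0.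
- exact: measurable_bump_normr.
apply: ge0_le_integral => //.
- by move=> u _; rewrite lee_fin bump_ge0.
- exact: measurable_bump_normr.
- by apply: emeasurable_funD => //; exact: measurable_bump_normr.
move=> u _; rewrite -EFinD lee_fin; apply: le_trans (bump_lip _ _ `|h u|) _.
by rewrite lerD2l ler_dist_dist.
Qed.

Definition level (i : nat) : R * R :=
  if unpickle i is Some (q, N) then (`|ratr q|, (N : nat)%:R) else (0, 0).

Lemma level_ge0 i : 0 <= (level i).1 /\ 0 <= (level i).2.
Proof. by rewrite /level; case: unpickle => [[q N]|] //=. Qed.

(** For large [N] the minimum is 1 as soon as [exceed] is positive, and it is 0 when [exceed]
    vanishes. The supremum over all [i] is therefore that of [r^p] over the rational [r] that [|g|]
    exceeds with positive probability. *)
Definition level_term (i : nat) (g : 'rV[R]_n -> R) : \bar R :=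
  (((level i).1 `^ p)%:E * mine 1 ((level i).2%:E * exceed (level i).1 g))%E.

Fixpoint level_max (k : nat) (g : 'rV[R]_n -> R) : \bar R :=
  if k is k'.+1 then maxe (level_max k' g) (level_term k' g) else 0%E.

Fixpoint level_lip (k : nat) : R :=
  if k is k'.+1 then level_lip k' + (level k').1 `^ p * (level k').2 else 0.

Lemma level_lip_ge0 k : 0 <= level_lip k.
Proof.
by elim: k => //= k ih; rewrite addr_ge0// mulr_ge0 ?powR_ge0//; case: (level_ge0 k).
Qed.

Lemma level_max_ge0 k g : (0 <= level_max k g)%E.
Proof. by elim: k => //= k ih; rewrite le_max ih. Qed.

Lemma level_term_lip i (g h : 'rV[R]_n -> measurableTypeR R) :
  measurable_fun setT g -> measurable_fun setT h ->
  (level_term i g <= level_term i h + ((level i).1 `^ p * (level i).2)%:E * L1dist g h)%E.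
Proof.
move=> mg mh; have [l1 l2] := level_ge0 i.
have e0 := exceed_ge0 (level i).1; have d0 := L1dist_ge0 g h.
rewrite /level_term EFinM -muleA -ge0_muleDr; last 2 first.
- by rewrite le_min lee01/= mule_ge0// lee_fin.
- by rewrite mule_ge0// lee_fin.
rewrite lee_wpmul2l ?lee_fin ?powR_ge0//.
have := exceed_lip (level i).1 mg mh.
move: (exceed _ g) (exceed _ h) (L1dist g h) (e0 g) (e0 h) d0 => a b c a0 b0 c0 abc.
have h1 : ((level i).2%:E * a <= (level i).2%:E * b + (level i).2%:E * c)%E.
  by rewrite -ge0_muleDr// lee_wpmul2l// lee_fin.
rewrite [X in (_ <= X + _)%E]minEle; case: ifPn => _.
  by apply: (@le_trans _ _ 1%E); [rewrite ge_min lexx | rewrite leeDl// mule_ge0// lee_fin].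
by apply: le_trans h1; rewrite ge_min lexx orbT.
Qed.

Lemma level_max_lip k (g h : 'rV[R]_n -> measurableTypeR R) :
  measurable_fun setT g -> measurable_fun setT h ->
  (level_max k g <= level_max k h + (level_lip k)%:E * L1dist g h)%E.
Proof.
move=> mg mh; have d0 := L1dist_ge0 g h; elim: k => [|k ih] /=; first by rewrite mul0e adde0.
have [l1 l2] := level_ge0 k; have t := level_term_lip k mg mh.
have q0 : 0 <= (level k).1 `^ p * (level k).2 by rewrite mulr_ge0// powR_ge0.
rewrite EFinD ge0_muleDl ?lee_fin ?level_lip_ge0// ge_max; apply/andP; split.
  apply: le_trans ih _; apply: leeD; first by rewrite le_max lexx.
  by rewrite leeDl// mule_ge0.
apply: le_trans t _; apply: leeD; first by rewrite le_max lexx orbT.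
by rewrite leeDr// mule_ge0// lee_fin level_lip_ge0.
Qed.

Lemma measurable_level_max k (g : measurableTypeR R * 'rV[R]_n -> measurableTypeR R) :
  measurable_fun setT g ->
  measurable_fun setT (fun a : measurableTypeR R => level_max k (fun u => g (a, u))).
Proof.
move=> mg; elim: k => [|k ih] /=; first exact: measurable_cst.
apply: measurable_maxe => //; apply: measurable_funeM; apply: measurable_mine => //.
apply: measurable_funeM.
apply: (@measurable_fun_fubini_tonelli_F _ _ _ _ _ _ (fun z => (bump (level k).1 `|g z|)%:E)).
  exact: measurable_bump_normr.
by move=> z; rewrite lee_fin bump_ge0.
Qed.

Lemma level_surj (q : rat) (N : nat) : 0 <= q -> exists i, level i = (ratr q, N%:R).
Proof.
by move=> q0; exists (pickle (q, N)); rewrite /level pickleK ger0_norm// ler0q.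
Qed.

Section regular.
Context (f : measurableTypeR R * 'rV[R]_n -> R) (rf : regular f) (a : R).
Let g (u : 'rV[R]_n) := f (a, u).

Lemma measurable_g : measurable_fun setT (g : 'rV[R]_n -> measurableTypeR R).
Proof. exact: measurable_regular_section. Qed.

Lemma exceed_eq0 r : sphere_sup f a <= r -> exceed r g = 0%E.
Proof.
move=> ar; rewrite /exceed (@ae_eq_integral _ _ _ _ _ (cst 0%E))//.
- by rewrite integral0.
- by apply: measurable_bump_normr; exact: measurable_g.
move: (sphere_measure_sphere R m); apply: filterS => u u1 _.
by rewrite bump_eq0//; apply: le_trans ar; exact: sphere_sup_ub.
Qed.

Lemma exceed_gt0 r : 0 <= r -> r < sphere_sup f a -> (0 < exceed r g)%E.
Proof.
move=> r0 ra; pose e := (sphere_sup f a - r) / 2.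
have e0 : 0 < e by rewrite divr_gt0// subr_gt0.
have re : r + e < sphere_sup f a by rewrite /e; lra.
have mA : measurable [set u | r + e < `|g u|].
  have := measurableT_comp (@normr_measurable R setT) measurable_g.
  move=> /(_ measurableT `]r + e, +oo[%classic (measurable_itv _)).
  by rewrite setTI preimage_itvoy.
have s0 : (0 < sigma [set u | (r + e < `|g u|)%R])%E.
  by rewrite -(sphere_sup_gtE rf)// addr_ge0// ltW.
have b0 : 0 < Num.min 1 e by rewrite lt_min ltr01.
apply: (@lt_le_trans _ _ (\int[sigma]_(u in [set u | (r + e < `|g u|)%R]) (Num.min 1 e)%:E)%E).
  by rewrite integral_cst//= mule_gt0.
apply: (@le_trans _ _ (\int[sigma]_(u in [set u | (r + e < `|g u|)%R]) (bump r `|g u|)%:E)%E).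
  apply: ge0_le_integral => //.
  - by move=> u _; rewrite lee_fin ltW.
  - by apply: measurable_funTS; apply: measurable_bump_normr; exact: measurable_g.
  move=> u /= eu; rewrite lee_fin /bump le_min ge_min lexx/=.
  by rewrite ge_min; apply/orP; right; rewrite le_max; apply/orP; right; lra.
apply: ge0_subset_integral => //.
- by apply: measurable_bump_normr; exact: measurable_g.
- by move=> u _; rewrite lee_fin bump_ge0.
Qed.

Lemma level_max_le k : (level_max k g <= (sphere_sup f a `^ p)%:E)%E.
Proof.
have H0 := sphere_sup_ge0 rf a.
elim: k => [|k ih] /=; first by rewrite lee_fin powR_ge0.
rewrite ge_max ih /= /level_term; have [l1 l2] := level_ge0 k.
have [h|h] := leP (sphere_sup f a) (level k).1.
  by rewrite exceed_eq0// mule0 min_r ?lee01// mule0 lee_fin powR_ge0.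
apply: (@le_trans _ _ (((level k).1 `^ p)%:E * 1)%E).
  by rewrite lee_wpmul2l ?lee_fin ?powR_ge0// ge_min lexx.
by rewrite mule1 lee_fin ge0_ler_powR ?nnegrE ?(ltW p_gt0)// ltW.
Qed.

Lemma level_max_ndec : nondecreasing_seq (fun k => level_max k g).
Proof. by apply/nondecreasing_seqP => k /=; rewrite le_max lexx. Qed.

Lemma level_max_sup : limn (fun k => level_max k g) = (sphere_sup f a `^ p)%:E.
Proof.
have cvgl := ereal_nondecreasing_cvgn level_max_ndec.
rewrite (cvg_lim _ cvgl)//; apply/le_anti/andP; split.
  by apply: ub_ereal_sup => _ [k _ <-]; exact: level_max_le.
apply/lee_subgt0Pr => e e0.
have H0 := sphere_sup_ge0 rf a.
have [->|Hn0] := eqVneq (sphere_sup f a) 0.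
  rewrite powR0 ?gt_eqF//; apply: (@le_trans _ _ 0%E); first by rewrite -EFinB lee_fin sub0r oppr_le0 ltW.
  by apply: ereal_sup_ubound; exists 0%N.
have Hgt0 : 0 < sphere_sup f a by rewrite lt0r Hn0.
(* Truncated at 0 so that taking the power [1/p] and then [p] gives back [s]. *)
pose s := Num.max 0 (sphere_sup f a `^ p - e).
have s0 : 0 <= s by rewrite le_max lexx.
have sH : s `^ p^-1 < sphere_sup f a.
  rewrite [ltRHS](_ : _ = (sphere_sup f a `^ p) `^ p^-1); last first.
    by rewrite -powRrM mulfV ?gt_eqF// powRr1.
  rewrite gt0_ltr_powR ?nnegrE ?powR_ge0 ?invr_gt0// gt_max powR_gt0//=.
  by rewrite ltrBlDr ltrDl.
have [q] := rat_in_itvoo sH; rewrite in_itv /= => /andP[sq qH].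
have q0 : 0 <= ratr q :> R by apply: le_trans (ltW sq); exact: powR_ge0.
have ex0 := exceed_gt0 q0 qH.
(* This [N] saturates the minimum in [level_term], whose value becomes [q^p]. *)
have [N Nex] : exists N : nat, (1 <= N%:R%:E * exceed (ratr q) g)%E.
  move: ex0; case: (exceed _ _) => [x||]//; last first.
    by move=> _; exists 1%N; rewrite mul1e leey.
  rewrite lte_fin => x0; exists (Num.truncn x^-1).+1.
  rewrite -EFinM lee_fin -ler_pdivrMr// div1r ltW//.
  exact: truncnS_gt.
have [i li] : exists i, level i = (ratr q, N%:R) by apply: level_surj; rewrite -(ler0q R).
apply: (@le_trans _ _ (level_max i.+1 g)); last by apply: ereal_sup_ubound; exists i.+1.
rewrite /= le_max; apply/orP; right; rewrite /level_term li /= min_l// mule1.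
rewrite -EFinB lee_fin; apply: (@le_trans _ _ s); first by rewrite le_max lexx orbT.
rewrite [leLHS](_ : _ = (s `^ p^-1) `^ p); last by rewrite -powRrM mulVf ?gt_eqF// powRr1.
by rewrite ge0_ler_powR ?nnegrE ?powR_ge0 ?(ltW p_gt0)// ltW.
Qed.

End regular.

Definition level_integral (k : nat) (g : measurableTypeR R * 'rV[R]_n -> R) : \bar R :=
  (\int[lebesgue_measure]_(a in I01) level_max k (fun u => g (a, u)))%E.

Lemma level_integral_lip k (g h : measurableTypeR R * 'rV[R]_n -> measurableTypeR R) :
  measurable_fun setT g -> measurable_fun setT h ->
  (level_integral k g <= level_integral k h + (level_lip k)%:E * \int[cyl]_z `|(g z - h z)%R|%:E)%E.
Proof.
move=> mg mh; have mgh : measurable_fun setT (fun z => `|g z - h z|%:E).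
  by apply/measurable_EFinP; apply: measurableT_comp => //; exact: measurable_funB.
rewrite (@cyl_integral _ _ (fun z => `|(g z - h z)%R|%:E))//.
have mL : measurable_fun setT (fun a : measurableTypeR R => L1dist (fun u => g (a, u)) (fun u => h (a, u))).
  exact: (@measurable_fun_fubini_tonelli_F _ _ _ _ _ _ (fun z => `|(g z - h z)%R|%:E)).
have mI : measurable I01 by exact: measurable_itv.
have key (D : set (measurableTypeR R)) (U V W : measurableTypeR R -> \bar R) (C : R) :
    measurable D -> measurable_fun setT U -> measurable_fun setT V -> measurable_fun setT W ->
    (forall a, 0 <= U a)%E -> (forall a, 0 <= V a)%E -> (forall a, 0 <= W a)%E -> 0 <= C ->
    (forall a, U a <= V a + C%:E * W a)%E ->
    (\int[lebesgue_measure]_(a in D) U a <= \int[lebesgue_measure]_(a in D) V a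
      + C%:E * \int[lebesgue_measure]_(a in D) W a)%E.
  move=> mD mU mV mW U0 V0 W0 C0 h'.
  rewrite -ge0_integralZl//; last exact: measurable_funTS.
  rewrite -ge0_integralD//; last 3 first.
  - exact: measurable_funTS.
  - by move=> a _; rewrite mule_ge0.
  - by apply: measurable_funeM; exact: measurable_funTS.
  apply: ge0_le_integral => //.
  - exact: measurable_funTS.
  - by apply: measurable_funTS; apply: emeasurable_funD => //; exact: measurable_funeM.
apply: (key _ _ _ _ _ mI (measurable_level_max k mg) (measurable_level_max k mh) mL
  (fun _ => level_max_ge0 _ _) (fun _ => level_max_ge0 _ _) (fun _ => L1dist_ge0 _ _) (level_lip_ge0 k)) => a.
by apply: level_max_lip; exact: measurableT_comp.
Qed.

Lemma level_integral_sup f : regular f ->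
  ereal_sup (range (fun k => level_integral k f)) = (dp_energy p f)%:E.
Proof.
move=> rf; have [mf _ _ _] := rf; rewrite -dp_energy_fin//.
have nd : nondecreasing_seq (fun k => level_integral k f).
  move=> k l kl; apply: ge0_le_integral => //.
  - by move=> a _; exact: level_max_ge0.
  - by apply: measurable_funTS; exact: measurable_level_max.
  - by apply: measurable_funTS; exact: measurable_level_max.
  - by move=> a _; apply: (@level_max_ndec f a).
rewrite -(cvg_lim _ (ereal_nondecreasing_cvgn nd))//.
rewrite -monotone_convergence//.
- by apply: eq_integral => a _; rewrite level_max_sup.
- by move=> k; apply: measurable_funTS; exact: measurable_level_max.
- by move=> k a _; exact: level_max_ge0.
- by move=> a _; exact: (@level_max_ndec f a).
Qed.

(** Integrates [t <= e + e^(1-p) t^p], valid for all [t >= 0] according to whether [t <= e], over a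
    space of total mass 1. The choice [e = |b|] gives the factor 2. *)
Lemma L1_le_norm (b : B) : (\int[cyl]_z `|Lp_fun b z|%:E <= (2 * `|b|)%:E)%E.
Proof.
have mb := measurable_Lp_fun b.
have main (e : R) : 0 < e -> (\int[cyl]_z `|Lp_fun b z|%:E <= (e + e `^ (1 - p) * `|b| `^ p)%:E)%E.
  move=> e0; rewrite EFinD EFinM Lp_norm_powR.
  have e1 : 0 <= e `^ (1 - p) by exact: powR_ge0.
  have mbp : measurable_fun setT (fun z => (`|Lp_fun b z| `^ p)%:E) by exact: measurable_normr_powR.
  rewrite -ge0_integralZl ?lee_fin//.
  have -> : e%:E = (\int[cyl]_z e%:E)%E by rewrite integral_cst// cyl_setT mule1.
  rewrite -ge0_integralD//; last 3 first.
  - by move=> z _; rewrite lee_fin ltW.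
  - by move=> z _; rewrite mule_ge0// lee_fin powR_ge0.
  - exact: measurable_funeM.
  apply: ge0_le_integral => //.
  - by apply/measurable_EFinP; exact: measurableT_comp.
  - by apply: emeasurable_funD => //; exact: measurable_funeM.
  move=> z _; rewrite -EFinM -EFinD lee_fin.
  set t := `|Lp_fun b z|; have t0 : 0 <= t by exact: normr_ge0.
  have [te|et] := leP t e; first by apply: le_trans te _; rewrite lerDl mulr_ge0 ?powR_ge0.
  apply: le_trans (_ : e `^ (1 - p) * t `^ p <= _); last by rewrite lerDr ltW.
  have t1 : 0 < t by exact: lt_trans et.
  rewrite -[leLHS](_ : t `^ (1 - p) * t `^ p = t); last first.
    by rewrite -powRD ?subrK ?powRr1// gt_eqF// implybT.
  rewrite ler_wpM2r ?powR_ge0// -(opprB p) !powRN lef_pV2 ?posrE ?powR_gt0//.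
  by rewrite ge0_ler_powR ?nnegrE ?subr_ge0 ?(ltW e0) ?(ltW et).
have [b0|b0] := eqVneq `|b| 0.
  rewrite b0 mulr0; apply/lee_addgt0Pr => e e0; rewrite add0e.
  by have := main e e0; rewrite b0 powR0 ?gt_eqF// mulr0 addr0.
have bp : 0 < `|b| by rewrite lt0r b0 normr_ge0.
have := main _ bp; rewrite -powRD; last by rewrite (gt_eqF bp) implybT.
by rewrite subrK powRr1 ?normr_ge0// -mulr2n mulr_natl.
Qed.

(** Defined on all of [B], where the supremum may be infinite and [fine] then returns 0. On
    differences of embeddings it is finite and the formula gives [dp]. *)
Definition dp_of (b : B) : R :=
  fine (ereal_sup (range (fun k => level_integral k (Lp_fun b)))) `^ p^-1.

Lemma level_integral_Lp k (b c : B) :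
  (level_integral k (Lp_fun b) <= level_integral k (Lp_fun c) + (level_lip k * (2 * `|b - c|))%:E)%E.
Proof.
apply: le_trans (level_integral_lip k (measurable_Lp_fun b) (measurable_Lp_fun c)) _.
rewrite leeD2l// EFinM lee_wpmul2l ?lee_fin ?level_lip_ge0//.
apply: le_trans (L1_le_norm (b - c)); rewrite le_eqVlt; apply/orP; left; apply/eqP.
apply: ae_eq_integral => //.
- apply/measurable_EFinP; apply: measurableT_comp => //.
  by apply: measurable_funB; exact: measurable_Lp_fun.
- by apply/measurable_EFinP; apply: measurableT_comp => //; exact: measurable_Lp_fun.
by move: (Lp_funB b c); apply: filterS => z h zT; rewrite h.
Qed.

(** Each level integral satisfies a Lipschitz bound on [B], so their supremum is lower
    semicontinuous: the sets where it exceeds a given value are open. *)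
Lemma measurable_dp_of : measurable_fun setT (dp_of : Borel B -> measurableTypeR R).
Proof.
apply: (@measurableT_comp _ _ _ _ _ _ (@powR R ^~ p^-1)) => //.
apply: measurableT_comp => //.
apply: (measurability _ (ErealGenOInfty.measurableE R)) => //.
move=> _ [_ [r ->] <-]; rewrite setTI preimage_itvoy.
apply: sub_sigma_algebra; rewrite openE => b /= rb.
have [k rk] : exists k, (r%:E < level_integral k (Lp_fun b))%E.
  apply: contrapT => H; move: rb; rewrite ltNge => /negP; apply.
  apply: ub_ereal_sup => _ [k _ <-]; rewrite leNgt; apply/negP => h; apply: H.
  by exists k.
have [e e0 he] : exists2 e : R, 0 < e & (r%:E + e%:E <= level_integral k (Lp_fun b))%E.
  move: rk; case: (level_integral _ _) => [x||]//.
    rewrite lte_fin => rx; exists (x - r); first by rewrite subr_gt0.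
    by rewrite -EFinD subrKC.
  by move=> _; exists 1; rewrite ?leey.
have C0 : 0 < level_lip k + 1 by rewrite ltr_wpDl// level_lip_ge0.
apply/nbhs_normP; exists (e / (2 * (level_lip k + 1))) => /=.
  by rewrite divr_gt0// mulr_gt0.
move=> c /=; rewrite ltr_pdivlMr ?mulr_gt0// => bc.
apply: (@lt_le_trans _ _ (level_integral k (Lp_fun c))); last by apply: ereal_sup_ubound; exists k.
have := le_trans he (level_integral_Lp k b c).
have hs : level_lip k * (2 * `|b - c|) < e.
  by apply: le_lt_trans bc; have := normr_ge0 (b - c); lra.
case: (level_integral k (Lp_fun c)) => [x||]//=; last by rewrite ltry.
rewrite -!EFinD lee_fin lte_fin; lra.
Qed.

Lemma dp_ofE (xi eta : 'rV[R]_n -> R) : Fcconv xi -> Fcconv eta ->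
  dp p xi eta = dp_of (support_embed p1 xi - support_embed p1 eta).
Proof.
move=> Fx Fe; rewrite dpE//; congr (_ `^ _).
have rf := regularB (regular_csupp Fx) (regular_csupp Fe); have [mf _ _ _] := rf.
set f := fun z => _ in rf mf *; have mb := measurable_Lp_fun (support_embed p1 xi - support_embed p1 eta).
have E k : level_integral k (Lp_fun (support_embed p1 xi - support_embed p1 eta)) = level_integral k f.
  (* Functions of the same class are at [L^1] distance 0, so the Lipschitz bound, used in both
     directions, equates their level integrals. *)
  have zero (g h : measurableTypeR R * 'rV[R]_n -> R) : g = h %[ae cyl] ->
      measurable_fun setT (g : _ -> measurableTypeR R) -> measurable_fun setT (h : _ -> measurableTypeR R) ->
      (\int[cyl]_z `|(g z - h z)%R|%:E = 0)%E.
    move=> gh mg mh; rewrite (@ae_eq_integral _ _ _ _ _ (cst 0%E))//.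
    - by rewrite integral0.
    - by apply/measurable_EFinP; apply: measurableT_comp => //; exact: measurable_funB.
    - by move: gh; apply: filterS => z h' zT; rewrite h'// subrr normr0.
  have bf := support_embed_sub p1 Fx Fe.
  apply/le_anti/andP; split.
    by have := level_integral_lip k mb mf; rewrite zero// mule0 adde0.
  have := level_integral_lip k mf mb; rewrite zero ?mule0 ?adde0//.
  by move: bf; apply: filterS => z h zT; rewrite h.
by under eq_fun do rewrite E; rewrite level_integral_sup.
Qed.

End dp_borel.

(** * Limits of fuzzy vectors *)

Section fuzzy_series.
Context (R : realType) (n : nat).
Implicit Types (xi eta : 'rV[R]_n -> R) (u v x y : 'rV[R]_n).

Lemma closure_enormP (A : set 'rV[R]_n) x :
  closure A x <-> forall e : R, 0 < e -> exists2 y, A y & enorm (x - y) < e.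
Proof.
split => [cAx e e0|h B].
  have e1 : 0 < e / n.+1%:R by rewrite divr_gt0.
  have [|y [Ay /= xy]] := cAx [set y | `|x - y| < e / n.+1%:R].
    by apply/(@nbhs_normP R 'rV[R]_n); exists (e / n.+1%:R).
  exists y => //; apply: le_lt_trans (enorm_le_norm _) _.
  apply: (@le_lt_trans _ _ (n.+1%:R * `|x - y|)); first by rewrite ler_wpM2r// ler_nat.
  by rewrite mulrC -ltr_pdivlMr.
move=> /(@nbhs_normP R 'rV[R]_n)[e /= e0 xeB]; have [y Ay xy] := h e e0.
by exists y; split => //; apply: xeB; exact: le_lt_trans (norm_le_enorm _) xy.
Qed.

Lemma convex_closure (A : set 'rV[R]_n) : convex_set A -> convex_set (closure A).
Proof.
move=> /convex_setP cA; apply/convex_setP => x y t /closure_enormP cx /closure_enormP cy t01.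
apply/closure_enormP => e e0; have [x' Ax' xx'] := cx e e0; have [y' Ay' yy'] := cy e e0.
exists (t *: x' + (1 - t) *: y'); first exact: cA.
have -> : t *: x + (1 - t) *: y - (t *: x' + (1 - t) *: y') =
  t *: (x - x') + (1 - t) *: (y - y') by rewrite !scalerBr opprD addrACA.
apply: le_lt_trans (ler_enormD _ _) _; rewrite !enormZ.
case/andP: t01 => t0 t1; rewrite !ger0_norm ?subr_ge0//.
apply: (@le_lt_trans _ _ (Num.max (enorm (x - x')) (enorm (y - y')))); last by rewrite gt_max xx'.
set M := Num.max _ _; have h1 : enorm (x - x') <= M by rewrite le_max lexx.
have h2 : enorm (y - y') <= M by rewrite le_max lexx orbT.
have := ler_wpM2l t0 h1; have t1' : 0 <= 1 - t by rewrite subr_ge0.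
by have := ler_wpM2l t1' h2; lra.
Qed.

(** A maximiser of [u] on the support is close to some [y] with [xi y > 0], and [y] lies in every
    cut of level at most [xi y]. *)
Lemma fsupp_approx xi u (e : R) : Fcconv xi -> 0 < e -> exists2 a : R, 0 < a <= 1 &
  forall b, 0 < b <= a -> suppf (fsupp xi) u <= suppf (alpha_cut xi b) u + e.
Proof.
move=> Fx e0; have [S0 cS _] := convex_body_fsupp Fx.
have [x /closure_enormP xS <-] := suppf_attained S0 cS u.
have u1 : 0 < enorm u + 1 by rewrite ltr_wpDl// enorm_ge0.
have [|y /= y0 xy] := xS (e / (enorm u + 1)); first by rewrite divr_gt0.
have [x01 _ _ _] := Fx; have /andP[_ y1] := x01 y.
exists (xi y) => [|b /andP[b0 bx]]; first by rewrite y0.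
have [_ cB _] : convex_body (alpha_cut xi b) by apply: convex_body_cut => //; rewrite b0 (le_trans bx).
have h1 := suppf_ub cB u (bx : alpha_cut xi b y).
have h2 := dotv_le u (x - y); rewrite dotvBr in h2.
have h3 : enorm u * enorm (x - y) <= e.
  apply: le_trans (ler_wpM2l (enorm_ge0 u) (ltW xy)) _.
  by rewrite mulrCA ler_piMr ?(ltW e0)// ler_pdivrMr// mul1r lerDl.
lra.
Qed.

Lemma suppf_fsupp_ge xi u (a : R) : Fcconv xi -> 0 < a <= 1 ->
  suppf (alpha_cut xi a) u <= suppf (fsupp xi) u.
Proof.
move=> Fx a01; have [A0 cA _] := convex_body_cut Fx a01; have [S0 cS _] := convex_body_fsupp Fx.
apply: suppf_le => // x ax; apply: suppf_ub => //.
by apply: cut_sub_fsupp ax; case/andP: a01.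
Qed.

(* Widths [suppf u + suppf (-u)] are nonnegative and additive, so bounded
   widths and convergent base points force convergence. *)
Lemma cvg_suppf_series (D : nat -> set 'rV[R]_n) (c : nat -> 'rV[R]_n) zc (W : 'rV[R]_n -> R) :
  (forall i, convex_body (D i)) -> (forall i, D i (c i)) ->
  (forall u, \sum_(i < k) dotv u (c i) @[k --> \oo] --> dotv u zc) ->
  (forall u k, \sum_(i < k) suppf (D i) u + \sum_(i < k) suppf (D i) (- u) <= W u) ->
  exists T : 'rV[R]_n -> R, forall u, \sum_(i < k) suppf (D i) u @[k --> \oo] --> T u.
Proof.
move=> bD Dc cc hW.
exists (fun u => limn (fun k => \sum_(i < k) (suppf (D i) u - dotv u (c i))) + dotv u zc) => u.
have sE k : \sum_(i < k) suppf (D i) u =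
    \sum_(i < k) (suppf (D i) u - dotv u (c i)) + \sum_(i < k) dotv u (c i).
  by rewrite sumrB subrK.
under eq_fun do rewrite sE; apply: cvgD; last exact: cc.
apply: nondecreasing_is_cvgn.
  apply/nondecreasing_seqP => k; rewrite big_ord_recr/= lerDl subr_ge0.
  by apply: suppf_ub => //; have [] := bD k.
exists (W u) => _ [k _ <-]; apply: le_trans (hW u k); rewrite sumrB lerD2l.
rewrite -sumrN; apply: ler_sum => i _; rewrite -dotvNl.
by apply: suppf_ub => //; have [] := bD i.
Qed.

Section limit.
Context (K : set 'rV[R]_n) (F E : nat -> 'rV[R]_n -> R) (q : 'rV[R]_n -> R)
  (c : nat -> 'rV[R]_n) (zc : 'rV[R]_n).
Hypotheses (KD : forall x y, K x -> K y -> K (x + y))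
  (KZ : forall (l : R) x, 0 < l -> K x -> K (l *: x))
  (FK : forall i, FcconvK K (F i)) (FE : forall k, Fcconv (E k)) (Fq : Fcconv q)
  (Fc : forall i, alpha_cut (F i) 1 (c i))
  (cvg_c : forall u, \sum_(i < k) dotv u (c i) @[k --> \oo] --> dotv u zc)
  (qE : forall k (a : R) u, 0 < a <= 1 -> suppf (alpha_cut q a) u =
     \sum_(i < k) suppf (alpha_cut (F i) a) u + suppf (alpha_cut (E k) a) u).

Let FF i : Fcconv (F i) := (FK i).1.

Let Fc_cut (a : R) i : a <= 1 -> alpha_cut (F i) a (c i).
Proof. by move=> a1; exact: cut_subset (Fc i). Qed.

(** The remainder [E k] has nonnegative width, so partial sums are no wider than [q]. Using the
    support of [q] makes the bound independent of the level. *)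
Lemma width_bound : exists W : 'rV[R]_n -> R, forall (a : R) u k, 0 < a <= 1 ->
  \sum_(i < k) suppf (alpha_cut (F i) a) u + \sum_(i < k) suppf (alpha_cut (F i) a) (- u) <= W u.
Proof.
exists (fun u => suppf (fsupp q) u + suppf (fsupp q) (- u)) => a u k a01.
have h1 := qE k u a01; have h2 := qE k (- u) a01.
have h3 := suppf_fsupp_ge u Fq a01; have h4 := suppf_fsupp_ge (- u) Fq a01.
have [E0 cE _] := convex_body_cut (FE k) a01.
have := suppfN E0 cE u; lra.
Qed.

Lemma sum_fsupp_approx u (e : R) k : 0 < e -> exists2 a : R, 0 < a <= 1 &
  forall b, 0 < b <= a -> \sum_(i < k) suppf (fsupp (F i)) u <=
    \sum_(i < k) suppf (alpha_cut (F i) b) u + e.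
Proof.
elim: k e => [|k ih] e e0; first by exists 1; rewrite ?ltr01 ?lexx// => b _; rewrite !big_ord0 add0r ltW.
have e2 : 0 < e / 2 by rewrite divr_gt0.
have [a /andP[a0 a1] ha] := ih _ e2; have [a' /andP[a'0 a'1] ha'] := fsupp_approx u (FF k) e2.
exists (Num.min a a') => [|b /andP[b0]]; first by rewrite lt_min a0 a'0 ge_min a1.
rewrite le_min => /andP[ba ba']; rewrite !big_ord_recr /=.
have := ha b; have := ha' b; rewrite b0 ba ba' => /(_ isT) + /(_ isT); lra.
Qed.

(** The decomposition of [q] is given at positive levels only; the bound reaches the supports by
    letting the level tend to 0. *)
Lemma width_bound0 : exists W : 'rV[R]_n -> R, forall u k,
  \sum_(i < k) suppf (fsupp (F i)) u + \sum_(i < k) suppf (fsupp (F i)) (- u) <= W u.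
Proof.
have [W hW] := width_bound; exists W => u k; apply/ler_addgt0Pr => e e0.
have e2 : 0 < e / 2 by rewrite divr_gt0.
have [a /andP[a0 a1] ha] := sum_fsupp_approx u k e2.
have [b /andP[b0 b1] hb] := sum_fsupp_approx (- u) k e2.
have m0 : 0 < Num.min a b by rewrite lt_min a0.
have := ha (Num.min a b); rewrite m0 ge_min lexx /= => /(_ isT) h1.
have := hb (Num.min a b); rewrite m0 ge_min lexx orbT /= => /(_ isT) h2.
have := hW (Num.min a b) u k; rewrite m0 ge_min a1 /= => /(_ isT); lra.
Qed.

(** The limit is built level by level: its cut at [a] is the Minkowski sum [halfspaces (T a)] of the
    cuts, and [xi x] is the supremum of the levels whose body contains [x]. The sum [halfspaces T0]
    of the supports is a closed subset of [K] containing all the cuts, hence the support of [xi]. *)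
Lemma fuzzy_series_limit : exists2 xi, FcconvK K xi & forall (a : R) u, 0 < a <= 1 ->
  \sum_(i < k) suppf (alpha_cut (F i) a) u @[k --> \oo] --> suppf (alpha_cut xi a) u.
Proof.
have [W0 hW0] := width_bound0; have [W hW] := width_bound.
have bF0 i := convex_body_fsupp (FF i).
have bF (a : R) (a01 : 0 < a <= 1) i := convex_body_cut (FF i) a01.
have cF0 i : fsupp (F i) (c i) by exact: cut_sub_fsupp (ltr01) _ (Fc i).
have [T0 hT0] := cvg_suppf_series bF0 cF0 cvg_c hW0.
have /choice[T hT] (a : R) : exists T : 'rV[R]_n -> R, 0 < a <= 1 ->
    forall u, \sum_(i < k) suppf (alpha_cut (F i) a) u @[k --> \oo] --> T u.
  have [a01|_] := boolP (0 < a <= 1); last by exists (fun=> 0).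
  have cF i : alpha_cut (F i) a (c i) by apply: Fc_cut; case/andP: a01.
  have [T hT] := cvg_suppf_series (bF a a01) cF cvg_c (fun u k => hW a u k a01).
  by exists T.
have bT (a : R) : 0 < a <= 1 -> convex_body (halfspaces (T a)) /\
    forall u, suppf (halfspaces (T a)) u = T a u.
  move=> a01; have cF i : alpha_cut (F i) a (c i) by apply: Fc_cut; case/andP: a01.
  split; first exact: convex_body_halfspaces (bF a a01) cF cvg_c (hT a a01).
  by move=> u; exact: suppf_halfspaces (bF a a01) cF cvg_c (hT a a01) u.
have le_lim (s t : nat -> R) (ls lt : R) : s @ \oo --> ls -> t @ \oo --> lt ->
    (forall k, s k <= t k) -> ls <= lt.
  by move=> hs ht st; apply: ler_cvg_to hs ht _; exact: nearW.
have TT0 (a : R) u : 0 < a <= 1 -> T a u <= T0 u.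
  move=> a01; apply: le_lim (hT a a01 u) (hT0 u) _ => k.
  by apply: ler_sum => i _; exact: suppf_fsupp_ge.
have Tmono (a b : R) u : 0 < a -> a <= b -> b <= 1 -> T b u <= T a u.
  move=> a0 ab b1; have b01 : 0 < b <= 1 by rewrite b1 (lt_le_trans a0).
  have a01 : 0 < a <= 1 by rewrite a0 (le_trans ab).
  apply: le_lim (hT b b01 u) (hT a a01 u) _ => k.
  by apply: ler_sum => i _; exact: suppf_cut_le.
(* Left continuity is inherited from [q]: between two levels a partial sum grows no more than [q],
   because the cuts of the remainder grow as well. *)
have Tleft (a e : R) u : 0 < a <= 1 -> 0 < e -> exists2 b, 0 < b < a & T b u <= T a u + e.
  move=> a01 e0; have [b /andP[b0 ba] hb] := cut_left_lim Fq u a01 e0.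
  have b01 : 0 < b <= 1 by rewrite b0 (le_trans (ltW ba))//; case/andP: a01.
  exists b; first by rewrite b0.
  have hTa : (fun k => \sum_(i < k) suppf (alpha_cut (F i) a) u + e) @ \oo --> T a u + e.
    by apply: cvgD; [exact: hT|exact: cvg_cst].
  apply: le_lim (hT b b01 u) hTa _ => k.
  have := qE k u a01; have := qE k u b01.
  have : suppf (alpha_cut (E k) a) u <= suppf (alpha_cut (E k) b) u.
    by apply: suppf_cut_le => //; [exact: ltW|case/andP: a01].
  lra.
(* A point of the sum is a series of points of the supports, all in [K]. *)
have M0K : halfspaces T0 `<=` K.
  move=> z /(halfspaces_decomp bF0 cF0 cvg_c hT0)[d Fd dz].
  by apply: (cone_series KD KZ _ dz) => i; apply: (FK i).2.
pose Lx x := [set a : R | 0 < a <= 1 /\ halfspaces (T a) x].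
pose xi x : R := sup (Lx x).
have Lub x : ubound (Lx x) 1 by move=> a [/andP[]].
have cutE (a : R) : 0 < a <= 1 -> alpha_cut xi a = halfspaces (T a).
  move=> /andP[a0 a1]; apply/seteqP; split => x; last first.
    by move=> Tx; apply: ub_le_sup; [exists 1 | split; rewrite ?a0].
  (* The supremum defining [xi x] need not be attained; levels close to it suffice by [Tleft]. *)
  rewrite /alpha_cut /= => ax u; apply/ler_addgt0Pr => e e0.
  have [|b /andP[b0 ba] hb] := Tleft a e u _ e0; first by rewrite a0.
  apply: le_trans hb.
  have [hs|/sup_out h0] := pselect (has_sup (Lx x)); last by move: ax; rewrite /xi h0 leNgt a0.
  have ab0 : 0 < xi x - b by rewrite subr_gt0 (lt_le_trans ba).
  have [b' [/andP[b'0 b'1] Tb'] bb'] := sup_adherent ab0 hs.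
  apply: le_trans (Tb' u) _; apply: Tmono => //.
  by move: bb'; rewrite /xi subKr => /ltW.
have pos_sub : [set x | 0 < xi x] `<=` halfspaces T0.
  move=> x /= x0 u.
  have [[[a [a01 Ta]] _]|/sup_out h0] := pselect (has_sup (Lx x)).
    by apply: le_trans (Ta u) _; exact: TT0.
  by move: x0; rewrite /xi h0 ltxx.
have fs_sub : fsupp xi `<=` halfspaces T0.
  rewrite /fsupp (closure_id (halfspaces T0)).1; last exact: closed_halfspaces.
  exact: closure_subset.
have cT0 : compact (halfspaces T0) by exact: compact_halfspaces.
have cfs : compact (fsupp xi) by apply: subclosed_compact cT0 fs_sub; exact: closed_closure.
exists xi; last by move=> a u a01; rewrite cutE// (bT a a01).2; exact: hT.
have one01 : 0 < (1 : R) <= 1 by rewrite ltr01 lexx.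
split; last by apply: subset_trans fs_sub M0K.
split.
- move=> x; rewrite sup_nonneg /=; last by move=> a [/andP[/ltW]].
  have [[h _]|/sup_out h0] := pselect (has_sup (Lx x)); first exact: ge_sup.
  by rewrite /xi h0 ler01.
- exact: compact_bounded.
- by move=> a a01; rewrite cutE//; exact: (bT a a01).1.
split => //.
  have [[x Tx] _ _] := (bT 1 one01).1; exists x; apply: subset_closure => /=.
  by have : alpha_cut xi 1 x; [rewrite cutE | exact: lt_le_trans].
apply: convex_closure; apply/convex_setP => x y t /= x0 y0 t01.
have [x01 y01] : xi x <= 1 /\ xi y <= 1.
  split.
    have [[h _]|/sup_out h0] := pselect (has_sup (Lx x)); first exact: ge_sup.
    by rewrite /xi h0 ler01.
  have [[h _]|/sup_out h0] := pselect (has_sup (Lx y)); first exact: ge_sup.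
  by rewrite /xi h0 ler01.
have m0 : 0 < Num.min (xi x) (xi y) by rewrite lt_min x0.
have m01 : 0 < Num.min (xi x) (xi y) <= 1 by rewrite m0 ge_min x01.
have : alpha_cut xi (Num.min (xi x) (xi y)) (t *: x + (1 - t) *: y).
  rewrite cutE//; have [[_ _ /convex_setP cvx] _] := bT _ m01.
  by apply: cvx => //; rewrite -cutE// /alpha_cut /= ge_min lexx ?orbT.
exact: lt_le_trans.
Qed.

End limit.
End fuzzy_series.

(** * Continuity of the metric and identification of limits in [B] *)

Section limits.
Context (R : realType) (m : nat).
Local Notation n := m.+1.
Local Notation sigma := (@sphere_measure R n).
Local Notation cyl := (@cyl_measure R n).
Local Notation I01 := (`]0, 1]%classic : set (measurableTypeR R)).
Context (p : R) (p1 : (1 <= p%:E)%E).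
Local Notation B := (LpB n p1).
Local Notation j := (support_embed p1).

Let p_ge1 : 1 <= p. Proof. by rewrite -lee_fin. Qed.
Let p_gt0 : 0 < p. Proof. exact: lt_le_trans ltr01 p_ge1. Qed.

Lemma dp_sym (xi eta : 'rV[R]_n -> R) : dp p xi eta = dp p eta xi.
Proof.
have h : (fun a => hausdorff_dist (alpha_cut xi a) (alpha_cut eta a) `^ p) =
         (fun a => hausdorff_dist (alpha_cut eta a) (alpha_cut xi a) `^ p).
  by apply/funext => a; rewrite hausdorff_distC.
exact: (congr1 (fun f => (\int[@lebesgue_measure R]_(a in `]0, 1]) f a) `^ p^-1) h).
Qed.

Lemma dp_continuity (M e : R) : 0 <= M -> 0 < e -> exists2 delta, 0 < delta &
  forall xi eta : 'rV[R]_n -> R, Fcconv xi -> Fcconv eta -> `|j xi| <= M ->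
  `|j xi - j eta| < delta -> dp p xi eta < e.
Proof.
move=> M0 e0; have ep : 0 < e `^ p by rewrite powR_gt0.
have q0 : 0 < (M + 1) `^ p + 1 by rewrite ltr_wpDl// powR_ge0.
(* Both norms will be at most [M + 1], since the distance is also kept below 1. The norm term is
   then at most [e^p / 2] and the difference term at most [e^p / 4], which sum to less than
   [e^p]. *)
have e10 : 0 < e `^ p / (4 * ((M + 1) `^ p + 1)) by rewrite divr_gt0// mulr_gt0.
have [C C0 hC] := dp_norm_bound m p1 e10.
have c0 : 0 < e `^ p / (4 * (C + 1)) by rewrite divr_gt0// mulr_gt0// ltr_wpDl.
exists (Num.min 1 ((e `^ p / (4 * (C + 1))) `^ p^-1)).
  by rewrite lt_min ltr01 powR_gt0.
move=> xi eta Fx Fe xM; rewrite lt_min => /andP[d1 d2].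
rewrite ltNge; apply/negP => he.
have := hC _ _ Fx Fe.
have h1 : e `^ p <= dp p xi eta `^ p.
  by rewrite ge0_ler_powR ?nnegrE ?dp_ge0 ?(ltW p_gt0)// ltW.
have eM : `|j eta| <= M + 1.
  have : `|j eta| <= `|j xi| + `|j xi - j eta|.
    by rewrite -[X in `|X| <= _](subKr (j xi)) ler_normB.
  lra.
move: (`|j xi|) (`|j eta|) (`|j xi - j eta|) (normr_ge0 (j xi)) (normr_ge0 (j eta)) (normr_ge0 (j xi - j eta)) xM d1 d2 eM.
move=> a b d a0 b0 d0 aM d1 d2 bM.
have h2 : a `^ p <= (M + 1) `^ p by rewrite ge0_ler_powR ?nnegrE ?(ltW p_gt0) ?addr_ge0//; lra.
have h3 : b `^ p <= (M + 1) `^ p by rewrite ge0_ler_powR ?nnegrE ?(ltW p_gt0) ?addr_ge0.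
have h4 : d `^ p <= e `^ p / (4 * (C + 1)).
  rewrite [leRHS](_ : _ = ((e `^ p / (4 * (C + 1))) `^ p^-1) `^ p); last first.
    by rewrite -powRrM mulVf ?gt_eqF// powRr1// ltW.
  by rewrite ge0_ler_powR ?nnegrE ?powR_ge0 ?(ltW p_gt0)// ltW.
have h5 : C * d `^ p <= e `^ p / 4.
  apply: le_trans (ler_wpM2l C0 h4) _.
  have C1 : 0 < C + 1 by rewrite ltr_wpDl.
  rewrite (_ : C * _ = e `^ p / 4 * (C / (C + 1))); last by field; rewrite gt_eqF.
  by rewrite ler_piMr ?divr_ge0 ?(ltW ep)// ler_pdivrMr// mul1r lerDl.
have h6 : e `^ p / (4 * ((M + 1) `^ p + 1)) * (a `^ p + b `^ p) <= e `^ p / 2.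
  have : a `^ p + b `^ p <= 2 * ((M + 1) `^ p + 1) by lra.
  move=> /(ler_wpM2l (ltW e10)) h; apply: le_trans h _.
  rewrite le_eqVlt; apply/orP; left; apply/eqP; field.
  by rewrite gt_eqF.
lra.
Qed.

Lemma cauchy_cvg_dotv (P : nat -> 'rV[R]_n) :
  (forall e : R, 0 < e -> exists N, forall k, (N <= k)%N -> enorm (P k - P N) < e) ->
  exists z, forall u, dotv u (P k) @[k --> \oo] --> dotv u z.
Proof.
move=> hP; have : cvg (P @ \oo).
  apply/cauchy_cvgP; apply: cauchy_exP => e e0; have [N hN] := hP e e0.
  exists (P N); exists N => // k /= Nk; rewrite -ball_normE /=.
  by apply: le_lt_trans (norm_le_enorm _) _; rewrite enorm_distC; exact: hN.
move=> /cvg_ex[z Pz]; exists z => u.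
exact: (cvg_comp _ _ Pz (continuous_dotv (u := u) (x := z))).
Qed.

Lemma measurable_dotv x : measurable_fun setT (fun u : 'rV[R]_n => dotv u x : measurableTypeR R).
Proof.
apply: (@lipschitz_measurable _ m _ (enorm x)); first exact: enorm_ge0.
by move=> u v; rewrite -dotvBl mulrC ler_dotv_enorm.
Qed.

(** On the cap of radius [1/2] around the direction of [x], the inner product with [x] is at least
    half the norm of [x]. This recovers base points from [L^1] estimates. *)
Lemma dotv_L1_bound : exists2 C, 0 < C & forall x : 'rV[R]_n,
  ((C * enorm x)%:E <= \int[sigma]_u `|dotv u x|%:E)%E.
Proof.
have h2 : 0 < 2^-1 :> R by rewrite invr_gt0.
have [c c0 hc] := cap_lower_bound (R := R) m h2; exists (c / 2); first by rewrite divr_gt0.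
move=> x; have [->|x0] := eqVneq x 0.
  by rewrite enorm0 mulr0; apply: integral_ge0 => u _; rewrite lee_fin.
have ex := enorm_gt0 x0; pose e := (enorm x)^-1 *: x.
have e1 : enorm e = 1 by rewrite enormZ ger0_norm ?invr_ge0 ?enorm_ge0// mulVf// gt_eqF.
have ed : dotv e x = enorm x by rewrite dotvZl -sqr_enorm expr2 mulKf// gt_eqF.
have mC := measurable_cap e 2^-1.
have ma : measurable_fun setT (fun u : 'rV[R]_n => `|dotv u x|%:E).
  by apply/measurable_EFinP; apply: measurableT_comp => //; exact: measurable_dotv.
apply: (@le_trans _ _ (\int[sigma]_(u in cap e 2^-1) (enorm x / 2)%:E)%E).
  rewrite integral_cst// (_ : c / 2 * enorm x = enorm x / 2 * c); last by ring.
  by rewrite EFinM lee_wpmul2l ?hc// lee_fin divr_ge0 ?enorm_ge0.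
apply: (@le_trans _ _ (\int[sigma]_(u in cap e 2^-1) `|dotv u x|%:E)%E).
  apply: ge0_le_integral => //.
  - by move=> u _; rewrite lee_fin divr_ge0 ?enorm_ge0.
  - exact: measurable_funTS.
  move=> u; rewrite /cap /= => ue; rewrite lee_fin; apply: le_trans (ler_norm _).
  have := dotv_le (e - u) x; rewrite dotvBl ed enorm_distC.
  have : enorm (u - e) * enorm x <= 2^-1 * enorm x by rewrite ler_wpM2r ?enorm_ge0// ltW.
  lra.
by apply: ge0_subset_integral => // u _; rewrite lee_fin.
Qed.

Lemma L1_csupp_le xi eta : Fcconv xi -> Fcconv eta ->
  (\int[cyl]_z `|(csupp xi z - csupp eta z)%R|%:E <= (2 * `|j xi - j eta|)%:E)%E.
Proof.
move=> Fx Fe; apply: le_trans (L1_le_norm (j xi - j eta)).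
rewrite le_eqVlt; apply/orP; left; apply/eqP; apply: ae_eq_integral => //.
- apply/measurable_EFinP; apply: measurableT_comp => //.
  by apply: measurable_funB; exact: measurable_csupp.
- by apply/measurable_EFinP; apply: measurableT_comp => //; exact: measurable_Lp_fun.
by move: (support_embed_sub p1 Fx Fe); apply: filterS => z h zT; rewrite h.
Qed.

Lemma cyl_integral_snd (g : 'rV[R]_n -> \bar R) : measurable_fun setT g -> (forall u, 0 <= g u)%E ->
  (\int[cyl]_z g z.2 = \int[sigma]_u g u)%E.
Proof.
move=> mg g0; rewrite (@cyl_integral _ _ (fun z => g z.2))//; last exact: measurableT_comp.
rewrite (@integral_cst _ _ _ _ _ _ (\int[sigma]_u g u)%E)//.
rewrite [X in (_ * X)%E](_ : _ = 1%E) ?mule1//.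
rewrite [LHS](@lebesgue_measure_itv R `]0, 1]%R) /= lte_fin ltr01 oppr0 adde0//.
Qed.

(** By Fatou's lemma, the [L^1] distance from [l] to the pointwise limit is at most the lower limit
    of the distances to the terms, which tend to 0. *)
Lemma support_embed_limit (x : nat -> 'rV[R]_n -> R) xi (l : B) :
  (forall k, Fcconv (x k)) -> Fcconv xi ->
  (forall (a : R) u, 0 < a <= 1 -> suppf (alpha_cut (x k) a) u @[k --> \oo] --> suppf (alpha_cut xi a) u) ->
  j (x k) @[k --> \oo] --> l -> j xi = l.
Proof.
move=> Fx Fxi xxi xl.
pose L := Lp_fun l; have mL := measurable_Lp_fun l.
pose g k z := `|(L z - csupp (x k) z)%R|%:E.
have mg k : measurable_fun setT (g k).
  apply/measurable_EFinP; apply: measurableT_comp => //.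
  by apply: measurable_funB => //; exact: measurable_csupp.
have g0 k z : (0 <= g k z)%E by rewrite lee_fin.
have gE k : (\int[cyl]_z g k z <= (2 * `|l - j (x k)|)%:E)%E.
  apply: le_trans (L1_le_norm (l - j (x k))).
  rewrite le_eqVlt; apply/orP; left; apply/eqP; apply: ae_eq_integral => //.
    by apply/measurable_EFinP; apply: measurableT_comp => //; exact: measurable_Lp_fun.
  move: (Lp_funB l (j (x k))) (support_embedE p1 (Fx k)).
  by apply: filterS2 => z h1 h2 zT; rewrite h1//= h2.
have glim z : g k z @[k --> \oo] --> (`|(L z - csupp xi z)%R|%:E : \bar R).
  apply: cvg_EFin; first exact: nearW.
  apply: cvg_norm; apply: cvgB; first exact: cvg_cst.
  rewrite /csupp; case: ifP => [a01|_]; last exact: cvg_cst.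
  exact: xxi.
have Ilim : (\int[cyl]_z g k z)%E @[k --> \oo] --> 0%E.
  apply: (@squeeze_cvge _ _ _ _ (fun=> 0%E) _ (fun k => (2 * `|l - j (x k)|)%:E)).
  - by apply: nearW => k; rewrite gE andbT; exact: integral_ge0.
  - exact: cvg_cst.
  apply: cvg_EFin; first exact: nearW.
  rewrite -[X in _ --> X](mulr0 2); apply: cvgM; first exact: cvg_cst.
  rewrite -(@normr0 _ B) -(subrr l); apply: cvg_norm; apply: cvgB => //; exact: cvg_cst.
have := @fatou _ _ _ cyl setT measurableT g (fun k => mg k) (fun k z _ => g0 k z).
rewrite (cvg_limn_einf_sup Ilim).1.
rewrite (_ : (fun z => limn_einf (g^~ z)) = fun z => `|(L z - csupp xi z)%R|%:E); last first.
  by apply/funext => z; rewrite (cvg_limn_einf_sup (glim z)).1.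
move=> I0; have mxi : measurable_fun setT (fun z => (L z - csupp xi z)%:E).
  by apply/measurable_EFinP; apply: measurable_funB => //; exact: measurable_csupp.
have /(ae_eq_integral_abs cyl measurableT mxi) h : (\int[cyl]_(z in setT) `|(L z - csupp xi z)%:E| = 0)%E.
  by apply/eqP; rewrite eq_le I0 integral_ge0.
apply/Lp_funP; move: (support_embedE p1 Fxi) h.
apply: filterS2 => z h1 h2 zT; rewrite h1//; move: (h2 zT) => /= -[] /eqP.
by rewrite subr_eq0 => /eqP.
Qed.

End limits.

(** * Limits of sequences with increments in the cone *)

Section left_limit.
Context (R : realType) (m : nat).
Local Notation n := m.+1.
Local Notation sigma := (@sphere_measure R n).
Local Notation cyl := (@cyl_measure R n).
Context (p : R) (p1 : (1 <= p%:E)%E).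
Local Notation B := (LpB n p1).
Local Notation j := (support_embed p1).
#[local] Existing Instance cyl_ae_filter.

Lemma cyl_le_integral (f g : measurableTypeR R * 'rV[R]_n -> \bar R) :
  measurable_fun setT f -> measurable_fun setT g -> (forall z, 0 <= f z)%E -> (forall z, 0 <= g z)%E ->
  (forall (a : measurableTypeR R) u, 0 < a <= 1 -> enorm u = 1 -> (f (a, u) <= g (a, u))%E) ->
  (\int[cyl]_z f z <= \int[cyl]_z g z)%E.
Proof.
move=> mf mg f0 g0 fg; apply: ae_ge0_le_integral => //.
have := @cyl_carrier R m; apply: filterS => -[a u] [a01 u1] _; exact: fg.
Qed.

Context (K : set 'rV[R]_n) (x D E : nat -> 'rV[R]_n -> R) (q : 'rV[R]_n -> R) (l : B).
Hypotheses (KD : forall u v, K u -> K v -> K (u + v))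
  (KZ : forall (a : R) u, 0 < a -> K u -> K (a *: u))
  (xK : forall k, FcconvK K (x k)) (DK : forall k, FcconvK K (D k))
  (FE : forall k, Fcconv (E k)) (Fq : Fcconv q)
  (xD : forall k, j (x k.+1) = j (x k) + j (D k))
  (xE : forall k, j q = j (x k) + j (E k))
  (xl : (fun k => j (x k)) @ \oo --> l).

(** The starting value followed by the increments, so that [x k] is the sum of the first [k + 1]
    terms. The remainders [E'] are shifted accordingly, with all of [q] left when no term has been
    taken. *)
Let F k := if k is k'.+1 then D k' else x 0%N.
Let E' k := if k is k'.+1 then E k' else q.

Let FK k : FcconvK K (F k). Proof. by case: k => [|k]; [exact: xK | exact: DK]. Qed.
Let FE' k : Fcconv (E' k). Proof. by case: k => [|k]; [exact: Fq | exact: FE]. Qed.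
Let Fx k : Fcconv (x k) := (xK k).1.
Let FF k : Fcconv (F k) := (FK k).1.

Let xS k (a : R) u : 0 < a <= 1 ->
  suppf (alpha_cut (x k) a) u = \sum_(i < k.+1) suppf (alpha_cut (F i) a) u.
Proof.
move=> a01; elim: k => [|k ih]; first by rewrite big_ord1.
by rewrite big_ord_recr /= -ih; exact: (support_embedD (Fx k) (DK k).1 (Fx k.+1) (xD k)).
Qed.

Let qS k (a : R) u : 0 < a <= 1 -> suppf (alpha_cut q a) u =
  \sum_(i < k) suppf (alpha_cut (F i) a) u + suppf (alpha_cut (E' k) a) u.
Proof.
case: k => [|k] a01; first by rewrite big_ord0 add0r.
by rewrite -xS//; exact: (support_embedD (Fx k) (FE k) Fq (xE k)).
Qed.

Section base_points.
Context (c : nat -> 'rV[R]_n).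
Hypothesis Fc : forall i, alpha_cut (F i) 1 (c i).
Let P k : 'rV[R]_n := \sum_(i < k) c i.
(** At levels in []0, 1]], a sum of nonnegative terms, hence nondecreasing in [k]. *)
Let y k (z : measurableTypeR R * 'rV[R]_n) : R := csupp (x k) z - dotv z.2 (P k.+1).

Let Fc_ub (a : R) u i : 0 < a <= 1 -> dotv u (c i) <= suppf (alpha_cut (F i) a) u.
Proof.
move=> a01; have [_ cF _] := convex_body_cut (FF i) a01.
by apply: suppf_ub => //; apply: cut_subset (Fc i); case/andP: a01.
Qed.

Let yE k (a : R) u : 0 < a <= 1 ->
  y k (a, u) = \sum_(i < k.+1) (suppf (alpha_cut (F i) a) u - dotv u (c i)).
Proof. by move=> a01; rewrite /y csupp_cutE// xS//= dotv_sumr sumrB. Qed.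

Let y_ge0 k (a : R) u : 0 < a <= 1 -> 0 <= y k (a, u).
Proof. by move=> a01; rewrite yE//; apply: sumr_ge0 => i _; rewrite subr_ge0 Fc_ub. Qed.

Let y_nd k l' (a : R) u : 0 < a <= 1 -> (k <= l')%N -> y k (a, u) <= y l' (a, u).
Proof.
move=> a01; elim: l' => [|l' ih]; first by rewrite leqn0 => /eqP ->.
rewrite leq_eqVlt => /orP[/eqP -> //|/ih h]; apply: (le_trans h).
by rewrite !yE// [leRHS]big_ord_recr lerDl subr_ge0 Fc_ub.
Qed.

(** The recentred value is at most the width of the partial sum, which is at most the width of
    [q]. *)
Let y_bound : exists2 M, 0 <= M & forall k (a : R) u, 0 < a <= 1 -> enorm u = 1 -> y k (a, u) <= M.
Proof.
have [M M0 qM] := fsupp_bounded Fq; exists (M + M) => [|k a u a01 u1]; first exact: addr_ge0.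
have qle v : enorm v = 1 -> suppf (alpha_cut q a) v <= M.
  move=> v1; have [q0 cq _] := convex_body_cut Fq a01.
  apply: suppf_le => // b /(cut_sub_fsupp (andP a01).1) /qM; apply: le_trans.
  by apply: le_trans (dotv_le _ _) _; rewrite v1 mul1r.
have h1 := qle u u1; have : enorm (- u) = 1 by rewrite enormN.
move=> /qle; move: h1; rewrite (qS k.+1 u a01) (qS k.+1 (- u) a01).
have [E0 cE _] := convex_body_cut (FE' k.+1) a01; have := suppfN E0 cE u.
suff : y k (a, u) <= \sum_(i < k.+1) suppf (alpha_cut (F i) a) u +
    \sum_(i < k.+1) suppf (alpha_cut (F i) a) (- u) by lra.
rewrite yE// sumrB lerD2l -sumrN; apply: ler_sum => i _; rewrite -dotvNl.
exact: Fc_ub.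
Qed.

Let my k : measurable_fun setT (fun z => `|y k z|%:E).
Proof.
apply/measurable_EFinP; apply: measurableT_comp => //; apply: measurable_funB.
  exact: measurable_csupp.
by apply: (measurableT_comp (measurable_dotv _)).
Qed.

Let A k : \bar R := (\int[cyl]_z `|y k z|%:E)%E.

Let A_le : exists M : R, forall k, (A k <= M%:E)%E.
Proof.
have [M M0 yM] := y_bound; exists M => k.
apply: (@le_trans _ _ (\int[cyl]_z M%:E)%E); last by rewrite integral_cst// cyl_setT mule1.
apply: cyl_le_integral => // a u a01 u1.
by rewrite lee_fin ger0_norm ?y_ge0// yM.
Qed.

(** The displacement of the base points is the increment of [csupp] minus that of [y]. The latter is
    nonnegative, so its [L^1] norm is the difference of the masses [A]; the inequality is arranged
    to avoid subtracting extended reals. *)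
Let A_base k l' : (k <= l')%N -> 
  (\int[cyl]_z `|dotv z.2 (P l'.+1 - P k.+1)|%:E + A k <= (2 * `|j (x l') - j (x k)|)%:E + A l')%E.
Proof.
move=> kl.
apply: le_trans (leeD (L1_csupp_le p1 (Fx l') (Fx k)) (lexx _)).
have md : measurable_fun setT (fun z : measurableTypeR R * 'rV[R]_n =>
    `|dotv z.2 (P l'.+1 - P k.+1)|%:E).
  apply/measurable_EFinP; apply: measurableT_comp => //.
  by apply: (measurableT_comp (measurable_dotv _)).
have mx : measurable_fun setT (fun z => `|(csupp (x l') z - csupp (x k) z)%R|%:E).
  apply/measurable_EFinP; apply: measurableT_comp => //.
  by apply: measurable_funB; exact: measurable_csupp.
rewrite /A -!ge0_integralD//; apply: cyl_le_integral => //.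
- exact: emeasurable_funD.
- exact: emeasurable_funD.
- by move=> z; rewrite adde_ge0.
- by move=> z; rewrite adde_ge0.
move=> a u a01 u1; rewrite -!EFinD lee_fin !(ger0_norm (y_ge0 _ _ _))//.
have ykl := y_nd u a01 kl.
have -> : dotv u (P l'.+1 - P k.+1) =
    (csupp (x l') (a, u) - csupp (x k) (a, u)) - (y l' (a, u) - y k (a, u)).
  by rewrite /y dotvBr /=; ring.
apply: (@le_trans _ _ (`|csupp (x l') (a, u) - csupp (x k) (a, u)| + (y l' (a, u) - y k (a, u)) + y k (a, u))).
  by rewrite lerD2r (le_trans (ler_normB _ _))// lerD2l ger0_norm// subr_ge0.
by rewrite -addrA subrK.
Qed.

Lemma base_points_cvg : exists z, forall u, \sum_(i < k) dotv u (c i) @[k --> \oo] --> dotv u z.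
Proof.
have [M AM] := A_le; have A0 k : (0 <= A k)%E by exact: integral_ge0.
have AE k : (fine (A k))%:E = A k.
  by apply: fineK; rewrite ge0_fin_numE// (le_lt_trans (AM k))// ltry.
have [C C0 hC] := dotv_L1_bound R m.
have base k l' : (k <= l')%N -> C * enorm (P l'.+1 - P k.+1) + fine (A k) <=
    2 * `|j (x l') - j (x k)| + fine (A l').
  move=> kl; rewrite -lee_fin !EFinD !AE; apply: le_trans (A_base kl).
  rewrite leeD2r// (@cyl_integral_snd R m (fun u => `|dotv u (P l'.+1 - P k.+1)|%:E))//.
  by apply/measurable_EFinP; apply: measurableT_comp => //; exact: measurable_dotv.
have Ac : cvgn (fun k => fine (A k)).
  apply: nondecreasing_is_cvgn.
    move=> k l' kl; rewrite -lee_fin !AE; apply: cyl_le_integral => // a u a01 u1.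
    by rewrite lee_fin !ger0_norm ?y_ge0// y_nd.
  by exists M => _ [k _ <-]; rewrite -lee_fin AE.
have [z Pz] : exists z, forall u, dotv u (P k) @[k --> \oo] --> dotv u z.
  apply: cauchy_cvg_dotv => e e0.
  (* With all terms within [e1] of their limits, the doubled norm contributes less than [4 e1] and
     the masses less than [2 e1], in total less than [C e]. *)
  have e1 : 0 < C * e / 8 by rewrite divr_gt0// mulr_gt0.
  move/cvg_ex: Ac => [a /cvgrPdist_lt/(_ _ e1)[N1 _ h1]].
  move: xl => /cvgrPdist_lt/(_ _ e1)[N2 _ h2].
  exists (maxn N1 N2).+1 => -[//|k]; rewrite ltnS => kN.
  have := base _ _ kN.
  have := h1 _ (leq_trans (leq_maxl N1 N2) kN); have := h1 _ (leq_maxl N1 N2).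
  have := h2 _ (leq_trans (leq_maxr N1 N2) kN); have := h2 _ (leq_maxr N1 N2).
  move=> /= a1 a2 b1 b2; rewrite -(ltr_pM2l C0).
  have := ler_normD (j (x k) - l) (l - j (x (maxn N1 N2))).
  rewrite addrA subrK (distrC (j (x k)) l).
  move: b1 b2; rewrite !ltr_norml => /andP[b1 b1'] /andP[b2 b2'].
  lra.
by exists z => u; under eq_fun do rewrite -dotv_sumr; exact: Pz.
Qed.

End base_points.

Lemma left_limit_exists : exists2 xi, FcconvK K xi & j xi = l.
Proof.
have /choice[c Fc] i : exists c, alpha_cut (F i) 1 c.
  by have [] := convex_body_cut (FF i) (_ : 0 < (1 : R) <= 1); rewrite ?ltr01 ?lexx.
have [zc cc] := base_points_cvg Fc.
have [xi xiK hxi] := fuzzy_series_limit KD KZ FK FE' Fq Fc cc qS.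
exists xi => //; apply: (support_embed_limit Fx xiK.1 _ xl) => a u a01.
under eq_fun do rewrite xS//.
by have := hxi a u a01; rewrite -cvg_shiftS.
Qed.

End left_limit.

(** * The process *)

Section process.
Context (R : realType) (m : nat).
Local Notation n := m.+1.
Context (p : R) (p1 : (1 <= p%:E)%E).
Local Notation B := (LpB n p1).
Local Notation j := (support_embed p1).
Context (K : set 'rV[R]_n) (dO : measure_display) (Omega : measurableType dO)
  (P : probability Omega R) (X : R -> Omega -> B).
Hypotheses (KD : forall u v, K u -> K v -> K (u + v))
  (KZ : forall (a : R) u, 0 < a -> K u -> K (a *: u))
  (hX : levy_process P X)
  (mK : measurable (cone_embed p1 K : set (Borel B)))
  (hval : forall (t : R) (w : Omega), 0 <= t -> cone_embed p1 K (X t w)).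
Let Xs (t : R) (w : Omega) := support_embed_inv p1 (X t w).

Let XsK (t : R) w : 0 <= t -> FcconvK K (Xs t w) /\ j (Xs t w) = X t w.
Proof.
move=> t0; have [xi xiK xiE] := hval w t0.
by rewrite /Xs -xiE support_embedK//; exact: xiK.1.
Qed.

Let dp_Xs (t s : R) w : 0 <= t -> 0 <= s ->
  dp p (Xs t w) (Xs s w) = dp_of (X t w - X s w).
Proof.
move=> t0 s0; have [[Ft _] jt] := XsK w t0; have [[Fs _] js] := XsK w s0.
by rewrite (dp_ofE p1 Ft Fs) jt js.
Qed.

Lemma fuzzy_start : {ae P, forall w, Xs 0 w = @fuzzy0 R n}.
Proof.
move: (levy_start hX); apply: filterS => w X0.
by rewrite /Xs X0 -(support_embed_fuzzy0 m p1) support_embedK//; exact: Fcconv_fuzzy0.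
Qed.

Lemma fuzzy_indep : independent_increments P
  (fun s t w => dp p (Xs t w) (Xs s w) : measurableTypeR R).
Proof.
move=> N t t0 tS; have [mX iX] := levy_indep hX t0 tS.
have tge i : (i <= N)%N -> 0 <= t i.
  by elim: i => [//|i ih] iN; rewrite (le_trans (ih (ltnW iN)))// ltW// tS.
have E : (fun (i : 'I_N) w => dp p (Xs (t i.+1) w) (Xs (t i) w) : measurableTypeR R) =
         (fun i => (@dp_of R m p p1 : Borel B -> measurableTypeR R) \o (fun w => X (t i.+1) w - X (t i) w)).
  by apply/funext => i; apply/funext => w /=; rewrite dp_Xs ?tge// ltnW.
rewrite E; split=> [i|A mA].
  exact: (measurableT_comp (@measurable_dp_of R m p p1) (mX i)).
apply: (iX (fun i => (@dp_of R m p p1 : Borel B -> measurableTypeR R) @^-1` A i)) => i.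
by rewrite -[X in measurable X]setTI; exact: (@measurable_dp_of R m p p1).
Qed.

Lemma fuzzy_stationary : stationary_increments P
  (fun s t w => dp p (Xs t w) (Xs s w) : measurableTypeR R).
Proof.
move=> s t s' t' /andP[s0 st] /andP[s'0 st'] e A mA.
have E (a b : R) : 0 <= a -> a < b -> P ((fun w => dp p (Xs b w) (Xs a w)) @^-1` A) =
    P ((fun w => X b w - X a w) @^-1` ((@dp_of R m p p1 : Borel B -> measurableTypeR R) @^-1` A)).
  move=> a0 ab; apply: congr1; apply: eq_set => w.
  by rewrite /preimage /= dp_Xs// (le_trans a0)// ltW.
apply: etrans (E _ _ s0 st) (etrans _ (esym (E _ _ s'0 st'))).
apply: (levy_stationary hX _ _ e); rewrite ?s0 ?s'0 ?st ?st'//.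
by rewrite -[X in measurable X]setTI; exact: (@measurable_dp_of R m p p1).
Qed.

(** Read off the independence of a single increment: continuity of the subtraction alone gives
    measurability for the Borel sets of [B * B], not for the product sigma-algebra. *)
Let measurable_incr (s t : R) : 0 <= s -> s <= t ->
  measurable_fun setT (fun w => X t w - X s w : Borel B).
Proof.
move=> s0; rewrite le_eqVlt => /orP[/eqP <-|st].
  by under eq_fun do rewrite subrr; exact: measurable_cst.
have [|mX _] := levy_indep hX (n := 1) (t := fun i => if i is 0%N then s else t) s0.
  by case.
exact: (mX ord0).
Qed.

Let measurable_incr_norm (s t e : R) : 0 <= s -> 0 <= t ->
  measurable [set w | e < `|X t w - X s w|].
Proof.
move=> s0 t0; wlog st : s t s0 t0 / s <= t.
  move=> h; have [|/ltW ts] := leP s t; first exact: h.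
  by under eq_set do rewrite distrC; exact: h.
rewrite -[X in measurable X]setTI.
apply: (measurable_incr s0 st measurableT (Y := [set b : B | e < `|b|])).
apply: sub_sigma_algebra; apply: (@open_comp _ _ (fun b : B => `|b|) [set x : R | e < x]).
  by move=> b _; exact: norm_continuous.
exact: open_gt.
Qed.

Let measurable_dp_Xs (s t e : R) : 0 <= s -> 0 <= t ->
  measurable [set w | e < dp p (Xs t w) (Xs s w)].
Proof.
move=> s0 t0; wlog st : s t s0 t0 / s <= t.
  move=> h; have [|/ltW ts] := leP s t; first exact: h.
  by under eq_set do rewrite dp_sym; exact: h.
under eq_set do rewrite dp_Xs//.
rewrite -[X in measurable X]setTI.
apply: (measurableT_comp (@measurable_dp_of R m p p1) (measurable_incr s0 st) measurableT (Y := [set x : R | e < x])).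
have <- : `]e, +oo[%classic = [set x | e < x] by rewrite set_itvE.
exact: measurable_itv.
Qed.

(** Supplies, outside an event of small probability, the norm bound under which [dp_continuity]
    applies. *)
Let norm_tight (t e : R) : 0 <= t -> 0 < e -> exists2 M, 0 <= M &
  measurable [set w | M < `|X t w|] /\ (P [set w | (M < `|X t w|)%R] < e%:E)%E.
Proof.
move=> t0 e0; pose F k := [set w | k%:R < `|X t w|].
have mF k : measurable (F k).
  rewrite -[X in measurable X]setTI.
  apply: (levy_random hX t0 measurableT (Y := [set b : B | k%:R < `|b|])).
  apply: sub_sigma_algebra; apply: (@open_comp _ _ (fun b : B => `|b|) [set x : R | k%:R < x]).
    by move=> b _; exact: norm_continuous.
  exact: open_gt.
have F0 : \bigcap_k F k = set0.
  rewrite -subset0 => w /(_ (Num.bound `|X t w|) I); rewrite /F /= ltNge => /negP; apply.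
  by rewrite ltW// archi_boundP.
have : (P \o F) k @[k --> \oo] --> 0%E.
  rewrite -(measure0 P) -F0; apply: nonincreasing_cvg_mu => //.
  - by rewrite (le_lt_trans (probability_le1 _ _))// ltry.
  - exact: bigcap_measurable.
  move=> k l kl; apply/subsetPset => w; rewrite /F /=; apply: le_lt_trans.
  by rewrite ler_nat.
move=> /fine_cvgP[_] /cvgrPdist_lt/(_ _ e0)[N _ /(_ _ (leqnn N))] /=.
rewrite sub0r normrN ger0_norm ?fine_ge0// => h; exists N%:R => //; split; first exact: mF.
by rewrite -[X in (X < _)%E]fineK ?lte_fin// fin_num_measure//; exact: mF.
Qed.

Lemma fuzzy_stoch_cont :
  stochastically_continuous P (fun t s w => dp p (Xs t w) (Xs s w)).
Proof.
move=> t t0 eps eps0; apply/fine_cvgP.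
have fs s : 0 <= s -> P [set w | eps < dp p (Xs t w) (Xs s w)] \is a fin_num.
  by move=> s0; apply: fin_num_measure; exact: measurable_dp_Xs.
have near0 : \forall s \near within [set s | 0 <= s] (nbhs t), 0 <= s by exact: withinT.
split; first by apply: filterS near0.
apply/cvgrPdist_lt => e e0; have e2 : 0 < e / 2 by rewrite divr_gt0.
have [M M0 [mM PM]] := norm_tight t0 e2.
have [delta d0 hd] := dp_continuity m p1 M0 eps0.
(* Outside the event the increment is only known to be at most the threshold; halving [delta]
   restores the strict inequality. *)
have d2 : 0 < delta / 2 by rewrite divr_gt0.
have /fine_cvgP[_] := levy_stoch_cont hX t0 d2.
move=> /cvgrPdist_lt/(_ _ e2); apply: filterS2 near0 => s s0 /=.
have mI := measurable_incr_norm (delta / 2) s0 t0.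
rewrite !sub0r !normrN !ger0_norm ?fine_ge0// => h.
rewrite -lte_fin fineK ?fs//.
apply: (@le_lt_trans _ _ (P ([set w | M < `|X t w|] `|` [set w | delta / 2 < `|X t w - X s w|]))).
  apply: le_measure; rewrite ?inE; [exact: measurable_dp_Xs|exact: measurableU|].
  move=> w /= hw; have [?|Mw] := ltP M `|X t w|; first by left.
  right; rewrite ltNge; apply/negP => hs; move: hw.
  have [[Ft _] jt] := XsK w t0; have [[Fs _] js] := XsK w s0.
  rewrite ltNge ltW// hd// ?jt ?js//; lra.
apply: le_lt_trans (measureU2 P mM mI) _.
rewrite [X in (_ < X%:E)%E](splitr e) EFinD lteD//.
by rewrite -[X in (X < _)%E]fineK ?lte_fin// fin_num_measure.
Qed.

Let incr_cone (s t : R) : 0 <= s -> s < t -> {ae P, forall w, cone_embed p1 K (X t w - X s w)}.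
Proof.
move=> s0 st; have mC : measurable (~` (cone_embed p1 K : set (Borel B))) by exact: measurableC.
exists ((fun w => X t w - X s w : Borel B) @^-1` (~` cone_embed p1 K)); split => //.
  by rewrite -[X in measurable X]setTI; apply: measurable_incr (ltW st) _ _ _.
have ts : 0 <= (0 : R) < t - s by rewrite lexx subr_gt0.
rewrite (levy_stationary hX (s' := 0) (t' := t - s))// ?s0 ?subr0//.
have [N [mN PN hN]] := levy_start hX.
apply/eqP; rewrite eq_le measure_ge0 andbT -PN; apply: le_measure; rewrite ?inE//.
  by rewrite -[X in measurable X]setTI; apply: measurable_incr => //; case/andP: ts => _ /ltW.
move=> w hw; apply: hN => X0; apply: hw; rewrite /= X0 subr0.
by apply: hval; rewrite subr_ge0 ltW.
Qed.

Let rational_incr_cone : {ae P, forall w, forall q r : rat, 0 <= ratr q :> R ->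
  ratr q < ratr r :> R -> cone_embed p1 K (X (ratr r) w - X (ratr q) w)}.
Proof.
pose Q k : rat := odflt 0 (unpickle k).
have h : {ae P, forall w, forall a b : nat, 0 <= ratr (Q a) :> R ->
    ratr (Q a) < ratr (Q b) :> R -> cone_embed p1 K (X (ratr (Q b)) w - X (ratr (Q a)) w)}.
  apply/ae_foralln => a; apply/ae_foralln => b.
  have [a0|a0] := leP 0 (ratr (Q a) : R); last exact: nearW.
  have [ab|ab] := ltP (ratr (Q a) : R) (ratr (Q b)); last exact: nearW.
  by move: (incr_cone a0 ab); apply: filterS.
by move: h; apply: filterS => w h q r; have := h (pickle q) (pickle r); rewrite /Q !pickleK.
Qed.

Let Xs_left_limit (t : R) w (l : B) : 0 < t ->
  (forall q r : rat, 0 <= ratr q :> R -> ratr q < ratr r :> R ->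
    cone_embed p1 K (X (ratr r) w - X (ratr q) w)) ->
  `|X s w - l| @[s --> t^'-] --> 0 -> exists2 xi, FcconvK K xi & j xi = l.
Proof.
move=> t0 hcone /cvg_at_leftP hl.
(* One rational between consecutive [a k] gives a strictly increasing sequence of nonnegative
   rationals that tends to [t] from below. *)
pose a k : R := t * (k%:R / k.+1%:R).
have aS k : a k < a k.+1.
  rewrite ltr_pM2l// ltr_pdivrMr// mulrAC ltr_pdivlMr// -!natrM ltr_nat.
  by rewrite mulnS mulSn addSn.
have /choice[q hq] k : exists q : rat, a k < ratr q < a k.+1.
  by have [q] := rat_in_itvoo (aS k); rewrite in_itv/=; exists q.
have q0 k : 0 <= ratr (q k) :> R.
  have /andP[/ltW + _] := hq k; apply: le_trans.
  by rewrite mulr_ge0 ?(ltW t0)// divr_ge0.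
have qS k : ratr (q k) < ratr (q k.+1) :> R.
  by have /andP[_ h] := hq k; have /andP[h' _] := hq k.+1; exact: lt_trans h'.
have at_ k : a k < t by rewrite gtr_pMr// ltr_pdivrMr// mul1r ltr_nat.
have qt k : ratr (q k) < t by have /andP[_ h] := hq k; exact: lt_trans h (at_ _).
have [r] : exists r : rat, ratr r \in `]t, t + 1[ by apply: rat_in_itvoo; rewrite ltrDl.
rewrite in_itv/= => /andP[tr _].
have qcvg : ratr (q k) @[k --> \oo] --> t.
  have acvg : a k @[k --> \oo] --> t.
    have E k : a k = t - t * harmonic k.
      by rewrite /a /harmonic /=; field; rewrite gt_eqF// ltr0Sn.
    under eq_fun do rewrite E.
    have : t - t * harmonic k @[k --> \oo] --> t - t * 0.
      by apply: cvgB; [exact: cvg_cst|apply: cvgM; [exact: cvg_cst|exact: cvg_harmonic]].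
    by rewrite mulr0 subr0.
  apply: (squeeze_cvgr _ acvg (cvg_cst t)); apply: nearW => k.
  by rewrite (ltW (qt k)) andbT; have /andP[/ltW] := hq k.
have Xl : X (ratr (q k)) w @[k --> \oo] --> l.
  apply/cvgrPdist_lt => e e0; have := hl (fun k => ratr (q k)) (conj qt qcvg).
  move=> /cvgrPdist_lt/(_ _ e0); apply: filterS => k.
  by rewrite sub0r normrN normr_id distrC.
have /choice[D hD] k : exists D, FcconvK K D /\ j D = X (ratr (q k.+1)) w - X (ratr (q k)) w.
  by have [D DK DE] := hcone _ _ (q0 k) (qS k); exists D.
have /choice[E hE] k : exists E, Fcconv E /\ j E = X (ratr r) w - X (ratr (q k)) w.
  by have [E [FE _] EE] := hcone _ r (q0 k) (lt_trans (qt k) tr); exists E.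
have r0 : 0 <= ratr r :> R by exact: le_trans (ltW t0) (ltW tr).
apply: (@left_limit_exists R m p p1 K (fun k => Xs (ratr (q k)) w) D E (Xs (ratr r) w)) => //.
- by move=> k; exact: (XsK w (q0 k)).1.
- by move=> k; exact: (hD k).1.
- by move=> k; exact: (hE k).1.
- exact: (XsK w r0).1.1.
- by move=> k; rewrite !(XsK w (q0 _)).2 (hD k).2 subrKC.
- by move=> k; rewrite (XsK w r0).2 (XsK w (q0 _)).2 (hE k).2 subrKC.
by under eq_fun do rewrite (XsK w (q0 _)).2.
Qed.

Let dp_cvg (F : set_system R) (xi : 'rV[R]_n -> R) w : Filter F -> Fcconv xi ->
  (\forall s \near F, 0 <= s) -> `|X s w - j xi| @[s --> F] --> 0 -> dp p (Xs s w) xi @[s --> F] --> 0.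
Proof.
move=> FF Fxi near0 hl; apply/cvgrPdist_lt => e e0.
have [delta d0 hd] := dp_continuity m p1 (normr_ge0 (j xi)) e0.
move: hl => /cvgrPdist_lt/(_ _ d0); apply: filterS2 near0 => s s0.
have [[Fs _] js] := XsK w s0.
rewrite !sub0r !normrN normr_id ger0_norm ?dp_ge0// distrC dp_sym -js => h.
exact: hd.
Qed.

Lemma fuzzy_cadlag : {ae P, forall w, cadlag (FcconvK K) (dp p) (Xs ^~ w)}.
Proof.
move: (levy_cadlag hX) rational_incr_cone; apply: filterS2 => w [rc ll] hcone; split => t t0.
  have [[Ft _] jt] := XsK w t0; apply: dp_cvg => //; last by rewrite jt; exact: rc.
  (* The path is known to lie in the cone at nonnegative times only. *)
  by near=> s; rewrite (le_trans t0)// ltW//; near: s; exact: nbhs_right_gt.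
have [l _ hl] := ll t t0; have [xi xiK xil] := Xs_left_limit t0 hcone hl.
exists xi => //; apply: dp_cvg => //; [exact: xiK.1| |by rewrite xil].
by near=> s; apply: ltW; near: s; exact: nbhs_left_gt.
Unshelve. all: by end_near. Qed.

End process.

Theorem theorem4p4 (R : realType) (d : nat) (d1 : (1 < d)%N)
  (p : R) (p1 : (1 <= p%:E)%E)
  (K : set 'rV[R]_d) (hK : proper_convex_cone K)
  (dO : measure_display) (Omega : measurableType dO) (P : probability Omega R)
  (X : R -> Omega -> LpB d p1)
  (A : (LpB d p1 -> R) -> LpB d p1)
  (Pi : {measure set (Borel (LpB d p1)) -> \bar R})
  (gamma : LpB d p1)
  (hX : levy_process P X)
  (htriplet : generating_triplet P X A Pi gamma)
  (ha : forall l, topdual l -> A l = 0)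
  (hb : measurable (cone_embed p1 K : set (Borel (LpB d p1))) /\
        Pi (~` cone_embed p1 K) = 0%E)
  (hc : exists2 I, Pettis_centering Pi I & cone_embed p1 K (gamma - I))
  (hval : forall (t : R) (w : Omega), 0 <= t -> cone_embed p1 K (X t w)) :
  let Xs (t : R) (w : Omega) := support_embed_inv p1 (X t w) in
  [/\ {ae P, forall w, Xs 0 w = @fuzzy0 R d},
      independent_increments P
        (fun s t w => dp p (Xs t w) (Xs s w) : measurableTypeR R) /\
      stationary_increments P
        (fun s t w => dp p (Xs t w) (Xs s w) : measurableTypeR R),
      stochastically_continuous P (fun t s w => dp p (Xs t w) (Xs s w)) &
      {ae P, forall w, cadlag (FcconvK K) (dp p) (Xs ^~ w)}].
Proof.
have {htriplet ha hc A gamma} mK := hb.1; move=> {hb Pi}.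
case: d d1 K hK X hX mK hval => [//|m _ K [KD KZ _] X hX mK hval].
split.
- exact: (fuzzy_start hX).
- by split; [exact: fuzzy_indep hX hval | exact: fuzzy_stationary hX hval].
- exact: fuzzy_stoch_cont hX hval.
- exact: fuzzy_cadlag KD KZ hX mK hval.
Qed.
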